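(* The following equalities hold: $$\lim_{n\to\infty}\frac{GR(n,12,62)}{n^2}=\frac{9}{22},\qquad \lim_{n\to\infty}\frac{GR(n,14,86)}{n^2}=\frac{5}{12},\qquad \lim_{n\to\infty}\frac{GR(n,16,114)}{n^2}=\frac{9}{22}.$$
   Context: For integers $p\geq 3$ and $2\le q\le\binom{p}{2}$, a $(p,q)$-colouring of the complete graph $K_n$ is a colouring of the edges of $K_n$ such that every set of $p$ vertices spans edges of at least $q$ distinct colours. The generalised Ramsey number $GR(n,p,q)$ is the minimum number of colours in a $(p,q)$-colouring of $K_n$. *)

(* Defs.v *)
From mathcomp Require Import all_boot.
Set Implicit Arguments. Unset Strict Implicit. Unset Printing Implicit Defensive.

(* An edge colouring of K_n with colours in 'I_k: a symmetric function on
   ordered pairs of vertices; only pairs (i,j) with i != j (edges) matter. *)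
Definition edge_colouring (n k : nat) (c : {ffun 'I_n * 'I_n -> 'I_k}) : bool :=
  [forall x : 'I_n * 'I_n, c (x.1, x.2) == c (x.2, x.1)].

Definition span_colours (n k : nat) (c : {ffun 'I_n * 'I_n -> 'I_k})
  (S : {set 'I_n}) : {set 'I_k} :=
  [set c x | x : 'I_n * 'I_n & [&& x.1 \in S, x.2 \in S & x.1 != x.2]].

Definition pq_colouring (n p q k : nat) (c : {ffun 'I_n * 'I_n -> 'I_k}) : bool :=
  edge_colouring c &&
  [forall S : {set 'I_n}, (#|S| == p) ==> (q <= #|span_colours c S|)].

Definition has_pq_colouring (n p q k : nat) : bool :=
  [exists c : {ffun 'I_n * 'I_n -> 'I_k}, pq_colouring p q c].

(* GR(n,p,q): least k such that a (p,q)-colouring of K_n with k colours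
   exists.  The search is over k <= n*n, which is harmless: a colouring
   uses at most n*n distinct colours, so if any (p,q)-colouring exists
   (e.g. whenever q <= 'C(p,2)) the minimum is found in this range. *)
Definition GR (n p q : nat) : nat :=
  find (has_pq_colouring n p q) (iota 0 (n * n).+1).

(* Main.v *)
(** Let k = 5, 6, 7, so that p = 2k + 2 and q = C(p, 2) - k + 1. A colouring is a
    (p, q)-colouring when no k repetitions of colours take place within 2k + 2 vertices, so
    the question is how many repetitions are possible.

    Constructions. A block is a pair of disjoint edges which receive the same colour. One
    packs copies of a gadget of blocks into K_n: for k = 6 it is a single K_4 with a block,
    covering 6 pairs; for k = 5, 7 it is made of squares, each with 2 blocks and covering
    about 11 pairs. The copies may not share covered pairs, and i of them with 3 <= i <= 7
    may not be too dense. A random greedy procedure (a nibble with weights, in which the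
    expectation of the total weight of the available copies is controlled exactly and all
    errors come from few degenerate configurations) covers almost all pairs, up to an
    arbitrarily small proportion reserved for the other pairs of the copies.

    Lower bounds. Each repetition gives a set of 3 or 4 vertices, the union of an edge with the
    chosen edge of its colour. After the deletion of O(n) of them, the components for the
    relation of sharing two vertices have s < k elements, 2s + 2 vertices and at least
    5s + 1 pairs covered by their elements. Two elements which share two vertices also span
    4 further pairs, of which most are covered by no element at all, and each such pair
    arises from at most two components. Counting all pairs of vertices then
    gives at most n^2 / 11 or n^2 / 12 repetitions, asymptotically. *)

From mathcomp Require Import all_boot all_order all_algebra fingroup perm zify.
From mathcomp Require ring lra.
Require Import Defs.
From Stdlib Require Classical_Prop.
Set Implicit Arguments. Unset Strict Implicit. Unset Printing Implicit Defensive.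

(** * A correlation inequality for product measures *)

(** The parity of k decides the gadget. Three squares with both their blocks can span just 14
    vertices, the number forbidden for k = 6, whereas an odd number of blocks leaves some square
    with a single block, and its private vertices cost one vertex more. A square has 15 pairs; to
    cover only about 11 pairs for each square, four of them must be shared by many squares.
    Incidences of points and lines give this sharing without 4-cycles; with a 4-cycle, seven blocks
    could lie on 16 vertices.

    Pairs of a copy that its gadget does not cover may be common to two copies, but must not be
    covered by another copy. They are therefore required to lie in a random set of small density
    which no copy may cover.

    The nibble needs no concentration inequality. A copy is weighted by the inverse of its
    probability of survival, so its mean weight stays near 1, and one second moment, that of the
    degrees, shows that most pairs behave well. The number of steps is fixed, so the weights are
    bounded independently of n and every degenerate configuration is negligible for large n. *)

Module Correlation.
Import mathcomp.algebra_tactics.ring mathcomp.algebra_tactics.lra.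
Import Order.TTheory GRing.Theory Num.Theory.

Local Open Scope ring_scope.

Section ProductMeasure.
Variables (R : realFieldType) (T : finType) (p : T -> R).

(** The accumulator [Z] holds the coordinates already drawn, each [c] being drawn independently with
    probability [p c]. The recursion over a list turns every inequality below into an induction on
    coordinates. *)
Fixpoint Exl (l : seq T) (F : {set T} -> R) (Z : {set T}) : R :=
  if l is c :: l' then p c * Exl l' F (c |: Z) + (1 - p c) * Exl l' F Z
  else F Z.

Definition Ex (F : {set T} -> R) : R := Exl (enum T) F set0.

Lemma eq_Exl l F G Z : F =1 G -> Exl l F Z = Exl l G Z.
Proof. by move=> FG; elim: l Z => [|c l IH] Z /=; rewrite ?FG ?IH. Qed.

Lemma ExlD l F G Z : Exl l (fun W => F W + G W) Z = Exl l F Z + Exl l G Z.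
Proof. by elim: l Z => [|c l IH] Z //=; rewrite !IH; ring. Qed.

Lemma ExlZ l a F Z : Exl l (fun W => a * F W) Z = a * Exl l F Z.
Proof. by elim: l Z => [|c l IH] Z //=; rewrite !IH; ring. Qed.

Lemma Exl_cst l a Z : Exl l (fun=> a) Z = a.
Proof. by elim: l Z => [|c l IH] Z //=; rewrite !IH; ring. Qed.

Lemma Exl_sum I (r : seq I) (P : pred I) (F : I -> {set T} -> R) l Z :
  Exl l (fun W => \sum_(i <- r | P i) F i W) Z = \sum_(i <- r | P i) Exl l (F i) Z.
Proof.
elim: r => [|i r IH].
  by rewrite big_nil -[RHS](Exl_cst l 0 Z); apply: eq_Exl => W; rewrite big_nil.
rewrite big_cons -IH; case: ifP => Pi; last first.
  by apply: eq_Exl => W; rewrite big_cons Pi.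
by rewrite -ExlD; apply: eq_Exl => W; rewrite big_cons Pi.
Qed.

Lemma Exl_setU1 l F c Z : Exl l F (c |: Z) = Exl l (fun W => F (c |: W)) Z.
Proof. by elim: l Z => [|b l IH] Z //=; rewrite -!IH setUCA. Qed.

Hypothesis p01 : forall t, 0 <= p t <= 1.

Let p_ge0 t : 0 <= p t. Proof. by case/andP: (p01 t). Qed.
Let p_le1 t : 0 <= 1 - p t. Proof. by case/andP: (p01 t); rewrite subr_ge0. Qed.

Lemma le_Exl l F G Z : (forall W, F W <= G W) -> Exl l F Z <= Exl l G Z.
Proof.
move=> FG; elim: l Z => [|c l IH] Z //=.
by apply: lerD; apply: ler_wpM2l => //.
Qed.

Lemma Exl_ge0 l F Z : (forall W, 0 <= F W) -> 0 <= Exl l F Z.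
Proof. by move=> F0; rewrite -[leLHS](Exl_cst l 0 Z); apply: le_Exl. Qed.

Definition antitone (F : {set T} -> R) := forall A B : {set T}, A \subset B -> F B <= F A.
Definition monotone (F : {set T} -> R) := forall A B : {set T}, A \subset B -> F A <= F B.

Lemma Exl_antitone l F Z c : antitone F -> Exl l F (c |: Z) <= Exl l F Z.
Proof. by move=> aF; rewrite Exl_setU1; apply: le_Exl => W; apply/aF/subsetUr. Qed.

(** Harris's inequality: conditioning on one coordinate leaves the covariance [p c * (1 - p c) *
    ((f0 - f1) * (g0 - g1))], whose last two factors are nonnegative. *)
Lemma harris_anti l F G Z : antitone F -> antitone G ->
  Exl l F Z * Exl l G Z <= Exl l (fun W => F W * G W) Z.
Proof.
move=> aF aG; elim: l Z => [|c l IH] Z //=.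
set f1 := Exl l F (c |: Z); set f0 := Exl l F Z.
set g1 := Exl l G (c |: Z); set g0 := Exl l G Z.
apply: (@le_trans _ _ (p c * (f1 * g1) + (1 - p c) * (f0 * g0))); last first.
  by apply: lerD; apply: ler_wpM2l; rewrite ?p_ge0 ?p_le1 // ?IH.
rewrite -subr_ge0.
suff -> : p c * (f1 * g1) + (1 - p c) * (f0 * g0) -
   (p c * f1 + (1 - p c) * f0) * (p c * g1 + (1 - p c) * g0)
   = p c * (1 - p c) * ((f0 - f1) * (g0 - g1)) by
  rewrite !mulr_ge0 // subr_ge0; apply: Exl_antitone.
by ring.
Qed.

Lemma ExlN l F Z : Exl l (fun W => - F W) Z = - Exl l F Z.
Proof.
by rewrite -mulN1r -ExlZ; apply: eq_Exl => W; rewrite mulN1r.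
Qed.

Lemma harris_mono l F G Z : monotone F -> monotone G ->
  Exl l F Z * Exl l G Z <= Exl l (fun W => F W * G W) Z.
Proof.
move=> mF mG.
have := @harris_anti l (fun W => - F W) (fun W => - G W) Z.
have -> : Exl l (fun W => - F W * - G W) Z = Exl l (fun W => F W * G W) Z.
  by apply: eq_Exl => W; rewrite mulrNN.
by rewrite !ExlN mulrNN; apply=> A B AB; rewrite lerN2; [apply: mF | apply: mG].
Qed.

Lemma harris_mixed l F G Z : antitone F -> monotone G ->
  Exl l (fun W => F W * G W) Z <= Exl l F Z * Exl l G Z.
Proof.
move=> aF mG.
have := @harris_anti l F (fun W => - G W) Z aF.
have -> : Exl l (fun W => F W * - G W) Z = - Exl l (fun W => F W * G W) Z.
  by rewrite -ExlN; apply: eq_Exl => W; rewrite mulrN.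
by rewrite !ExlN mulrN lerN2; apply=> A B AB; rewrite lerN2; apply: mG.
Qed.

Lemma mono_sub (V : {set T}) : monotone (fun W => (V \subset W)%:R).
Proof.
move=> A B AB; rewrite ler_nat; case VA: (V \subset A) => //.
by rewrite (subset_trans VA AB).
Qed.

Definition avoids (I : finType) (P : pred I) (U : I -> {set T}) (W : {set T}) :=
  [forall i, P i ==> ~~ (U i \subset W)].

Lemma anti_avoids (I : finType) (P : pred I) U : antitone (fun W => (@avoids I P U W)%:R).
Proof.
move=> A B AB; rewrite ler_nat; case aB: (avoids P U B) => //.
rewrite lt0b; apply/forallP => i; apply/implyP => Pi.
have := forallP aB i; rewrite Pi /=; apply: contraNN => UA.
exact: subset_trans UA AB.
Qed.

(* The variance-type error counts pairs of kill sets with the multiplicity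
   [#|U :&: U'|]: this is what makes the induction on coordinates close. *)
Lemma avoids_corr_l (I1 I2 : finType) (P1 : pred I1) (P2 : pred I2) U1 U2 l Z :
  Exl l (fun W => (avoids P1 U1 W && avoids P2 U2 W)%:R) Z <=
  Exl l (fun W => (avoids P1 U1 W)%:R) Z * Exl l (fun W => (avoids P2 U2 W)%:R) Z
  + \sum_(i | P1 i) \sum_(j | P2 j)
      (count [in U1 i :&: U2 j] l)%:R * Exl l (fun W => (U1 i :|: U2 j \subset W)%:R) Z.
Proof.
elim: l Z => [|c l IH] Z /=.
  rewrite -natrM mulnb lerDl sumr_ge0 // => i _; apply: sumr_ge0 => j _.
  by rewrite mul0r.
set f1 := Exl l (fun W => (avoids P1 U1 W)%:R) (c |: Z).
set f0 := Exl l (fun W => (avoids P1 U1 W)%:R) Z.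
set g1 := Exl l (fun W => (avoids P2 U2 W)%:R) (c |: Z).
set g0 := Exl l (fun W => (avoids P2 U2 W)%:R) Z.
set D1 := \sum_(i | P1 i) \sum_(j | P2 j) (count [in U1 i :&: U2 j] l)%:R *
    Exl l (fun W => (U1 i :|: U2 j \subset W)%:R) (c |: Z).
set D0 := \sum_(i | P1 i) \sum_(j | P2 j) (count [in U1 i :&: U2 j] l)%:R *
    Exl l (fun W => (U1 i :|: U2 j \subset W)%:R) Z.
set s := fun i j => Exl l (fun W => (U1 i :|: U2 j \subset W)%:R).
set Q := \sum_(i | P1 i) \sum_(j | P2 j) (c \in U1 i :&: U2 j)%:R * s i j (c |: Z).
have sg0 i j Y : 0 <= s i j Y by apply: Exl_ge0 => W; rewrite ler0n.
have IH1 := IH (c |: Z); have IH0 := IH Z.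
(* Each difference is the probability that [c] completes a set contained in the drawn one, hence a
   union bound. The product of two such bounds is again a probability of containment, by Harris for
   increasing events. *)
have key : (f0 - f1) * (g0 - g1) <= Q.
  have diff (I : finType) (P : pred I) (U : I -> {set T}) :
     Exl l (fun W => (avoids P U W)%:R) Z - Exl l (fun W => (avoids P U W)%:R) (c |: Z)
     <= \sum_(i | P i && (c \in U i)) Exl l (fun W => (U i \subset W)%:R) (c |: Z).
    rewrite -Exl_sum !Exl_setU1 -ExlN -ExlD; apply: le_Exl => W.
    case a0: (avoids P U W); last first.
      by rewrite sub0r (@le_trans _ _ 0) ?oppr_le0 ?ler0n // sumr_ge0.
    case a1: (avoids P U (c |: W)); first by rewrite subrr sumr_ge0.
    move/negbT: a1; rewrite negb_forall => /existsP[i].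
    rewrite negb_imply negbK => /andP[Pi Ui].
    have cU : c \in U i.
      have := forallP a0 i; rewrite Pi /=; apply: contraNT => cU.
      apply/subsetP => t tU; have := subsetP Ui t tU; rewrite !inE.
      by case/orP => // /eqP tc; rewrite -tc tU in cU.
    rewrite (bigD1 i) ?Pi ?cU //= Ui subr0 lerDl sumr_ge0 // => j _.
  have dg0 (I : finType) (P : pred I) (U : I -> {set T}) :
     0 <= Exl l (fun W => (avoids P U W)%:R) Z - Exl l (fun W => (avoids P U W)%:R) (c |: Z).
    by rewrite subr_ge0; apply/Exl_antitone/anti_avoids.
  have := ler_pM (dg0 _ P1 U1) (dg0 _ P2 U2) (diff _ P1 U1) (diff _ P2 U2).
  move=> /le_trans; apply.
  rewrite big_distrl /= /Q [leRHS](bigID (fun i => c \in U1 i)) /=.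
  rewrite -[leLHS]addr0; apply: lerD; last first.
    by apply: sumr_ge0 => i _; apply: sumr_ge0 => j _; rewrite mulr_ge0.
  apply: ler_sum => i /andP[Pi ci]; rewrite big_distrr /=.
  rewrite [leRHS](bigID (fun j => c \in U2 j)) /=.
  rewrite -[leLHS]addr0; apply: lerD; last first.
    by apply: sumr_ge0 => j _; rewrite mulr_ge0.
  apply: ler_sum => j /andP[Pj cj]; rewrite inE ci cj mul1r.
  apply: le_trans (harris_mono _ _ (@mono_sub _) (@mono_sub _)) _.
  by apply: le_Exl => W; rewrite -natrM mulnb subUset.
set LD := \sum_(i | P1 i) \sum_(j | P2 j) _.
have -> : LD = p c * (Q + D1) + (1 - p c) * (\sum_(i | P1 i) \sum_(j | P2 j) (c \in U1 i :&: U2 j)%:R * s i j Z + D0).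
  rewrite /LD /Q /D1 /D0 -!big_split /= !big_distrr /= -big_split /=.
  apply: eq_bigr => i _; rewrite -!big_split /= !big_distrr /= -big_split /=.
  by apply: eq_bigr => j _; rewrite natrD -!/(s i j _) /s; ring.
set Q0 := \sum_(i | P1 i) \sum_(j | P2 j) (c \in U1 i :&: U2 j)%:R * s i j Z.
have Q0_ge0 : 0 <= Q0.
  by apply: sumr_ge0 => i _; apply: sumr_ge0 => j _; rewrite mulr_ge0.
apply: le_trans (lerD (ler_wpM2l (p_ge0 c) IH1) (ler_wpM2l (p_le1 c) IH0)) _.
rewrite -/f1 -/f0 -/g1 -/g0 -/D1 -/D0.
have h2 : p c * (1 - p c) * ((f0 - f1) * (g0 - g1)) <= p c * Q.
  rewrite -mulrA; apply: ler_wpM2l => //.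
  have Q_ge0 : 0 <= Q.
    by apply: sumr_ge0 => i _; apply: sumr_ge0 => j _; rewrite mulr_ge0.
  apply: (@le_trans _ _ ((1 - p c) * Q)); first exact: ler_wpM2l.
  by rewrite -[leRHS]mul1r; apply: ler_wpM2r => //; rewrite lerBlDr lerDl.
have h3 : 0 <= (1 - p c) * Q0 by rewrite mulr_ge0.
rewrite -subr_ge0.
set X := (X in 0 <= X).
have -> : X = (p c * Q - p c * (1 - p c) * ((f0 - f1) * (g0 - g1))) + (1 - p c) * Q0.
  by rewrite /X; ring.
by rewrite addr_ge0 // subr_ge0.
Qed.

Lemma Exl_subset l (V Z : {set T}) : uniq l -> {in l, forall t, t \notin Z} ->
  Exl l (fun W => (V \subset W)%:R) Z =
  \prod_(v in V) (if v \in Z then 1 else if v \in l then p v else 0).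
Proof.
elim: l Z => [|c l IH] Z /=.
  move=> _ _; case VZ: (V \subset Z).
    by rewrite big1 // => v vV; rewrite (subsetP VZ).
  move/negbT/subsetPn: VZ => [v vV vZ].
  by rewrite (bigD1 v) //= (negbTE vZ) mul0r.
case/andP => cl ul dZ.
have cZ : c \notin Z by apply: dZ; rewrite mem_head.
have dZ' : {in l, forall t, t \notin Z} by move=> t tl; apply: dZ; rewrite inE tl orbT.
have dcZ : {in l, forall t, t \notin c |: Z}.
  move=> t tl; rewrite !inE negb_or dZ' // andbT.
  by apply: contraNneq cl => <-.
rewrite !IH //; case cV: (c \in V).
  rewrite !(bigD1 c cV) /= setU11 (negbTE cZ) (negbTE cl) mem_head mul1r mul0r mulr0 addr0.
  congr (_ * _); apply: eq_bigr => v /andP[_ vc].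
  by rewrite !inE (negbTE vc).
have e1 (f : T -> R) (g : T -> R) : (forall v, v != c -> f v = g v) ->
   \prod_(v in V) f v = \prod_(v in V) g v.
  move=> fg; apply: eq_bigr => v vV; apply: fg.
  by apply: contraTneq vV => ->; rewrite cV.
set X := \prod_(v in V) _; set Y := \prod_(v in V) _; set W := RHS.
have -> : X = W by apply: e1 => v vc; rewrite !inE (negbTE vc).
have -> : Y = W by apply: e1 => v vc; rewrite !inE (negbTE vc).
by ring.
Qed.

Lemma Ex_subset (V : {set T}) : Ex (fun W => (V \subset W)%:R) = \prod_(v in V) p v.
Proof.
rewrite /Ex Exl_subset ?enum_uniq //; last by move=> t _; rewrite inE.
by apply: eq_bigr => v _; rewrite inE mem_enum.
Qed.

Lemma Ex_mem t : Ex (fun W => (t \in W)%:R) = p t.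
Proof.
have <- : \prod_(v in [set t]) p v = p t by rewrite big_set1.
by rewrite -Ex_subset; apply: eq_Exl => W; rewrite sub1set.
Qed.

Lemma Exl_disjoint l (V Z : {set T}) : uniq l ->
  Exl l (fun W => [disjoint V & W]%:R) Z =
  \prod_(v in V) (if v \in Z then 0 else if v \in l then 1 - p v else 1).
Proof.
elim: l Z => [|c l IH] Z /=.
  move=> _; case VZ: [disjoint V & Z].
    by rewrite big1 // => v vV; rewrite (disjointFr VZ vV).
  move/negbT: VZ; rewrite -setI_eq0 => /set0Pn[v]; rewrite inE => /andP[vV vZ].
  by rewrite (bigD1 v) //= vZ mul0r.
case/andP => cl ul.
rewrite !IH //; case cV: (c \in V); last first.
  have e1 (f : T -> R) (g : T -> R) : (forall v, v != c -> f v = g v) ->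
     \prod_(v in V) f v = \prod_(v in V) g v.
    move=> fg; apply: eq_bigr => v vV; apply: fg.
    by apply: contraTneq vV => ->; rewrite cV.
  set X := \prod_(v in V) _; set Y := \prod_(v in V) _; set W := RHS.
  have -> : X = W by apply: e1 => v vc; rewrite !inE (negbTE vc).
  have -> : Y = W by apply: e1 => v vc; rewrite !inE (negbTE vc).
  by ring.
rewrite !(bigD1 c cV) /= setU11 (negbTE cl) mem_head mul0r mulr0 add0r mulrA.
case: ifP => cZ; first by rewrite mulr0 !mul0r.
rewrite mulr1; congr (_ * _); apply: eq_bigr => v /andP[_ vc].
by rewrite !inE (negbTE vc).
Qed.

Lemma Ex_disjoint (V : {set T}) :
  Ex (fun W => [disjoint V & W]%:R) = \prod_(v in V) (1 - p v).
Proof.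
rewrite /Ex Exl_disjoint ?enum_uniq //.
by apply: eq_bigr => v _; rewrite inE mem_enum.
Qed.

Lemma Exl_mixed l (V U Z : {set T}) : uniq l -> {in l, forall t, t \notin Z} ->
  [disjoint V & U] ->
  Exl l (fun W => ((V \subset W) && [disjoint U & W])%:R) Z =
  (\prod_(v in V) (if v \in Z then 1 else if v \in l then p v else 0)) *
  \prod_(v in U) (if v \in Z then 0 else if v \in l then 1 - p v else 1).
Proof.
move=> ul dZ dVU; elim: l Z ul dZ => [|c l IH] Z /=.
  move=> _ _; have := @Exl_subset [::] V Z isT; have := @Exl_disjoint [::] U Z isT.
  by move=> /= <- <- //; rewrite -natrM mulnb.
case/andP => cl ul dZ.
have cZ : c \notin Z by apply: dZ; rewrite mem_head.
have dZ' : {in l, forall t, t \notin Z} by move=> t tl; apply: dZ; rewrite inE tl orbT.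
have dcZ : {in l, forall t, t \notin c |: Z}.
  move=> t tl; rewrite !inE negb_or dZ' // andbT.
  by apply: contraNneq cl => <-.
have e1 (A : {set T}) (f g : T -> R) : c \notin A -> (forall v, v != c -> f v = g v) ->
   \prod_(v in A) f v = \prod_(v in A) g v.
  move=> cA fg; apply: eq_bigr => v vV; apply: fg.
  by apply: contraTneq vV => ->.
have e2 (A : {set T}) (f g : T -> R) : (forall v, v != c -> f v = g v) ->
   \prod_(v in A | v != c) f v = \prod_(v in A | v != c) g v.
  by move=> fg; apply: eq_bigr => v /andP[_ /fg].
rewrite !IH //; case cV: (c \in V).
  have cU : c \notin U by rewrite (disjointFr dVU cV).
  rewrite !(bigD1 c cV) /= setU11 (negbTE cZ) (negbTE cl) mem_head mul1r !mul0r mulr0 addr0.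
  rewrite -mulrA; congr (_ * (_ * _)).
    by apply: e2 => v vc; rewrite !inE (negbTE vc).
  by apply: e1 => // v vc; rewrite !inE (negbTE vc).
set X := \prod_(v in V) _; set Y := \prod_(v in V) (if v \in Z then _ else _).
set W := \prod_(v in V) (if v \in Z then _ else _).
have -> : X = W by apply: e1; rewrite ?cV // => v vc; rewrite !inE (negbTE vc).
have -> : Y = W by apply: e1; rewrite ?cV // => v vc; rewrite !inE (negbTE vc).
case cU: (c \in U).
  rewrite !(bigD1 c cU) /= setU11 (negbTE cZ) (negbTE cl) mem_head mul0r !mulr0 add0r mul1r.
  rewrite mulrCA; congr (_ * (_ * _)).
  by apply: e2 => v vc; rewrite !inE (negbTE vc).
set X' := \prod_(v in U) _; set Y' := \prod_(v in U) (if v \in Z then _ else _).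
set W' := \prod_(v in U) (if v \in Z then _ else _).
have -> : X' = W' by apply: e1; rewrite ?cU // => v vc; rewrite !inE (negbTE vc).
have -> : Y' = W' by apply: e1; rewrite ?cU // => v vc; rewrite !inE (negbTE vc).
by ring.
Qed.

Lemma Ex_mixed (V U : {set T}) : [disjoint V & U] ->
  Ex (fun W => ((V \subset W) && [disjoint U & W])%:R) =
  (\prod_(v in V) p v) * \prod_(v in U) (1 - p v).
Proof.
move=> dVU; rewrite /Ex Exl_mixed ?enum_uniq //; last by move=> t _; rewrite inE.
by congr (_ * _); apply: eq_bigr => v _; rewrite inE mem_enum.
Qed.

Lemma avoids_corr (I1 I2 : finType) (P1 : pred I1) (P2 : pred I2) U1 U2 :
  Ex (fun W => (avoids P1 U1 W && avoids P2 U2 W)%:R) <=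
  Ex (fun W => (avoids P1 U1 W)%:R) * Ex (fun W => (avoids P2 U2 W)%:R)
  + \sum_(i | P1 i) \sum_(j | P2 j)
      #|U1 i :&: U2 j|%:R * \prod_(t in U1 i :|: U2 j) p t.
Proof.
apply: le_trans (avoids_corr_l _ _ _ _ _ _) _.
rewrite lerD2l; apply: ler_sum => i _; apply: ler_sum => j _.
rewrite -Ex_subset -/(Ex _); apply: ler_wpM2r; first by apply: Exl_ge0.
rewrite ler_nat cardE -size_filter; apply: uniq_leq_size.
  by rewrite filter_uniq ?enum_uniq.
by move=> t; rewrite mem_filter mem_enum => /andP[].
Qed.

Lemma avoids_harris_seq (J : eqType) (r : seq J) (A : J -> {set T} -> bool) :
  (forall j, antitone (fun W => (A j W)%:R)) ->
  \prod_(j <- r) Ex (fun W => (A j W)%:R) <= Ex (fun W => (all (A^~ W) r)%:R).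
Proof.
move=> aA; elim: r => [|j r IH]; first by rewrite big_nil /Ex Exl_cst.
rewrite big_cons.
apply: le_trans (_ : Ex (fun W => (A j W)%:R) * Ex (fun W => (all (A^~ W) r)%:R) <= _).
  by apply: ler_wpM2l => //; apply: Exl_ge0.
apply: le_trans (harris_anti _ _ (aA j) _) _.
  move=> B C BC; rewrite ler_nat; case aC: (all _ r) => //.
  rewrite lt0b; apply/allP => i ir; have := allP aC i ir.
  by move: (aA i _ _ BC); rewrite ler_nat; case: (A i C) => //; rewrite lt0b.
by apply: le_Exl => W; rewrite -natrM mulnb.
Qed.

End ProductMeasure.

End Correlation.

(** * The weighted nibble *)
Module Nibble.
Import mathcomp.algebra_tactics.ring mathcomp.algebra_tactics.lra.
Import Order.TTheory GRing.Theory Num.Theory.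
Import Correlation.

Local Open Scope ring_scope.

Section Aux.
Variable R : realFieldType.

Lemma prod_1sub_ge (I : Type) (r : seq I) (P : pred I) (f : I -> R) :
  (forall i, P i -> 0 <= f i <= 1) ->
  1 - \sum_(i <- r | P i) f i <= \prod_(i <- r | P i) (1 - f i).
Proof.
move=> f01; have H i : P i -> 0 <= 1 - f i by move=> /f01/andP[_ h]; rewrite subr_ge0.
elim: r => [|i r IH]; first by rewrite !big_nil subr0.
rewrite !big_cons; case: ifP => Pi //.
have /andP[f0 f1] := f01 i Pi.
apply: le_trans (ler_wpM2l (H i Pi) IH).
have : 0 <= \sum_(j <- r | P j) f j by apply: sumr_ge0 => j /f01/andP[].
by move=> S0; have := mulr_ge0 f0 S0; lra.
Qed.

(* Split the factors greedily into blocks of total mass between 1/4 and 1/2,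
   each of which contributes at least 1/2. *)
Lemma prod_1sub_low (I : Type) (r : seq I) (P : pred I) (f : I -> R) (k : nat) :
  (forall i, P i -> 0 <= f i <= 4^-1) -> \sum_(i <- r | P i) f i <= k%:R ->
  (2 ^- (4 * k).+1 : R) <= \prod_(i <- r | P i) (1 - f i).
Proof.
move=> f01 fk.
have [m [x [x0 xh mx px]]] : exists m : nat, exists x : R, [/\ 0 <= x, x <= 2^-1,
   m%:R / 4 + x <= \sum_(i <- r | P i) f i &
   2 ^- m * (1 - x) <= \prod_(i <- r | P i) (1 - f i)].
  elim: r {fk} => [|i r [m [x [x0 xh mx px]]]].
    by exists 0%N, 0; rewrite !big_nil; split => //; lra.
  rewrite !big_cons; case: ifP => Pi; last by exists m, x.
  have /andP[f0 f4] := f01 i Pi.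
  have p2 : 0 <= (2 ^- m : R) by rewrite invr_ge0 exprn_ge0.
  have g0 : 0 <= 1 - f i by lra.
  case: (lerP (x + f i) 2^-1) => h.
    exists m, (x + f i); split => //; try lra.
    apply: le_trans (ler_wpM2l g0 px).
    rewrite mulrCA; apply: ler_wpM2l => //.
    by have := mulr_ge0 x0 f0; lra.
  exists m.+1, (f i); split => //; try lra.
  apply: le_trans (ler_wpM2l g0 px).
  rewrite exprS invfM [2^-1 * _]mulrC -mulrA [leRHS]mulrCA; apply: ler_wpM2l => //.
  by rewrite mulrC; apply: ler_wpM2l => //; lra.
have mk : (m <= 4 * k)%N.
  by rewrite -(ler_nat R) natrM; lra.
have h2 : 2 ^- (4 * k) <= (2 ^- m : R).
  by rewrite lef_pV2 ?posrE ?exprn_gt0 // ler_eXn2l // ltr1n.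
have p2 : 0 <= (2 ^- m : R) by rewrite invr_ge0 exprn_ge0.
apply: le_trans px; rewrite exprS invfM.
apply: le_trans (_ : 2^-1 * 2 ^- m <= _); first by apply: ler_wpM2l; rewrite ?invr_ge0.
by rewrite mulrC; apply: ler_wpM2l => //; lra.
Qed.

End Aux.

Section Nibble.
(* [X] is the set of pairs of vertices and [E] the set of copies: a copy [e] covers the
   pairs in [bd e], and needs the pairs in [hh e] to lie in the reserved random set [sH]. *)
Variables (R : realFieldType) (X E : finType) (bd hh : E -> {set X}).
Variable Conf : {set {set E}}.
Variables (theta delta : R) (kap d : nat).

Definition olap (e g : E) := (e != g) && ~~ [disjoint bd e & bd g].

(** Overlaps are treated as conflicts with two elements, so that a single rule removes copies: [e]
    dies once all other copies of some such [K] have been sampled. *)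
Definition PP (K : {set E}) :=
  (K \in Conf) || [exists e, exists g, olap e g && (K == [set e; g])].

(* Reserved pairs, uncovered pairs, available copies, sampled copies, the probability
   of survival of each available copy so far, accepted copies. *)
Record state := State {
  sH : {set X}; sA : {set X}; sB : {set E}; sS : {set E}; sy : E -> R; sAcc : {set E} }.

(** Inverse survival probability: a copy that survives gains exactly what the copies that die lose,
    so the mean weight stays close to its initial value 1. *)
Definition M st e : R := if e \in sB st then (sy st e)^-1 else 0.
Definition pe u st e := theta * u / d%:R * M st e.
Definition Y u st x := u / d%:R * \sum_(e | x \in bd e) M st e.
Definition good u st x := Y u st x <= 1 + delta.
(* The dummy coordinate [inr x] brings the probability that a good [x] is left
   untouched to exactly [1 - delta]. *)
Definition qd u st x :=
  if good u st x then 1 - (1 - delta) / \prod_(g | x \in bd g) (1 - pe u st g) else 0.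
Definition pr u st (t : E + X) :=
  match t with inl e => pe u st e | inr x => qd u st x end.
Definition ZE (Z : {set E + X}) : {set E} := [set e | inl e \in Z].
(** Mean number of conflicts through [e] whose other copies are all sampled after the step. *)
Definition w u st e :=
  \sum_(C in Conf | e \in C) \prod_(g in C :\ e :\: sS st) pe u st g.

Definition KP e (i : {set E} + X) :=
  match i with inl K => PP K && (e \in K) | inr y => y \in bd e end.
Definition KU (S : {set E}) e (i : {set E} + X) : {set E + X} :=
  match i with inl K => inl @: (K :\ e :\: S) | inr y => [set inr y] end.
Definition Dok st e := avoids (KP e) (KU (sS st) e).
Definition v u st e := Ex (pr u st) (fun Z => (Dok st e Z)%:R).
Definition nice u st e := (w u st e <= kap%:R) && [forall x in bd e, good u st x].

(** Copies are killed by sampled copies, accepted or not. Survival thus depends on independent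
    choices only, and acceptance has no influence on the later steps. *)
Definition next u st (Z : {set E + X}) := State (sH st)
  [set x in sA st | [&& good u st x, inr x \notin Z & [forall g, (inl g \in Z) ==> (x \notin bd g)]]]
  [set e in sB st | [&& nice u st e, inl e \notin Z & Dok st e Z]]
  (sS st :|: ZE Z)
  (fun e => sy st e * v u st e)
  (sAcc st :|: [set g in sB st | [&& inl g \in Z, [forall x in bd g, good u st x],
      [forall g', (inl g' \in Z) ==> ~~ olap g g'] &
      [forall C in Conf, (g \in C) ==> ~~ (C :\ g \subset sS st :|: ZE Z)]]]).

Record Inv (b : R) st : Prop := {
  inv_y : forall e, e \in sB st -> 0 < sy st e /\ (sy st e)^-1 <= b;
  inv_A : forall e, e \in sB st -> bd e \subset sA st;
  inv_K : forall e K, e \in sB st -> PP K -> e \in K -> ~~ (K :\ e \subset sS st);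
  inv_S : forall e, e \in sB st -> e \notin sS st;
  inv_Acc : sAcc st \subset sS st;
  inv_olap : forall e g, e \in sAcc st -> g \in sAcc st -> ~~ olap e g;
  inv_Conf : forall C, C \in Conf -> ~~ (C \subset sAcc st);
  inv_H : forall e, e \in sB st :|: sAcc st -> [disjoint bd e & sH st] && (hh e \subset sH st) }.

Hypothesis d_gt0 : (0 < d)%N.
Hypothesis delta01 : 0 < delta < 1.
Hypothesis thetaE : theta * (1 + delta) <= delta.
Hypothesis theta0 : 0 < theta.
Variable s : nat.
Hypothesis bd_s : forall e, #|bd e| = s.
Hypothesis s_gt0 : (0 < s)%N.

Variable J : nat.
Hypothesis J2 : (2 <= J)%N.
Hypothesis conf_card : forall C, C \in Conf -> (2 < #|C| <= J)%N.
Hypothesis conf_dis : forall C e g, C \in Conf -> e \in C -> g \in C -> e != g ->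
  [disjoint bd e :|: hh e & bd g :|: hh g].
(** [A1] to [A4] say that copies meeting in more than the generic way form bad sets, of which few
    exist. Correlations between survivals come from such sets, apart from three copies through one
    common pair, the exception in [A3], and from conflicts compared with themselves. *)
Variable bad : pred {set E}.
Hypothesis A1 : forall K1 K2, PP K1 -> PP K2 -> K1 != K2 -> (1 < #|K1 :&: K2|)%N -> bad (K1 :|: K2).
Hypothesis A2 : forall D K, bad D -> PP K -> K :&: D != set0 -> bad (D :|: K).
Hypothesis A3 : forall C K K' e e', PP C -> PP K -> PP K' -> e != e' ->
  e \in C -> e' \in C -> e \in K -> e' \in K' -> e' \notin K -> e \notin K' ->
  (K :\ e) :&: (K' :\ e') != set0 ->
  bad (C :|: K :|: K') \/ exists g x, [/\ C = [set e; e'], K = [set e; g], K' = [set e'; g],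
     g != e' & [/\ x \in bd e, x \in bd e' & x \in bd g]].
Hypothesis A4 : forall e e' x, e != e' -> x \in bd e -> x \in bd e' ->
  (bd e :|: hh e) :&: (bd e' :|: hh e') = [set x] \/ bad [set e; e'].

Let dR : R := d%:R.
Let dR_gt0 : 0 < dR. Proof. by rewrite ltr0n. Qed.
Let theta1 : theta <= 1.
Proof. by have /andP[d0 d1] := delta01; have := mulr_gt0 theta0 d0; move: thetaE; rewrite mulrDr mulr1; lra. Qed.

(** * Conditional expectations in a single step *)

Section OneStep.
Variables (b u : R).
Hypothesis b1 : 1 <= b.
Hypothesis u01 : 0 < u <= 1.
Hypothesis bd4 : b / d%:R <= 4^-1.
Variable st : state.
Hypothesis I : Inv b st.

Lemma M_ge0 e : 0 <= M st e.
Proof.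
rewrite /M; case: ifP => // eB; have [h _] := inv_y I eB.
by rewrite invr_ge0 ltW.
Qed.

Lemma M_le e : M st e <= b.
Proof.
rewrite /M; case: ifP => eB; first by have [] := inv_y I eB.
by apply: le_trans b1.
Qed.

Lemma pe_ge0 e : 0 <= pe u st e.
Proof.
have /andP[u0 u1] := u01.
by rewrite /pe mulr_ge0 ?M_ge0 // divr_ge0 ?mulr_ge0 // ltW.
Qed.

Lemma pe_theta e : pe u st e <= theta * (M st e / dR).
Proof.
have /andP[u0 u1] := u01.
have -> : pe u st e = u * (theta * (M st e / dR)) by rewrite /pe -/dR; ring.
apply: ler_piMl => //; apply: mulr_ge0; first exact: ltW.
by apply: divr_ge0; [exact: M_ge0 | exact: ltW].
Qed.

Lemma pe_M e : pe u st e <= M st e / dR.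
Proof.
apply: le_trans (pe_theta e) _.
rewrite -[leRHS]mul1r; apply: ler_wpM2r => //.
by rewrite divr_ge0 ?M_ge0 // ltW.
Qed.

Lemma pe_bd e : pe u st e <= b / dR.
Proof.
apply: le_trans (pe_M e) _; apply: ler_wpM2r; last exact: M_le.
by rewrite invr_ge0 ltW.
Qed.

Lemma pe_4 e : pe u st e <= 4^-1. Proof. exact: le_trans (pe_bd e) bd4. Qed.

Lemma pe01 e : 0 <= pe u st e <= 1.
Proof. by rewrite pe_ge0 /=; apply: le_trans (pe_4 e) _; lra. Qed.

Lemma pe_out e : e \notin sB st -> pe u st e = 0.
Proof. by rewrite /pe /M => /negbTE ->; rewrite mulr0. Qed.

Lemma sum_pe x : good u st x -> \sum_(g | x \in bd g) pe u st g <= delta.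
Proof.
rewrite /good /Y /pe -big_distrr /= => h; apply: le_trans thetaE.
by rewrite -!mulrA; apply: ler_wpM2l; rewrite ?(ltW theta0) // mulrA.
Qed.

Lemma prod_pe x : good u st x -> 1 - delta <= \prod_(g | x \in bd g) (1 - pe u st g).
Proof.
move=> gx; have := @prod_1sub_ge R E (index_enum E) (fun g => x \in bd g) (pe u st).
move=> /(_ (fun g _ => pe01 g)); apply: le_trans.
by rewrite lerD2l lerN2 sum_pe.
Qed.

Lemma prod_pe_gt0 x : good u st x -> 0 < \prod_(g | x \in bd g) (1 - pe u st g).
Proof.
move=> gx; apply: lt_le_trans (prod_pe gx).
by have /andP[d0 d1] := delta01; lra.
Qed.

Lemma qd01 x : 0 <= qd u st x <= 1.
Proof.
rewrite /qd; case: ifP => gx; last by rewrite lexx ler01.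
have p0 := prod_pe_gt0 gx.
have /andP[d0 d1] := delta01.
rewrite subr_ge0 ler_pdivrMr // mul1r prod_pe //= lerBlDr lerDl divr_ge0 ?(ltW p0) //.
by lra.
Qed.

Lemma pr01 t : 0 <= pr u st t <= 1.
Proof. by case: t => [e|x] /=; [exact: pe01 | exact: qd01]. Qed.

Let EZ := Ex (pr u st).

Definition touch x (P : pred E) : {set E + X} :=
  inr x |: [set inl g | g in [set g | (x \in bd g) && P g]].

Lemma prod_touch x (P : pred E) (f : E + X -> R) :
  \prod_(t in touch x P) f t = f (inr x) * \prod_(g | (x \in bd g) && P g) f (inl g).
Proof.
rewrite /touch big_setU1 /=; last by apply/negP => /imsetP[].
congr (_ * _); rewrite big_imset /=; last by move=> ? ? _ _ [].
by apply: eq_bigl => g; rewrite inE.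
Qed.

Lemma untouched_eq x : good u st x -> EZ (fun Z => [disjoint touch x predT & Z]%:R) = 1 - delta.
Proof.
move=> gx; rewrite /EZ Ex_disjoint prod_touch /= /qd gx.
have -> : \prod_(g | (x \in bd g) && true) (1 - pe u st g) = \prod_(g | x \in bd g) (1 - pe u st g).
  by apply: eq_bigl => g; rewrite andbT.
by rewrite subKr divfK // gt_eqF // prod_pe_gt0.
Qed.

Lemma untouched_ge x P : good u st x -> 1 - delta <= EZ (fun Z => [disjoint touch x P & Z]%:R).
Proof.
move=> gx; rewrite -(untouched_eq gx); apply: (le_Exl pr01) => Z.
rewrite ler_nat; case h: [disjoint touch x predT & Z] => //.
rewrite lt0b; apply: disjointWl h; apply/subsetP => t; rewrite !inE.
case/orP => [->//|/imsetP[g]]; rewrite inE => /andP[xg _] ->.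
by apply/orP; right; apply/imsetP; exists g; rewrite ?inE ?xg.
Qed.

Lemma anti_disjoint (V : {set E + X}) : antitone (fun W => [disjoint V & W]%:R : R).
Proof.
move=> A B AB; rewrite ler_nat; case h: [disjoint V & B] => //.
by rewrite lt0b (disjointWr AB).
Qed.

Lemma Dok_anti e : antitone (fun Z => (Dok st e Z)%:R : R).
Proof. exact: anti_avoids. Qed.

Lemma v_le1 e : v u st e <= 1.
Proof.
rewrite -[leRHS](Exl_cst (pr u st) (enum {: E + X}) 1 set0).
by apply: (le_Exl pr01) => Z; rewrite lern1; case: Dok.
Qed.

Lemma v_ge0 e : 0 <= v u st e.
Proof. by apply: (Exl_ge0 pr01) => Z; rewrite ler0n. Qed.

Lemma sub_inl (U : {set E}) (Z : {set E + X}) : ([set inl g | g in U] \subset Z) = (U \subset ZE Z).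
Proof.
apply/subsetP/subsetP => [h g gU|h t /imsetP[g gU ->]].
  by rewrite inE; apply: h; apply: imset_f.
by have := h g gU; rewrite inE.
Qed.

Lemma Ex_sub_inl (U : {set E}) :
  EZ (fun Z => (U \subset ZE Z)%:R) = \prod_(g in U) pe u st g.
Proof.
have <- : \prod_(t in [set inl g | g in U]) pr u st t = \prod_(g in U) pe u st g.
  by rewrite big_imset //= => ? ? _ _ [].
by rewrite -Ex_subset; apply: eq_Exl => Z; rewrite sub_inl.
Qed.

(** The first factor stands for the [s] pairs of a copy, each untouched with probability at least
    [1 - delta]; the second comes from [prod_1sub_low], as the probabilities of the conflicts have
    sum at most [kap]. *)
Definition vlow : R := (1 - delta) ^+ s * 2 ^- (4 * kap).+1.

Lemma vlow_gt0 : 0 < vlow.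
Proof.
have /andP[d0 d1] := delta01.
by rewrite mulr_gt0 ?exprn_gt0 ?invr_gt0 ?exprn_gt0 // ?subr_gt0.
Qed.

Lemma vlow_le e : e \in sB st -> nice u st e -> vlow <= v u st e.
Proof.
move=> eB /andP[we /forall_inP ge].
have d1 : 0 <= 1 - delta by have /andP[] := delta01; rewrite subr_ge0 => _ /ltW.
pose A (j : X + {set E}) (Z : {set E + X}) := match j with
  | inl y => (y \in bd e) ==> [disjoint touch y (fun g => g != e) & Z]
  | inr C => ((C \in Conf) && (e \in C)) ==> ~~ (C :\ e :\: sS st \subset ZE Z) end.
have aA j : antitone (fun Z => (A j Z)%:R : R).
  case: j => [y|C] B D BD /=.
    by case: (y \in bd e) => //=; apply: anti_disjoint.
  case: (_ && _) => //=; rewrite ler_nat; case h: (~~ _) => //.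
  rewrite lt0b; apply: contraNN h => /subset_trans; apply.
  by apply/subsetP => g; rewrite !inE; apply: (subsetP BD).
have := avoids_harris_seq pr01 (enum {: X + {set E}}) aA.
move=> /le_trans H; apply: le_trans (H _ _); last first.
  apply: (le_Exl pr01) => Z; rewrite ler_nat; case h: (all _ _) => //.
  rewrite lt0b; apply/forallP => -[K|y] /=; apply/implyP; last first.
    move=> ye; have := allP h (inl y); rewrite mem_enum inE => /(_ isT) /=.
    rewrite ye /= sub1set => dj; apply: contraL dj => yZ.
    by rewrite -setI_eq0; apply/set0Pn; exists (inr y); rewrite !inE eqxx.
  case/andP => PK eK; rewrite sub_inl.
  case/orP: (PK) => [KC|].
    by have := allP h (inr K); rewrite mem_enum inE => /(_ isT)/implyP; apply; rewrite KC.
  case/existsP => f /existsP[g /andP[/andP[fg dfg] /eqP KE]].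
  have [g' [KE' ge' [y [ye yg']]]] : exists g', [/\ K :\ e = [set g'], g' != e &
      exists y, y \in bd e /\ y \in bd g'].
    move: dfg; rewrite -setI_eq0 => /set0Pn[y]; rewrite inE => /andP[yf yg].
    move: eK; rewrite KE !inE => /orP[]/eqP ->.
      exists g; split; last by exists y.
        by apply/setP => z; rewrite !inE; case: eqP => [->|//]; rewrite (negbTE fg).
      by rewrite eq_sym.
    exists f; split; [|by []|by exists y].
    by apply/setP => z; rewrite !inE; case: eqP => [->|_]; rewrite ?orbF // eq_sym (negbTE fg).
  have := inv_K I eB PK eK; rewrite KE' sub1set => g'S.
  have -> : [set g'] :\: sS st = [set g'].
    by apply/setDidPl; rewrite disjoints_subset sub1set inE.
  rewrite sub1set inE; have := allP h (inl y); rewrite mem_enum inE => /(_ isT) /=.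
  rewrite ye /= => dj; apply: contraL dj => gZ.
  rewrite -setI_eq0; apply/set0Pn; exists (inl g'); rewrite !inE gZ andbT.
  by apply/imsetP; exists g'; rewrite ?inE ?yg'.
rewrite big_enum /= (bigID (fun j => if j is inl _ then true else false)) /=.
have -> : \prod_(j | if j is inl _ then true else false) EZ (fun Z => (A j Z)%:R)
   = \prod_(y : X) EZ (fun Z => (A (inl y) Z)%:R).
  rewrite big_sumType /= [X in _ * X]big_pred0 ?mulr1 //.
have -> : \prod_(j | ~~ (if j is inl _ then true else false)) EZ (fun Z => (A j Z)%:R)
   = \prod_(C : {set E}) EZ (fun Z => (A (inr C) Z)%:R).
  rewrite big_sumType /= [X in X * _]big_pred0 ?mul1r //.
have c1 : EZ (fun=> true%:R) = 1 by rewrite /EZ /Ex Exl_cst.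
apply: ler_pM.
- exact: exprn_ge0.
- by rewrite invr_ge0 exprn_ge0.
- rewrite (bigID (mem (bd e))) /= [X in _ * X]big1 ?mulr1; last first.
    by move=> y ye; rewrite (negbTE ye).
  rewrite -(bd_s e) -prodr_const; apply: ler_prod => y ye.
  by rewrite d1 ye /=; apply/untouched_ge/ge.
rewrite (bigID (fun C => (C \in Conf) && (e \in C))) /= [X in _ * X]big1 ?mulr1; last first.
  by move=> C /negbTE ->.
apply: le_trans (_ : \prod_(C in Conf | e \in C) (1 - \prod_(g in C :\ e :\: sS st) pe u st g) <= _); last first.
  apply: ler_prod => C /andP[CC eC]; rewrite CC eC /=.
  have -> : EZ (fun Z => (~~ (C :\ e :\: sS st \subset ZE Z))%:R) =
     1 - \prod_(g in C :\ e :\: sS st) pe u st g.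
    rewrite -Ex_sub_inl -[X in X - _]c1 /EZ /Ex -ExlN -ExlD.
    by apply: eq_Exl => Z; case: (_ \subset _); rewrite ?subrr ?subr0.
  rewrite lexx andbT subr_ge0; apply: prodr_ile1 => g _; apply: pe01.
apply: prod_1sub_low => // C /andP[CC eC].
have PC : PP C by rewrite /PP CC.
have /subsetPn[g gC gS] := inv_K I eB PC eC.
have gU : g \in C :\ e :\: sS st by rewrite inE gS.
rewrite prodr_ge0 /=; last by move=> *; apply: pe_ge0.
rewrite (bigD1 g gU) /=; apply: le_trans (_ : pe u st g * 1 <= _).
  apply: ler_wpM2l; first exact: pe_ge0.
  by apply: prodr_ile1 => h _; apply: pe01.
by rewrite mulr1 pe_4.
Qed.

Lemma M_next Z e : M (next u st Z) e =
  M st e / v u st e * [&& nice u st e, inl e \notin Z & Dok st e Z]%:R.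
Proof.
rewrite /M /= inE; case eB: (e \in sB st) => /=; last by rewrite mul0r mul0r.
by case: ifP => _; rewrite ?mulr1 ?mulr0 // invfM.
Qed.

Lemma M_v_ge0 e : 0 <= M st e / v u st e.
Proof. by rewrite divr_ge0 ?M_ge0 ?v_ge0. Qed.

Lemma M_v e : nice u st e -> M st e / v u st e * v u st e = M st e.
Proof.
move=> ne; case eB: (e \in sB st).
  by rewrite divfK // gt_eqF // (lt_le_trans vlow_gt0) // vlow_le.
by rewrite /M eB !mul0r.
Qed.

Lemma M_v_le e : nice u st e -> M st e / v u st e <= b / vlow.
Proof.
move=> ne; have v0 := vlow_gt0; case eB: (e \in sB st); last first.
  by rewrite /M eB mul0r divr_ge0 ?ltW // (lt_le_trans ltr01).
apply: ler_pM; rewrite ?M_ge0 ?invr_ge0 ?v_ge0 ?M_le //.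
by rewrite lef_pV2 ?posrE // ?vlow_le // (lt_le_trans v0) // vlow_le.
Qed.

Lemma EZ_compl (P : pred {set E + X}) : EZ (fun Z => (~~ P Z)%:R) = 1 - EZ (fun Z => (P Z)%:R).
Proof.
have c1 : EZ (fun=> 1) = 1 by rewrite /EZ /Ex Exl_cst.
rewrite -[X in X - _]c1 /EZ /Ex -ExlN -ExlD; apply: eq_Exl => Z.
by case: (P Z); rewrite /= ?subrr ?subr0.
Qed.

(** Division by [v] cancels the probability of [Dok]. The one remaining risk, that [e] itself is
    sampled, is positively correlated with dying, so Harris applies. *)
Lemma EZ_M_ge e : M st e * (1 - pe u st e) * (nice u st e)%:R <= EZ (fun Z => M (next u st Z) e).
Proof.
have -> : EZ (fun Z => M (next u st Z) e) = M st e / v u st e *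
   EZ (fun Z => [&& nice u st e, inl e \notin Z & Dok st e Z]%:R).
  by rewrite -ExlZ; apply: eq_Exl => Z; rewrite M_next.
case ne: (nice u st e); last first.
  by rewrite mulr0 mulr_ge0 ?M_v_ge0 // (Exl_ge0 pr01).
rewrite mulr1 /= -{1}(M_v ne) -mulrA; apply: ler_wpM2l; first exact: M_v_ge0.
have -> : 1 - pe u st e = EZ (fun Z => (inl e \notin Z)%:R).
  by rewrite (EZ_compl (fun Z => inl e \in Z)) /EZ Ex_mem.
rewrite mulrC; apply: le_trans (harris_anti pr01 _ _ _ (@Dok_anti e)) _.
  move=> A B AB; rewrite ler_nat; case h: (_ \notin B) => //.
  by rewrite lt0b; apply: contraNN h; apply: (subsetP AB).
by apply: (le_Exl pr01) => Z; rewrite -natrM mulnb.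
Qed.

Lemma EZ_M_le e : EZ (fun Z => M (next u st Z) e) <= M st e.
Proof.
case ne: (nice u st e); last first.
  rewrite -(Exl_cst (pr u st) (enum {: E + X}) (M st e) set0).
  by apply: (le_Exl pr01) => Z; rewrite M_next ne mulr0 M_ge0.
rewrite -[leRHS](M_v ne) /v -ExlZ; apply: (le_Exl pr01) => Z.
rewrite M_next ne /=; apply: ler_wpM2l; first exact: M_v_ge0.
by rewrite ler_nat; case: (_ \notin Z).
Qed.

Lemma EZ_A_le : EZ (fun Z => #|sA (next u st Z)|%:R) <= (1 - delta) * #|sA st|%:R.
Proof.
have d1 : 0 <= 1 - delta by have /andP[] := delta01; rewrite subr_ge0 => _ /ltW.
have -> : (1 - delta) * #|sA st|%:R = \sum_(x in sA st) (1 - delta).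
  by rewrite sumr_const mulr_natr.
apply: le_trans (_ : EZ (fun Z => \sum_(x in sA st) (x \in sA (next u st Z))%:R) <= _).
  apply: (le_Exl pr01) => Z.
  rewrite -natr_sum ler_nat -sum1_card -big_mkcondr /= leq_eqVlt; apply/orP; left.
  by apply/eqP/eq_bigl => x; rewrite !inE; case: (x \in sA st).
rewrite /EZ /Ex Exl_sum; apply: ler_sum => x xA.
case gx: (good u st x); last first.
  rewrite -[leRHS](Exl_cst (pr u st) (enum {: E + X}) (1 - delta) set0).
  by apply: (le_Exl pr01) => Z; rewrite inE xA gx.
rewrite -(untouched_eq gx); apply: (le_Exl pr01) => Z.
rewrite ler_nat inE xA gx /=; case h: (_ && _) => //; rewrite lt0b.
move: h => /andP[xZ /forallP h]; rewrite disjoint_subset; apply/subsetP => t.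
rewrite !inE; case/orP => [/eqP -> //|/imsetP[g]].
rewrite inE andbT => xg ->; apply: contraTN xg => gZ.
by have := h g; rewrite gZ.
Qed.

(** Bounds the conditional probability that [g] is sampled by the end of the step: [b / dR]
    dominates every sampling probability. *)
Definition aS (g : E) : R := (g \in sS st)%:R + b / dR.

Let bd_ge0 : 0 <= b / dR.
Proof. by rewrite divr_ge0 ?(ltW dR_gt0) // (le_trans ler01). Qed.

Lemma aS_ge0 g : 0 <= aS g.
Proof. by rewrite addr_ge0. Qed.

Lemma prod_aS (A : {set E}) : \prod_(g in A :\: sS st) pe u st g <= \prod_(g in A) aS g.
Proof.
rewrite [leRHS](bigID (mem (sS st))) /=.
rewrite -[leLHS]mul1r; apply: ler_pM => //.
- by apply: prodr_ge0 => g _; apply: pe_ge0.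
- apply: le_trans (_ : \prod_(g in A | g \in sS st) (1 : R) <= _); first by rewrite big1.
  by apply: ler_prod => g /andP[_ gS]; rewrite ler01 /= /aS gS lerDl.
rewrite (eq_bigl (fun g => (g \in A) && (g \notin sS st))) => [|g]; last by rewrite inE andbC.
apply: ler_prod => g /andP[_ gS]; rewrite pe_ge0 /= /aS (negbTE gS) add0r.
exact: pe_bd.
Qed.

Lemma PP_card K : PP K -> (#|K| <= J)%N.
Proof.
case/orP => [/conf_card/andP[]//|/existsP[e /existsP[g /andP[_ /eqP ->]]]].
by rewrite cards2; apply: leq_trans J2; case: (e != g).
Qed.

Definition meets (e e' : E) (K K' : {set E}) := (K :\ e) :&: (K' :\ e') != set0.

Definition Err (e e' : E) (P1 P2 : pred {set E}) :=
  \sum_(K | P1 K) \sum_(K' | P2 K' && meets e e' K K')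
     \prod_(g in (K :\ e) :|: (K' :\ e')) aS g.

Lemma Err_ge0 e e' P1 P2 : 0 <= Err e e' P1 P2.
Proof.
by apply: sumr_ge0 => K _; apply: sumr_ge0 => K' _; apply: prodr_ge0 => g _; apply: aS_ge0.
Qed.

(** Only kill sets with a common coordinate contribute to [avoids_corr]. A dummy coordinate is never
    common to both families, so what remains are sets [K], [K'] that meet outside [e] and [e']. *)
Lemma corr_err e e' (P1 P2 : pred ({set E} + X)) :
  (forall K, P1 (inl K) -> PP K) ->
  (forall y, P1 (inr y) -> ~~ P2 (inr y)) ->
  \sum_(i | P1 i) \sum_(j | P2 j) #|KU (sS st) e i :&: KU (sS st) e' j|%:R *
      \prod_(t in KU (sS st) e i :|: KU (sS st) e' j) pr u st t
  <= J%:R * Err e e' (P1 \o inl) (P2 \o inl).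
Proof.
move=> P1K P12.
have pr0 A : 0 <= \prod_(t in A) pr u st t :> R.
  by apply: prodr_ge0 => t _; case/andP: (pr01 t).
rewrite /Err big_sumType /= [X in _ + X]big1 ?addr0; last first.
  move=> y yP; apply: big1 => -[K|y'] yP'; rewrite [_ :&: _](_ : _ = set0) ?cards0 ?mul0r //.
    by apply/setP => t; rewrite !inE; apply/andP => -[/eqP -> /imsetP[]].
  apply/setP => t; rewrite !inE; apply/andP => -[/eqP -> /eqP[yy]].
  by move: (P12 y yP); rewrite yy yP'.
rewrite big_distrr /=; apply: ler_sum => K KP1.
rewrite big_sumType /= [X in _ + X]big1 ?addr0; last first.
  move=> y' yP'; rewrite [_ :&: _](_ : _ = set0) ?cards0 ?mul0r //.
  by apply/setP => t; rewrite !inE; apply/andP => -[/imsetP[g _ ->]].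
rewrite big_distrr /= [leRHS]big_mkcondr /=; apply: ler_sum => K' KP2.
have injl : injective (@inl E X) by move=> ? ? [].
rewrite -imsetI; last by move=> ? ? _ _; apply: injl.
rewrite card_imset // -imsetU big_imset /=; last by move=> ? ? _ _; apply: injl.
rewrite -setDUl; case: ifP => [_|/negbT]; last first.
  rewrite negbK => /eqP m0; rewrite [_ :&: _](_ : _ = set0) ?cards0 ?mul0r //.
  apply/eqP; rewrite -subset0 -m0; apply/subsetP => g.
  by rewrite !inE => /andP[/andP[_ ->] /andP[_ ->]].
apply: ler_pM => //.
- by apply: prodr_ge0 => g _; apply: pe_ge0.
- rewrite ler_nat; apply: leq_trans (PP_card (P1K _ KP1)).
  by apply: subset_leq_card; apply/subsetP => g; rewrite !inE => /andP[/andP[_ /andP[_ ->]]].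
exact: prod_aS.
Qed.

Lemma olap_sym e g : olap e g = olap g e.
Proof. by rewrite /olap eq_sym disjoint_sym. Qed.

Lemma PP_olap e g : olap e g -> PP [set e; g].
Proof. by move=> h; apply/orP; right; apply/existsP; exists e; apply/existsP; exists g; rewrite h eqxx. Qed.

Lemma DokP Z e K : Dok st e Z -> PP K -> e \in K -> ~~ (K :\ e \subset sS st :|: ZE Z).
Proof.
move=> /forallP/(_ (inl K)) /= h PK eK; move: h; rewrite PK eK /= sub_inl.
by apply: contraNN; rewrite (subDset (K :\ e)).
Qed.

Lemma set2D1 (e g : E) : e != g -> [set e; g] :\ e = [set g].
Proof. by move=> eg; apply/setP => z; rewrite !inE; case: eqP => [->|//]; rewrite (negbTE eg). Qed.

Lemma Inv_next Z : Inv (b / vlow) (next u st Z).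
Proof.
have v0 := vlow_gt0.
split.
- move=> e; rewrite inE => /and4P[eB ne eZ De]; have [y0 yb] := inv_y I eB.
  have ve := vlow_le eB ne; have ve0 := lt_le_trans v0 ve.
  split; rewrite /= ?mulr_gt0 // invfM; apply: ler_pM => //.
  + by rewrite invr_ge0 ltW.
  + by rewrite invr_ge0 ltW.
  + by rewrite lef_pV2.
- move=> e; rewrite inE => /and4P[eB /andP[_ /forall_inP ge] eZ De]; apply/subsetP => x xe.
  rewrite inE (subsetP (inv_A I eB)) //= ge //=; apply/andP; split.
    by move/forallP: De => /(_ (inr x)) /=; rewrite xe /= sub1set.
  apply/forallP => g; apply/implyP => gZ; apply/negP => xg.
  case: (eqVneq e g) => eg; first by move: eZ; rewrite eg gZ.
  have oeg : olap e g.
    by rewrite /olap eg -setI_eq0; apply/set0Pn; exists x; rewrite inE xe.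
  have := DokP De (PP_olap oeg); rewrite !inE eqxx => /(_ isT).
  by rewrite set2D1 // sub1set !inE gZ orbT.
- by move=> e K; rewrite inE => /and4P[eB ne eZ De] PK eK; apply: DokP.
- by move=> e; rewrite inE => /and4P[eB ne eZ De]; rewrite !inE (negbTE (inv_S I eB)) (negbTE eZ).
- apply/subsetP => g; rewrite !inE => /orP[/(subsetP (inv_Acc I)) -> //|].
  by move=> /and3P[_ -> _]; rewrite orbT.
- have aux e g : e \in sAcc st -> g \in sB st -> ~~ olap g e.
    move=> eA gB; apply/negP => o; have /andP[ge _] := o.
    have := inv_K I gB (PP_olap o); rewrite !inE eqxx => /(_ isT).
    by rewrite set2D1 // sub1set (subsetP (inv_Acc I)).
  move=> e g; rewrite !inE => /orP[eA|/and3P[eB eZ /and3P[_ /forallP/(_ g) h _]]];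
    move=> /orP[gA|/and3P[gB gZ /and3P[_ /forallP/(_ e) h' _]]].
  + exact: (inv_olap I).
  + by rewrite olap_sym; apply: aux.
  + exact: aux.
  + by move: h; rewrite gZ.
- move=> C CC; apply/negP => CA.
  have AS : sAcc (next u st Z) \subset sS st :|: ZE Z.
    apply/subsetP => g; rewrite !inE => /orP[/(subsetP (inv_Acc I)) -> //|].
    by move=> /and3P[_ -> _]; rewrite orbT.
  have /subsetPn[g gC gA] := inv_Conf I CC.
  have := subsetP CA g gC; rewrite inE (negbTE gA) inE /=.
  move=> /and5P[_ _ _ _ /forall_inP/(_ C CC)]; rewrite gC => /negP; apply.
  by apply: subset_trans (subset_trans CA AS); apply: subD1set.
- move=> e He; apply: (inv_H I); move: He; rewrite !inE.
  by case/orP => [/andP[->//]|/orP[->|/andP[->//]]]; rewrite ?orbT.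
Qed.

Lemma vlow_le1 : vlow <= 1.
Proof.
have /andP[d0 d1] := delta01.
have d2 : 0 <= 1 - delta by rewrite subr_ge0 ltW.
apply: mulr_ile1.
- exact: exprn_ge0.
- by rewrite invr_ge0 exprn_ge0.
- by apply: exprn_ile1 => //; rewrite lerBlDr lerDl ltW.
- by rewrite invf_le1 ?exprn_gt0 // exprn_ege1 // ler1n.
Qed.

Lemma b'1 : 1 <= b / vlow.
Proof. by rewrite ler_pdivlMr ?vlow_gt0 // mul1r (le_trans vlow_le1). Qed.

Definition xpair x (e' : E) (K : {set E}) := [exists g, [&& g != e', x \in bd g & K == [set e'; g]]].

(** Both copies need [x] untouched, an event of probability [1 - delta] which the product of the two
    survival probabilities would count twice; hence the division by [1 - delta]. *)
Lemma EZ_MM e e' x : e != e' -> bd e :&: bd e' = [set x] ->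
  EZ (fun Z => M (next u st Z) e * M (next u st Z) e') <=
  M st e * M st e' / (1 - delta) + (b / vlow) ^+ 2 * (J%:R *
    Err e e' (fun K => KP e (inl K)) (fun K => KP e' (inl K) && ~~ xpair x e' K)).
Proof.
move=> ee' bdx.
have xx : x \in bd e :&: bd e' by rewrite bdx inE.
move: (xx); rewrite inE => /andP[xe xe'].
have d1 : 0 < 1 - delta by have /andP[] := delta01; rewrite subr_gt0.
have R0 : 0 <= M st e * M st e' / (1 - delta) + (b / vlow) ^+ 2 * (J%:R *
    Err e e' (fun K => KP e (inl K)) (fun K => KP e' (inl K) && ~~ xpair x e' K)).
  have b0 : 0 <= b / vlow := le_trans ler01 b'1.
  apply: addr_ge0; first by rewrite divr_ge0 ?mulr_ge0 ?M_ge0 // ltW.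
  by rewrite mulr_ge0 ?exprn_ge0 // mulr_ge0 ?Err_ge0.
have zero : (forall Z, M (next u st Z) e * M (next u st Z) e' = 0) ->
   EZ (fun Z => M (next u st Z) e * M (next u st Z) e') <= 0.
  move=> h; rewrite -[leRHS](Exl_cst (pr u st) (enum {: E + X}) 0 set0).
  by apply: (le_Exl pr01) => Z; rewrite h.
case ne: (nice u st e); last first.
  by apply: le_trans R0; apply: zero => Z; rewrite M_next ne mulr0 mul0r.
case ne': (nice u st e'); last first.
  by apply: le_trans R0; apply: zero => Z; rewrite [M _ e']M_next ne' mulr0 mulr0.
case eB': (e' \in sB st); last first.
  by apply: le_trans R0; apply: zero => Z; rewrite [M _ e']M_next /M eB' !mul0r mulr0.
have gx : good u st x by case/andP: ne => _ /forall_inP/(_ x xe).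
(* The conditions on [e'] with those at [x] removed: the overlaps through [x] and its dummy
   coordinate. [H1] compares them with the survival of [e], and [H2] restores the condition at [x]
   at the price [1 - delta]. *)
pose P2 (i : {set E} + X) := match i with
  | inl K => KP e' (inl K) && ~~ xpair x e' K | inr y => (y \in bd e') && (y != x) end.
pose Rk (Z : {set E + X}) := avoids P2 (KU (sS st) e') Z.
have c := avoids_corr pr01 (KP e) P2 (KU (sS st) e) (KU (sS st) e').
have H1 : EZ (fun Z => (Dok st e Z && Rk Z)%:R) <= v u st e * EZ (fun Z => (Rk Z)%:R) +
   J%:R * Err e e' (fun K => KP e (inl K)) (fun K => KP e' (inl K) && ~~ xpair x e' K).
  apply: le_trans c _; rewrite lerD2l; apply: corr_err.
    by move=> K /andP[].
  move=> y yP /=; have ye : y \in bd e := yP; apply/negP => /andP[ye' /eqP]; apply.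
  by apply/set1P; rewrite -bdx inE ye.
have H2 : (1 - delta) * EZ (fun Z => (Rk Z)%:R) <= v u st e'.
  apply: le_trans (_ : EZ (fun Z => [disjoint touch x (fun g => g != e') & Z]%:R) * EZ (fun Z => (Rk Z)%:R) <= _).
    by apply: ler_wpM2r; [apply: (Exl_ge0 pr01) => Z | exact: untouched_ge].
  apply: le_trans (harris_anti pr01 _ _ (@anti_disjoint _) (@anti_avoids _ _ _ _ _)) _.
  apply: (le_Exl pr01) => Z; rewrite -natrM mulnb ler_nat; case h: (_ && _) => //.
  rewrite lt0b; move/andP: h => [dj /forallP rk]; apply/forallP => -[K|y]; apply/implyP => /=.
    case xK: (xpair x e' K); last first.
      by move=> kp; have := rk (inl K); rewrite /= kp xK.
    case/existsP: xK => g /and3P[ge' xg /eqP KE] /andP[PK eK].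
    have := inv_K I eB' PK eK; rewrite KE set2D1 1?eq_sym // sub1set => gS.
    rewrite sub_inl; have -> : [set g] :\: sS st = [set g].
      by apply/setDidPl; rewrite disjoints_subset sub1set inE.
    rewrite sub1set inE; apply: contraL dj => gZ.
    rewrite -setI_eq0; apply/set0Pn; exists (inl g); rewrite !inE gZ andbT.
    by apply/imsetP; exists g; rewrite ?inE ?xg.
  move=> ye'; case: (eqVneq y x) => [->|yx]; last by have := rk (inr y); rewrite /= ye' yx.
  rewrite sub1set; apply: contraL dj => xZ.
  by rewrite -setI_eq0; apply/set0Pn; exists (inr x); rewrite !inE eqxx.
set er := Err _ _ _ _ in H1 R0 *.
have er0 : 0 <= er := Err_ge0 _ _ _ _.
pose a := M st e / v u st e; pose a' := M st e' / v u st e'.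
have [a0 a0'] : 0 <= a /\ 0 <= a' by split; apply: M_v_ge0.
apply: le_trans (_ : a * a' * EZ (fun Z => (Dok st e Z && Rk Z)%:R) <= _).
  rewrite -ExlZ; apply: (le_Exl pr01) => Z.
  rewrite !M_next ne ne' -/a -/a' mulrACA; apply: ler_wpM2l; first exact: mulr_ge0.
  rewrite -natrM ler_nat mulnb /=; case De: (Dok st e Z); last by rewrite andbF.
  case De': (Dok st e' Z); last by rewrite !andbF.
  rewrite (_ : Rk Z = true); first by case: (_ && _).
  apply/forallP => -[K|y]; apply/implyP => /= /andP[h _].
    by move/forallP: De' => /(_ (inl K)) /=; rewrite h.
  by move/forallP: De' => /(_ (inr y)) /=; rewrite h.
apply: le_trans (ler_wpM2l (mulr_ge0 a0 a0') H1) _.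
rewrite mulrDr; apply: lerD; last first.
  apply: ler_wpM2r; first by rewrite mulr_ge0.
  by rewrite expr2; apply: ler_pM; rewrite ?M_v_le.
have ->: a * a' * (v u st e * EZ (fun Z => (Rk Z)%:R)) = M st e * (a' * EZ (fun Z => (Rk Z)%:R)).
  by rewrite -{1}(M_v ne) -/a; ring.
rewrite -mulrA; apply: ler_wpM2l; first exact: M_ge0.
rewrite ler_pdivlMr // -mulrA -[leRHS](M_v ne'); apply: ler_wpM2l => //.
by rewrite mulrC.
Qed.

Definition ErrK e e' := Err e e' (fun K => KP e (inl K)) (fun K => KP e' (inl K)).

(** Joint survival is again an avoidance event, indexed by a copy and one of its kill sets, so
    [avoids_corr] adds one copy at a time. Dummy coordinates cause no error because the copies of a
    conflict have disjoint pairs. *)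
Lemma corr_seq (l : seq E) C : C \in Conf -> uniq l -> {subset l <= C} ->
  EZ (fun Z => (all (fun e => Dok st e Z) l)%:R) <=
  \prod_(e <- l) v u st e + J%:R * \sum_(e <- l) \sum_(e' <- l | e != e') ErrK e e'.
Proof.
move=> CC; elim: l => [|e l IH].
  by move=> _ _; rewrite !big_nil mulr0 addr0 /EZ /Ex Exl_cst.
rewrite cons_uniq => /andP[el ul] lC.
have lC' : {subset l <= C} by move=> g gl; apply: lC; rewrite inE gl orbT.
have eC : e \in C by apply: lC; rewrite inE eqxx.
pose P2 (i : E * ({set E} + X)) := (i.1 \in l) && KP i.1 i.2.
pose U2 (i : E * ({set E} + X)) := KU (sS st) i.1 i.2.
have allE Z : all (fun e => Dok st e Z) l = avoids P2 U2 Z.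
  apply/allP/forallP => [h [g i]|h g gl].
    by apply/implyP => /andP[/= gl]; apply: (implyP (forallP (h g gl) i)).
  by apply/forallP => i; apply/implyP => gi; have := h (g, i); rewrite /P2 /= gl gi.
have c := avoids_corr pr01 (KP e) P2 (KU (sS st) e) U2.
apply: le_trans (_ : EZ (fun Z => (Dok st e Z && avoids P2 U2 Z)%:R) <= _).
  by apply: (le_Exl pr01) => Z; rewrite /= allE.
apply: le_trans c _.
have -> : Ex (pr u st) (fun Z => (avoids P2 U2 Z)%:R) = EZ (fun Z => (all (fun e => Dok st e Z) l)%:R).
  by apply: eq_Exl => Z; rewrite allE.
set er := \sum_(i | KP e i) _.
have Her : er <= J%:R * \sum_(e' <- l) ErrK e e'.
  apply: le_trans (_ : \sum_(e' in l) \sum_(i | KP e i) \sum_(j | KP e' j)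
     #|KU (sS st) e i :&: KU (sS st) e' j|%:R *
      \prod_(t in KU (sS st) e i :|: KU (sS st) e' j) pr u st t <= _).
    by rewrite exchange_big /=; apply: ler_sum => i _; rewrite pair_big_dep /=.
  rewrite (big_uniq _ ul) big_distrr /=; apply: ler_sum => e' e'l.
  apply: (@corr_err e e' (KP e) (KP e')); first by move=> K /andP[].
  move=> y ye; apply/negP => ye'.
  have ee' : e != e' by apply: contraNneq el => ->.
  have := conf_dis CC eC (lC' _ e'l) ee'; rewrite -setI_eq0 => /eqP/setP/(_ y).
  by rewrite !inE [y \in bd e]ye [y \in bd e']ye'.
have S1 : \sum_(e' <- l) ErrK e e' + \sum_(a <- l) \sum_(c <- l | a != c) ErrK a c <=
    \sum_(a <- e :: l) \sum_(c <- e :: l | a != c) ErrK a c.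
  rewrite [leRHS]big_cons; apply: lerD.
    rewrite big_cons eqxx /= big_seq [leRHS]big_seq_cond /= le_eqVlt; apply/orP; left.
    apply/eqP/eq_bigl => g; case gl: (g \in l) => //=.
    by symmetry; apply: contraNneq el => ->.
  apply: ler_sum => a _; rewrite big_cons; case: ifP => _ //.
  by rewrite lerDr Err_ge0.
have J0 : 0 <= J%:R :> R by [].
apply: le_trans (_ : v u st e * (\prod_(e <- l) v u st e + J%:R * \sum_(e <- l) \sum_(e' <- l | e != e') ErrK e e')
   + J%:R * \sum_(e' <- l) ErrK e e' <= _).
  by apply: lerD => //; apply: ler_wpM2l; [exact: v_ge0 | exact: IH].
have SS0 : 0 <= \sum_(e <- l) \sum_(e' <- l | e != e') ErrK e e'.
  by apply: sumr_ge0 => a _; apply: sumr_ge0 => a' _; apply: Err_ge0.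
rewrite mulrDr -[X in _ <= X + _]/(\prod_(e <- e :: l) v u st e) big_cons -addrA lerD2l.
apply: le_trans (ler_wpM2l J0 S1); rewrite mulrDr addrC lerD2l.
by apply: ler_piMl; rewrite ?v_le1 // mulr_ge0.
Qed.

Lemma sum_sub_le (T : finType) (A B : pred T) (F : T -> R) :
  (forall x, A x -> B x) -> (forall x, 0 <= F x) -> \sum_(x | A x) F x <= \sum_(x | B x) F x.
Proof.
move=> AB F0; rewrite [leRHS](bigID A) /=.
rewrite (eq_bigl (fun x => B x && A x)); last first.
  by move=> x; case Ax: (A x); rewrite ?andbF // AB.
by rewrite lerDl sumr_ge0.
Qed.

Fixpoint splits (l : seq E) : seq (seq E * seq E) :=
  if l is x :: l' then [seq (x :: p.1, p.2) | p <- splits l'] ++ [seq (p.1, x :: p.2) | p <- splits l']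
  else [:: ([::], [::])].

Lemma prod_splits (l : seq E) (f g : E -> R) :
  \prod_(e <- l) (f e + g e) = \sum_(p <- splits l) (\prod_(e <- p.1) f e * \prod_(e <- p.2) g e).
Proof.
elim: l => [|x l IH] /=; first by rewrite big_seq1 !big_nil mulr1.
rewrite big_cons IH big_cat !big_map /= mulrDl !big_distrr /=.
by congr (_ + _); apply: eq_bigr => p _; rewrite big_cons; ring.
Qed.

Lemma size_splits l : size (splits l) = (2 ^ size l)%N.
Proof. by elim: l => //= x l IH; rewrite size_cat !size_map IH expnS mul2n addnn. Qed.

Lemma splits_perm l p : p \in splits l -> perm_eq (p.1 ++ p.2) l.
Proof.
elim: l p => [|x l IH] p /=; first by rewrite inE => /eqP ->.
rewrite mem_cat => /orP[]/mapP[q /IH h ->] /=; first by rewrite perm_cons.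
by rewrite -(cat1s x q.2) perm_catCA /= perm_cons.
Qed.

Lemma prod_bool (r : seq E) (c : E -> R) (P : pred E) :
  \prod_(g <- r) (c g * (P g)%:R) = (\prod_(g <- r) c g) * (all P r)%:R.
Proof.
elim: r => [|x r IH]; first by rewrite !big_nil mulr1.
by rewrite !big_cons IH /= -mulnb natrM; ring.
Qed.

Lemma EZ_all (r : seq E) : uniq r ->
  EZ (fun Z => (all (fun g => inl g \in Z) r)%:R) = \prod_(g <- r) pe u st g.
Proof.
move=> ur; rewrite (big_uniq _ ur) /=.
have -> : \prod_(g in r) pe u st g = \prod_(g in [set g in r]) pe u st g.
  by apply: eq_bigl => g; rewrite inE.
rewrite -Ex_sub_inl; apply: eq_Exl => Z; congr (_%:R); congr nat_of_bool.
apply/allP/subsetP => h g; first by rewrite !inE => /h.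
by move=> gr; have := h g; rewrite !inE; apply.
Qed.

Lemma EZ_lin (l : seq E) (f c : E -> R) : uniq l ->
  EZ (fun Z => \prod_(g <- l) (f g * (inl g \in Z)%:R + c g)) = \prod_(g <- l) (f g * pe u st g + c g).
Proof.
move=> ul; rewrite prod_splits.
have -> : EZ (fun Z => \prod_(g <- l) (f g * (inl g \in Z)%:R + c g)) =
  \sum_(p <- splits l) EZ (fun Z => \prod_(g <- p.1) f g * \prod_(g <- p.2) c g *
     (all (fun g => inl g \in Z) p.1)%:R).
  rewrite /EZ /Ex -Exl_sum; apply: eq_Exl => Z; rewrite prod_splits; apply: eq_bigr => p _.
  by rewrite prod_bool; ring.
rewrite big_seq [RHS]big_seq; apply: eq_bigr => p /splits_perm pp.
have : uniq (p.1 ++ p.2) by rewrite (perm_uniq pp).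
rewrite cat_uniq => /andP[u1 _].
have := EZ_all u1; rewrite /EZ /Ex ExlZ => ->; rewrite [in RHS]big_split /=; ring.
Qed.

(** A new sample adds at most [c] to the mean of each factor, that is, at most doubles it. *)
Lemma EZ_S (D : {set E}) (c : R) : b / dR <= c ->
  EZ (fun Z => \prod_(g in D) ((g \in sS (next u st Z))%:R + c)) <=
  2 ^+ #|D| * \prod_(g in D) ((g \in sS st)%:R + c).
Proof.
move=> bc; have c0 : 0 <= c := le_trans bd_ge0 bc.
have -> : EZ (fun Z => \prod_(g in D) ((g \in sS (next u st Z))%:R + c)) =
  EZ (fun Z => \prod_(g <- enum D) ((g \notin sS st)%:R * (inl g \in Z)%:R + ((g \in sS st)%:R + c))).
  apply: eq_Exl => Z; rewrite big_enum /=; apply: eq_bigr => g _; rewrite !inE addrA; congr (_ + _).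
  by case: (g \in sS st); rewrite /= ?mul0r ?mul1r ?add0r ?addr0.
rewrite EZ_lin ?enum_uniq // big_enum -prodr_const -big_split /=.
apply: ler_prod => g _; have := pe_ge0 g; have := le_trans (pe_bd g) bc => h1 h2.
by case: (g \in sS st); rewrite /= ?mul0r ?mul1r; apply/andP; split; lra.
Qed.

Definition Ep (C : {set E}) := \sum_(e in C :\: sS st) \sum_(e' in C :\: sS st | e != e') ErrK e e'.

Lemma sum_cst_seq (T : Type) (r : seq T) (c : R) : \sum_(p <- r) c = (size r)%:R * c.
Proof. by elim: r => [|x r IH]; rewrite ?big_nil ?mul0r // big_cons IH /= -natr1; ring. Qed.

(** An unsampled copy of [C] either survives, with mean weight at most [M], or is sampled, where
    [dR] times the probability is [theta * u * M]. Expanding the product over these two fates,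
    [harris_mixed] separates survival from sampling, so that [lam] simply grows by [theta * u]. *)
Lemma EZ_conf C lam : C \in Conf -> 0 <= lam <= 2 ->
  EZ (fun Z => \prod_(g in C) (lam * M (next u st Z) g + dR * (g \in sS (next u st Z))%:R)) <=
  \prod_(g in C) ((lam + theta * u) * M st g + dR * (g \in sS st)%:R) +
  (4 * (b / vlow)) ^+ J * (J%:R * (dR ^+ #|C :&: sS st| * Ep C)).
Proof.
move=> CC /andP[l0 l2]; have /andP[u0 u1] := u01.
have b'0 : 0 <= b / vlow := le_trans ler01 b'1.
set U := C :\: sS st; pose l := enum U.
pose al g := lam * (M st g / v u st g * (nice u st g)%:R).
have al0 g : 0 <= al g by rewrite mulr_ge0 // mulr_ge0 ?M_v_ge0.
have alle g : al g <= 2 * (b / vlow).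
  apply: ler_pM => //; first by rewrite mulr_ge0 ?M_v_ge0.
  by case ng: (nice u st g); rewrite ?mulr0 // mulr1 M_v_le.
have alv g : al g * v u st g <= lam * M st g.
  rewrite /al -mulrA; apply: ler_wpM2l => //; case ng: (nice u st g).
    by rewrite mulr1 M_v.
  by rewrite mulr0 mul0r M_ge0.
have alv0 g : 0 <= al g * v u st g by rewrite mulr_ge0 ?v_ge0.
pose pd g := dR * pe u st g.
have pdE g : pd g = theta * u * M st g.
  by rewrite /pd /pe -/dR; field; rewrite gt_eqF.
have pd0 g : 0 <= pd g by rewrite mulr_ge0 ?pe_ge0 // ltW.
have pdle g : pd g <= 2 * (b / vlow).
  apply: le_trans (_ : b <= _); last first.
    apply: le_trans (_ : b / vlow <= _); last by lra.
    by rewrite ler_pdivlMr ?vlow_gt0 // ler_piMr ?vlow_le1 // (le_trans ler01).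
  rewrite pdE; apply: le_trans (M_le g); apply: ler_piMl; first exact: M_ge0.
  by apply: mulr_ile1 => //; exact: ltW.
have SM g : g \in sS st -> M st g = 0.
  by rewrite /M; case: ifP => // gB gS; move: (inv_S I gB); rewrite gS.
have spl (F : E -> R) : \prod_(g in C) F g = \prod_(g in C :&: sS st) F g * \prod_(g <- l) F g.
  by rewrite (big_setID (sS st)) /l big_enum.
have constS (F : E -> R) : (forall g, g \in sS st -> F g = dR) ->
    \prod_(g in C :&: sS st) F g = dR ^+ #|C :&: sS st|.
  by move=> h; rewrite -prodr_const; apply: eq_bigr => g; rewrite inE => /andP[_ /h].
set k := #|_|.
have dk0 : 0 <= dR ^+ k by rewrite exprn_ge0 // ltW.
apply: le_trans (_ : EZ (fun Z => dR ^+ k *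
    \prod_(g <- l) (al g * (Dok st g Z)%:R + dR * (inl g \in Z)%:R)) <= _).
  apply: (le_Exl pr01) => Z; rewrite spl constS; last first.
    by move=> g gS; rewrite M_next SM // !mul0r mulr0 add0r !inE gS mulr1.
  apply: ler_wpM2l => //; rewrite /l !big_enum /=; apply: ler_prod => g; rewrite inE => /andP[gS gC].
  rewrite !inE (negbTE gS) /= M_next /al.
  have hm : 0 <= lam * (M st g / v u st g) by rewrite mulr_ge0 // M_v_ge0.
  case: (nice u st g); case: (_ \in Z); case: (Dok st g Z); rewrite /= ?mulr0 ?mulr1 ?mul0r ?addr0 ?add0r ?mulr0 ?addr0 ?add0r
    ?lexx ?hm ?(ltW dR_gt0) ?addr_ge0 ?(ltW dR_gt0) ?lerDl ?lerDr ?hm ?(ltW dR_gt0) //.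
have H : EZ (fun Z => \prod_(g <- l) (al g * (Dok st g Z)%:R + dR * (inl g \in Z)%:R)) <=
   \prod_(g <- l) (lam * M st g + theta * u * M st g) + (4 * (b / vlow)) ^+ J * (J%:R * Ep C).
  have sl : (size l <= J)%N.
    rewrite -cardE; have /andP[_ h] := conf_card CC; apply: leq_trans h.
    by apply: subset_leq_card; apply: subsetDl.
  have E0 : 0 <= Ep C.
    by apply: sumr_ge0 => a _; apply: sumr_ge0 => a' _; apply: Err_ge0.
  have JE0 : 0 <= J%:R * Ep C by rewrite mulr_ge0.
  have -> : EZ (fun Z => \prod_(g <- l) (al g * (Dok st g Z)%:R + dR * (inl g \in Z)%:R)) =
    \sum_(p <- splits l) EZ (fun Z => (\prod_(g <- p.1) al g * \prod_(g <- p.2) dR) *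
      ((all (fun g => Dok st g Z) p.1)%:R * (all (fun g => inl g \in Z) p.2)%:R)).
    rewrite /EZ /Ex -Exl_sum; apply: eq_Exl => Z; rewrite prod_splits; apply: eq_bigr => p _.
    by rewrite !prod_bool; ring.
  apply: le_trans (_ : \sum_(p <- splits l) (\prod_(g <- p.1) (lam * M st g) *
      \prod_(g <- p.2) (theta * u * M st g) + (2 * (b / vlow)) ^+ J * (J%:R * Ep C)) <= _); last first.
    rewrite big_split /= -prod_splits lerD2l sum_cst_seq size_splits mulrA.
    apply: ler_wpM2r => //.
    have -> : 4 * (b / vlow) = 2 * (2 * (b / vlow)) by ring.
    rewrite [leRHS]exprMn natrX; apply: ler_wpM2r; first by rewrite exprn_ge0 // mulr_ge0.
    by rewrite ler_eXn2l // ltr1n.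
  rewrite big_seq [leRHS]big_seq; apply: ler_sum => p /splits_perm pp.
  have up : uniq (p.1 ++ p.2) by rewrite (perm_uniq pp) enum_uniq.
  have := up; rewrite cat_uniq => /and3P[up1 _ up2].
  have p1U g : g \in p.1 -> g \in U.
    by move=> gp; rewrite -mem_enum -(perm_mem pp) mem_cat gp.
  rewrite [leLHS](_ : _ = (\prod_(g <- p.1) al g * \prod_(g <- p.2) dR) *
      EZ (fun Z => (all (fun g => Dok st g Z) p.1)%:R * (all (fun g => inl g \in Z) p.2)%:R));
    last exact: ExlZ.
  have P1 : 0 <= \prod_(g <- p.1) al g by apply: prodr_ge0.
  have P2 : 0 <= \prod_(g <- p.2) dR by apply: prodr_ge0 => *; apply: ltW.
  have P3 : 0 <= \prod_(g <- p.2) pe u st g by apply: prodr_ge0 => *; apply: pe_ge0.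
  have aD : antitone (fun Z => (all (fun g => Dok st g Z) p.1)%:R : R).
    move=> A B AB; rewrite ler_nat; case h: (all _ _) => //; rewrite lt0b; apply/allP => g gp.
    have := Dok_anti g AB; rewrite (allP h g gp) ler1n lt0b; exact.
  have mz : monotone (fun Z : {set E + X} => (all (fun g => inl g \in Z) p.2)%:R : R).
    move=> A B AB; rewrite ler_nat; case: (boolP (all (fun g => inl g \in A) p.2)) => [/allP h|_ //].
    have -> : all (fun g => inl g \in B) p.2 by apply/allP => g gp; apply: (subsetP AB) (h g gp).
    by [].
  have cs : EZ (fun Z => (all (fun g => Dok st g Z) p.1)%:R) <=
     \prod_(g <- p.1) v u st g + J%:R * Ep C.
    apply: le_trans (corr_seq CC up1 _) _.
      by move=> g /p1U; rewrite inE => /andP[].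
    rewrite lerD2l; apply: ler_wpM2l => //.
    rewrite (big_uniq _ up1) /=; apply: le_trans (_ : \sum_(e in p.1) \sum_(e' in U | e != e') ErrK e e' <= _).
      apply: ler_sum => e _; rewrite -big_filter (big_uniq _ (filter_uniq _ up1)) /=.
      apply: sum_sub_le => [e'|e']; last exact: Err_ge0.
      by rewrite mem_filter => /andP[-> /p1U ->].
    apply: sum_sub_le; first exact: p1U.
    by move=> e; apply: sumr_ge0 => e' _; apply: Err_ge0.
  apply: le_trans (_ : (\prod_(g <- p.1) al g * \prod_(g <- p.2) dR) *
     ((\prod_(g <- p.1) v u st g + J%:R * Ep C) * \prod_(g <- p.2) pe u st g) <= _).
    apply: ler_wpM2l; first exact: mulr_ge0.
    apply: le_trans (harris_mixed pr01 _ _ aD mz) _.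
    by move: (EZ_all up2); rewrite /EZ /Ex => ->; apply: ler_wpM2r.
  rewrite [leLHS](_ : _ = \prod_(g <- p.1) (al g * v u st g) * \prod_(g <- p.2) pd g +
      (\prod_(g <- p.1) al g * \prod_(g <- p.2) pd g) * (J%:R * Ep C)); last first.
    rewrite !big_split /=; ring.
  apply: lerD.
    apply: ler_pM; [exact: prodr_ge0 | exact: prodr_ge0 | |].
      by apply: ler_prod => g _; rewrite alv0 alv.
    by apply: ler_prod => g _; rewrite pd0 pdE /=.
  apply: ler_wpM2r => //.
  have b2 : 1 <= 2 * (b / vlow) by have := b'1; lra.
  apply: le_trans (_ : (2 * (b / vlow)) ^+ size (p.1 ++ p.2) <= _); last first.
    by rewrite (perm_size pp) ler_weXn2l.
  have pw (r : seq E) (F : E -> R) : (forall g, 0 <= F g) -> (forall g, F g <= 2 * (b / vlow)) ->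
      \prod_(g <- r) F g <= (2 * (b / vlow)) ^+ size r.
    move=> F0 F1; elim: r => [|g r IH]; first by rewrite big_nil expr0.
    by rewrite big_cons exprS; apply: ler_pM => //; apply: prodr_ge0.
  by rewrite size_cat exprD; apply: ler_pM; rewrite ?pw // prodr_ge0.
apply: le_trans (_ : dR ^+ k * EZ (fun Z => \prod_(g <- l) (al g * (Dok st g Z)%:R + dR * (inl g \in Z)%:R)) <= _).
  by rewrite /EZ /Ex ExlZ.
apply: le_trans (ler_wpM2l dk0 H) _.
rewrite [X in _ <= X + _]spl constS; last by move=> g gS; rewrite SM // mulr0 add0r gS mulr1.
have -> : \prod_(g <- l) ((lam + theta * u) * M st g + dR * (g \in sS st)%:R) =
   \prod_(g <- l) (lam * M st g + theta * u * M st g).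
  rewrite /l !big_enum /=; apply: eq_bigr => g; rewrite inE => /andP[/negbTE -> _].
  by rewrite mulr0 addr0 mulrDl.
rewrite -/k; set P := \prod_(g <- l) _; set cc := _ ^+ J.
by rewrite le_eqVlt; apply/orP; left; apply/eqP; ring.
Qed.

(** A sampled copy is refused for a bad pair, an overlapping sample or a completed conflict. The
    union bound charges [delta] for the overlaps at each of its [s] pairs and [w] for the
    conflicts. *)
Lemma EZ_Acc :
  \sum_g pe u st g * (1 - \sum_(x in bd g) (~~ good u st x)%:R - s%:R * delta - w u st g) <=
  EZ (fun Z => #|sAcc (next u st Z)|%:R) - #|sAcc st|%:R.
Proof.
have /andP[dl0 dl1] := delta01.
have w0 g : 0 <= w u st g.
  by apply: sumr_ge0 => C _; apply: prodr_ge0 => h _; apply: pe_ge0.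
pose bads g := [forall x in bd g, good u st x].
pose Q g := (g \in sB st) && bads g.
pose T1 (Z : {set E + X}) g : R := \sum_(g' | olap g g') ([set g; g'] \subset ZE Z)%:R.
pose T2 (Z : {set E + X}) g : R := \sum_(C in Conf | g \in C) (g |: (C :\ g :\: sS st) \subset ZE Z)%:R.
have ptw Z : \sum_(g | Q g) (([set g] \subset ZE Z)%:R - T1 Z g - T2 Z g) <=
    #|sAcc (next u st Z)|%:R - #|sAcc st|%:R.
  rewrite /next /=; set N := [set g in sB st | _].
  have -> : #|sAcc st :|: N|%:R - #|sAcc st|%:R = \sum_g (g \in N)%:R :> R.
    rewrite cardsU (_ : sAcc st :&: N = set0) ?cards0 ?subn0.
      by rewrite natrD addrAC subrr add0r -sum1_card natr_sum big_mkcond /=; apply: eq_bigr => g _; case: (g \in N).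
    apply/setP => g; rewrite !inE; apply/negP => /andP[gA /andP[gB _]].
    by move: (inv_S I gB); rewrite (subsetP (inv_Acc I)).
  apply: le_trans (_ : \sum_(g | Q g) (g \in N)%:R <= _); last first.
    exact: sum_sub_le.
  apply: ler_sum => g /andP[gB gg].
  have t1 : 0 <= T1 Z g by apply: sumr_ge0.
  have t2 : 0 <= T2 Z g by apply: sumr_ge0.
  case gN: (g \in N); first by case: (_ \subset _); rewrite /=; lra.
  rewrite sub1set; case gZ: (g \in ZE Z); last by rewrite /=; lra.
  have gZ' : inl g \in Z by move: gZ; rewrite inE.
  have : 1 <= T1 Z g \/ 1 <= T2 Z g; last by case=> h /=; lra.
  move: gN; rewrite inE gB gZ' /= -/(bads g) gg /= => /negbT; rewrite negb_and => /orP[|].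
    rewrite negb_forall => /existsP[g']; rewrite negb_imply negbK => /andP[g'Z og].
    left; rewrite /T1 (bigD1 g') //= (_ : _ \subset _); last first.
      by apply/subsetP => h /set2P[]->; rewrite inE.
    by rewrite lerDl sumr_ge0.
  rewrite negb_forall => /existsP[C hC].
  have [CC gC sub] : [/\ C \in Conf, g \in C & C :\ g \subset sS st :|: ZE Z].
    by move: hC; case: (C \in Conf); case: (g \in C); case: (_ \subset _).
  right; rewrite /T2 (bigD1 C) /= ?CC // (_ : _ \subset _); last first.
    by rewrite subUset sub1set gZ (subDset (C :\ g)).
  by rewrite lerDl sumr_ge0.
have Ez1 g : EZ (fun Z => ([set g] \subset ZE Z)%:R) = pe u st g.
  by rewrite Ex_sub_inl big_set1.
have Ez2 g g' : g != g' -> EZ (fun Z => ([set g; g'] \subset ZE Z)%:R) = pe u st g * pe u st g'.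
  by move=> gg; rewrite Ex_sub_inl big_setU1 ?big_set1 // inE.
apply: le_trans (_ : EZ (fun Z => \sum_(g | Q g) (([set g] \subset ZE Z)%:R - T1 Z g - T2 Z g)) <= _); last first.
  have -> : EZ (fun Z => #|sAcc (next u st Z)|%:R) - #|sAcc st|%:R =
      EZ (fun Z => #|sAcc (next u st Z)|%:R - #|sAcc st|%:R).
    by rewrite /EZ /Ex ExlD Exl_cst.
  exact: (le_Exl pr01).
(* Copies outside [Q] may be dropped: they have sampling probability 0, or a bad pair makes their
   bracket nonpositive. *)
rewrite /EZ /Ex Exl_sum (bigID Q) /= -[leRHS]addr0; apply: lerD; last first.
  apply: sumr_le0 => g; rewrite negb_and => /orP[gB|].
    by rewrite pe_out // mul0r.
  rewrite negb_forall => /existsP[x]; rewrite negb_imply => /andP[xg gx].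
  apply: mulr_ge0_le0; first exact: pe_ge0.
  rewrite (bigD1 x) //= gx /=.
  have sd : 0 <= s%:R * delta by rewrite mulr_ge0 // ltW.
  have : 0 <= \sum_(i in bd g | i != x) (~~ good u st i)%:R :> R by apply: sumr_ge0.
  by have := w0 g; lra.
apply: ler_sum => g /andP[gB /forall_inP gg].
rewrite !ExlD !ExlN -!/(Ex _ _) /T1 /T2.
move: (Ez1 g); rewrite /EZ => ->.
rewrite /Ex !Exl_sum.
have -> : \sum_(C in Conf | g \in C) Exl (pr u st) (enum {: E + X})
    (fun W => (g |: (C :\ g :\: sS st) \subset ZE W)%:R) set0 = pe u st g * w u st g.
  rewrite /w big_distrr /=; apply: eq_bigr => C _.
  by have := Ex_sub_inl (g |: (C :\ g :\: sS st)); rewrite /EZ /Ex => ->; rewrite big_setU1 //= !inE eqxx andbF.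
have h : \sum_(g' | olap g g') Exl (pr u st) (enum {: E + X})
    (fun W => ([set g; g'] \subset ZE W)%:R) set0 <= pe u st g * (s%:R * delta).
  apply: le_trans (_ : \sum_(g' | olap g g') pe u st g * pe u st g' <= _).
    by apply: ler_sum => g' /andP[gg' _]; have := Ez2 g g' gg'; rewrite /EZ /Ex => ->.
  rewrite -big_distrr /=; apply: ler_wpM2l; first exact: pe_ge0.
  apply: le_trans (_ : \sum_(x in bd g) \sum_(g' | x \in bd g') pe u st g' <= _).
    rewrite (exchange_big_dep predT) //=.
    rewrite [leLHS]big_mkcond /=; apply: ler_sum => g' _; case: ifP => [/andP[_]|_]; last first.
      by apply: sumr_ge0 => *; apply: pe_ge0.
    rewrite -setI_eq0 => /set0Pn[x]; rewrite inE => /andP[xg xg'].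
    by rewrite (bigD1 x) ?xg //= lerDl sumr_ge0 // => *; apply: pe_ge0.
  rewrite -(bd_s g) mulr_natl -sumr_const; apply: ler_sum => x xg.
  by apply/sum_pe/gg.
rewrite big1 => [|x xg]; last by rewrite gg.
by rewrite subr0 -subr_ge0; move: h; set S1 := \sum_(g' | _) _ => h; lra.
Qed.

(** * Charging the correlations to bad sets *)

Lemma prod_union (A B : {set E}) (f : E -> R) : (forall g, 0 <= f g <= 2) ->
  \prod_(g in A) f g * \prod_(g in B) f g <= 2 ^+ #|A| * \prod_(g in A :|: B) f g.
Proof.
move=> f02; have f0 g : 0 <= f g by case/andP: (f02 g).
have p0 (D : {set E}) : 0 <= \prod_(g in D) f g by apply: prodr_ge0.
have -> : \prod_(g in B) f g = \prod_(g in A :&: B) f g * \prod_(g in B :\: A) f g.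
  by rewrite (big_setID A) /= setIC.
have -> : \prod_(g in A :|: B) f g = \prod_(g in A) f g * \prod_(g in B :\: A) f g.
  by rewrite (big_setID A) /= setIC (setIidPl (subsetUl _ _)) setDUl setDv set0U.
rewrite mulrCA; apply: ler_wpM2r; first by rewrite mulr_ge0.
apply: le_trans (_ : 2 ^+ #|A :&: B| <= _).
  rewrite -prodr_const; apply: ler_prod => g _; exact: f02.
by rewrite ler_eXn2l ?ltr1n // subset_leq_card // subsetIl.
Qed.

(** Number of ways to choose two elements and three subsets of a set of size [m]: a bound for the
    tuples [(e, e', C, K, K')] with a given union. *)
Definition cnt (m : nat) : nat := m ^ 2 * (2 ^ m) ^ 3.

Lemma count_tuples (m : nat) (G : {set E} -> R) (Q : E -> E -> {set E} -> {set E} -> {set E} -> bool) :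
  (forall D, 0 <= G D) ->
  (forall e e' C K K', Q e e' C K K' -> [/\ e \in C, e' \in C & (#|C :|: K :|: K'| <= m)%N]) ->
  \sum_e \sum_e' \sum_C \sum_K \sum_K' (Q e e' C K K')%:R * G (C :|: K :|: K') <=
  (cnt m)%:R * \sum_(D : {set E} | (#|D| <= m)%N) G D.
Proof.
move=> G0 HQ; rewrite !pair_bigA /=.
pose U (t : E * E * {set E} * {set E} * {set E}) := t.1.1.2 :|: t.1.2 :|: t.2.
pose Q' (t : E * E * {set E} * {set E} * {set E}) := Q t.1.1.1.1 t.1.1.1.2 t.1.1.2 t.1.2 t.2.
rewrite [leLHS](eq_bigr (fun t => if Q' t then G (U t) else 0)); last first.
  by move=> t _; rewrite -/(Q' t) -/(U t); case: (Q' t); rewrite ?mul1r ?mul0r.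
rewrite -big_mkcond (partition_big U (fun D => #|D| <= m)%N) /=; last by move=> t /HQ[].
rewrite big_distrr /=; apply: ler_sum => D Dm.
rewrite (eq_bigr (fun=> G D)); last by move=> t /andP[_ /eqP ->].
rewrite sumr_const -[leLHS]mulr_natl; apply: ler_wpM2r => //; rewrite ler_nat.
apply: leq_trans (_ : #|setX (setX (setX (setX D D) (powerset D)) (powerset D)) (powerset D)| <= _)%N.
  apply/subset_leq_card/subsetP => -[[[[e e'] C] K] K'] /= /andP[/HQ /=[eC eC' _] /eqP /= <-].
  rewrite !in_setX /= !powersetE /U /=; rewrite !inE eC eC' /=.
  by rewrite subsetUr (subset_trans (subsetUl C K)) ?subsetUl // (subset_trans (subsetUr C K)) ?subsetUl.
rewrite !cardsX !card_powerset /cnt.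
have h : (2 ^ #|D| <= 2 ^ m)%N by rewrite leq_exp2l.
rewrite !expnS expn0 !muln1 -!mulnA; do !apply: leq_mul => //.
Qed.

(** If [e'] lies in [K] or [e] in [K'], then two of the three sets share two copies, and either they
    are equal or [A1] and [A2] apply; otherwise this is the situation of [A3]. *)
Lemma tuple_bad C K K' e e' : PP C -> PP K -> PP K' -> e != e' -> e \in C -> e' \in C ->
  e \in K -> e' \in K' -> meets e e' K K' ->
  [\/ bad (C :|: K :|: K'), K = C /\ K' = C |
    exists g x, [/\ C = [set e; e'], K = [set e; g], K' = [set e'; g],
     g != e' & [/\ x \in bd e, x \in bd e' & x \in bd g]]].
Proof.
move=> PC PK PK' ee' eC eC' eK eK' m.
have two (A B : {set E}) y z : y != z -> y \in A -> y \in B -> z \in A -> z \in B -> (1 < #|A :&: B|)%N.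
  move=> yz yA yB zA zB; have <- : #|[set y; z]| = 2%N by rewrite cards2 yz.
  by apply/subset_leq_card/subsetP => h /set2P[]->; rewrite inE ?yA ?zA.
have := m; rewrite /meets => /set0Pn[z]; rewrite !inE => /andP[/andP[ze zK] /andP[ze' zK']].
case e'K: (e' \in K).
  case: (eqVneq K C) => [KC|KC]; last first.
    apply: Or31; apply: A2 => //; last by apply/set0Pn; exists e'; rewrite !inE eK' eC'.
    by apply: A1; rewrite // ?(two _ _ e e') // eq_sym.
  subst K; case: (eqVneq K' C) => [KC'|KC']; first by apply: Or32.
  apply: Or31; rewrite setUid; apply: A1 => //; first by rewrite eq_sym.
  by apply: (two _ _ z e').
case eK'': (e \in K').
  case: (eqVneq K' C) => [KC|KC].
    subst K'; apply: Or31; rewrite setUAC setUid; apply: A1 => //.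
      by apply: contraFneq e'K => <-.
    by apply: (two _ _ z e).
  apply: Or31; rewrite setUAC; apply: A2 => //; last by apply/set0Pn; exists e; rewrite !inE eK eC.
  by apply: A1; rewrite // ?(two _ _ e e') // eq_sym.
have := A3 PC PK PK' ee' eC eC' eK eK'; rewrite e'K eK'' => /(_ isT isT m).
by case=> h; [apply: Or31 | apply: Or33].
Qed.

(** The first sum bounds the mean number of bad sets sampled. The second accounts for a conflict
    that acts as its own two kill sets, with the factor [b / dR] supplied by a copy not yet
    sampled. *)
Definition Phi := \sum_(D : {set E} | bad D && (#|D| <= 3 * J)%N) \prod_(g in D) aS g +
  b / dR * \sum_(C in Conf) \prod_(g in C) aS g.

Let G D := if bad D then \prod_(g in D) aS g else 0.

Let G0 D : 0 <= G D.
Proof. by rewrite /G; case: ifP => // _; apply: prodr_ge0 => g _; apply: aS_ge0. Qed.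

Let sumG : \sum_(D : {set E} | (#|D| <= 3 * J)%N) G D <= Phi.
Proof.
rewrite /Phi -big_mkcondr (eq_bigl (fun D => bad D && (#|D| <= 3 * J)%N)) => [|D]; last by rewrite andbC.
rewrite lerDl mulr_ge0 // sumr_ge0 // => C _; apply: prodr_ge0 => g _; exact: aS_ge0.
Qed.

Lemma aS02 g : 0 <= aS g <= 2.
Proof. by rewrite aS_ge0 /aS /=; have := bd4; case: (_ \in _); rewrite -/dR /=; lra. Qed.

Lemma term_bad (C K K' : {set E}) (e e' : E) : (#|C| <= J)%N -> e \in C -> e' \in C -> bad (C :|: K :|: K') ->
  \prod_(g in C) aS g * \prod_(g in (K :\ e) :|: (K' :\ e')) aS g <= 2 ^+ J * G (C :|: K :|: K').
Proof.
move=> CJ eC eC' bD; apply: le_trans (prod_union _ _ aS02) _.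
have -> : C :|: ((K :\ e) :|: (K' :\ e')) = C :|: K :|: K'.
  apply/setP => z; rewrite !inE; case: (eqVneq z e) => [->|_]; first by rewrite eC.
  by case: (eqVneq z e') => [->|_]; rewrite ?eC' //= orbA.
rewrite /G bD; apply: ler_wpM2r; first by apply: prodr_ge0 => g _; apply: aS_ge0.
by rewrite ler_eXn2l ?ltr1n.
Qed.

Let card3 C K K' : PP C -> PP K -> PP K' -> (#|C :|: K :|: K'| <= 3 * J)%N.
Proof.
move=> /PP_card h1 /PP_card h2 /PP_card h3; rewrite mulSn mulSn mul1n addnA.
by apply: leq_trans (leq_card_setU _ _) _; apply: leq_add => //; apply: leq_trans (leq_card_setU _ _) _; apply: leq_add.
Qed.

(** A tuple is charged to its union if that is bad. In the case [K = K' = C] the copy [e'] is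
    unsampled, which gives the second term of [Phi]. The exception in [A3] would force [C] to have
    two elements, but conflicts have at least three. *)
Lemma claimA : \sum_(C in Conf) (\prod_(g in C) aS g) * Ep C <= 2 ^+ J * (cnt (3 * J) + J ^ 2)%:R * Phi.
Proof.
have P0 (A : {set E}) : 0 <= \prod_(g in A) aS g by apply: prodr_ge0 => g _; apply: aS_ge0.
pose Xc (C : {set E}) := 2 ^+ J * (b / dR * \prod_(g in C) aS g).
have X0 C : 0 <= Xc C by apply: mulr_ge0; [exact: exprn_ge0 | exact: mulr_ge0].
pose Q (e e' : E) (C K K' : {set E}) := [&& C \in Conf, e \in C :\: sS st, e' \in C :\: sS st, e != e', KP e (inl K),
   KP e' (inl K') & meets e e' K K'].
have QG e e' C K K' : 0 <= (Q e e' C K K')%:R * (2 ^+ J * G (C :|: K :|: K')).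
  by apply: mulr_ge0 => //; apply: mulr_ge0; [exact: exprn_ge0 | exact: G0].
have step e e' C : C \in Conf -> e \in C :\: sS st -> e' \in C :\: sS st -> e != e' ->
    (\prod_(g in C) aS g) * ErrK e e' <=
    \sum_K \sum_K' (Q e e' C K K')%:R * (2 ^+ J * G (C :|: K :|: K')) + Xc C.
  move=> CC eCS eCS' ee'.
  have /andP[eS eC] : (e \notin sS st) && (e \in C) by move: eCS; rewrite inE.
  have /andP[eS' eC'] : (e' \notin sS st) && (e' \in C) by move: eCS'; rewrite inE.
  have PC : PP C by rewrite /PP CC.
  have CJ : (#|C| <= J)%N by have /andP[] := conf_card CC.
  apply: le_trans (_ : \sum_K \sum_K' ((Q e e' C K K')%:R * (2 ^+ J * G (C :|: K :|: K')) +
      (if K' == C then (if K == C then Xc C else 0) else 0)) <= _); last first.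
    rewrite (eq_bigr (fun K => \sum_K' (Q e e' C K K')%:R * (2 ^+ J * G (C :|: K :|: K')) +
      (if K == C then Xc C else 0))) => [|K _]; last by rewrite big_split /= -big_mkcond big_pred1_eq.
    by rewrite big_split /= -[X in _ + X]big_mkcond big_pred1_eq.
  rewrite /ErrK /Err big_distrr big_mkcond /=; apply: ler_sum => K _.
  have nn K' : 0 <= (Q e e' C K K')%:R * (2 ^+ J * G (C :|: K :|: K')) +
      (if K' == C then (if K == C then Xc C else 0) else 0).
    by apply: addr_ge0; [exact: QG | case: ifP => // _; case: ifP].
  case: ifP => [/andP[PK eK]|_]; last by apply: sumr_ge0 => K' _.
  rewrite big_distrr big_mkcond /=; apply: ler_sum => K' _.
  case: ifP => [/andP[/andP[PK' eK'] m]|_]; last exact: nn.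
  have -> : Q e e' C K K' by rewrite /Q CC eCS eCS' ee' /= PK eK PK' eK'.
  rewrite mul1r.
  have [bD|[KC KC']|[g [x [Ce _ _ _ _]]]] := tuple_bad PC PK PK' ee' eC eC' eK eK' m.
  - apply: le_trans (term_bad CJ eC eC' bD) _.
    by rewrite lerDl; case: ifP => // _; case: ifP.
  - subst K K'; rewrite !eqxx; rewrite -[leLHS]add0r; apply: lerD.
      by apply: mulr_ge0; [exact: exprn_ge0 | exact: G0].
    rewrite /Xc mulrA [leRHS]mulrC; apply: ler_wpM2l; first exact: P0.
    have e'D : e' \in C :\ e :|: C :\ e' by rewrite !inE eC' eq_sym ee'.
    rewrite (bigD1 e') //= {1}/aS (negbTE eS') add0r [leRHS]mulrC; apply: ler_wpM2l => //.
    apply: le_trans (_ : 2 ^+ #|[set i in C :\ e :|: C :\ e' | i != e']| <= _).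
      rewrite -prodr_const [leRHS](eq_bigl (fun i => (i \in C :\ e :|: C :\ e') && (i != e'))) => [|i]; last by rewrite !inE.
      by apply: ler_prod => g _; apply: aS02.
    rewrite ler_eXn2l ?ltr1n //; apply: leq_trans CJ; apply/subset_leq_card/subsetP => g.
    by rewrite !inE => /andP[/orP[]/andP[]].
  - by have /andP[] := conf_card CC; rewrite Ce cards2 ee'.
apply: le_trans (_ : \sum_(C in Conf) (\sum_e \sum_e' \sum_K \sum_K'
     (Q e e' C K K')%:R * (2 ^+ J * G (C :|: K :|: K')) + (J ^ 2)%:R * Xc C) <= _).
  apply: ler_sum => C CC; rewrite /Ep big_distrr /= .
  apply: le_trans (_ : \sum_(e in C :\: sS st) \sum_(e' in C :\: sS st)
     (\sum_K \sum_K' (Q e e' C K K')%:R * (2 ^+ J * G (C :|: K :|: K')) + Xc C) <= _).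
    apply: ler_sum => e eC; rewrite big_distrr /= [leLHS]big_mkcondr /=; apply: ler_sum => e' eC'.
    case: ifP => [ee'|_]; first exact: step.
    by rewrite addr_ge0 ?X0 // sumr_ge0 // => K _; rewrite sumr_ge0 // => K' _; exact: QG.
  rewrite (eq_bigr (fun e => \sum_(e' in C :\: sS st) (\sum_K \sum_K'
      (Q e e' C K K')%:R * (2 ^+ J * G (C :|: K :|: K'))) + #|C :\: sS st|%:R * Xc C)); last first.
    by move=> e _; rewrite big_split /= sumr_const mulr_natl.
  rewrite big_split /= sumr_const -[X in _ + X]mulr_natl; apply: lerD.
    have nn e e' : 0 <= \sum_K \sum_K' (Q e e' C K K')%:R * (2 ^+ J * G (C :|: K :|: K')).
      by rewrite sumr_ge0 // => K _; rewrite sumr_ge0 // => K' _; exact: QG.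
    apply: le_trans (_ : \sum_(e in C :\: sS st) \sum_e' _ <= _).
      by apply: ler_sum => e _; apply: sum_sub_le.
    by apply: sum_sub_le => // e; apply: sumr_ge0.
  rewrite mulrA -natrM; apply: ler_wpM2r => //; rewrite ler_nat expnS expn1.
  have /andP[_ h] := conf_card CC; have h2 : (#|C :\: sS st| <= J)%N.
    by apply: leq_trans h; apply/subset_leq_card/subsetDl.
  exact: leq_mul.
rewrite big_split /= -big_distrr /=.
have -> : 2 ^+ J * (cnt (3 * J) + J ^ 2)%:R * Phi =
   2 ^+ J * (cnt (3 * J))%:R * Phi + (J ^ 2)%:R * (2 ^+ J * Phi) by rewrite natrD; ring.
apply: lerD; last first.
  apply: ler_wpM2l => //; rewrite /Xc -!big_distrr /=; apply: ler_wpM2l; first exact: exprn_ge0.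
  rewrite /Phi lerDr; apply: sumr_ge0 => D _; exact: P0.
apply: le_trans (_ : 2 ^+ J * \sum_e \sum_e' \sum_C \sum_K \sum_K' (Q e e' C K K')%:R * G (C :|: K :|: K') <= _).
  have -> : 2 ^+ J * \sum_e \sum_e' \sum_C \sum_K \sum_K' (Q e e' C K K')%:R * G (C :|: K :|: K') =
     \sum_C \sum_e \sum_e' \sum_K \sum_K' (Q e e' C K K')%:R * (2 ^+ J * G (C :|: K :|: K')).
    rewrite big_distrr /= [RHS]exchange_big /=; apply: eq_bigr => e _.
    rewrite big_distrr /= [RHS]exchange_big /=; apply: eq_bigr => e' _.
    rewrite big_distrr /=; apply: eq_bigr => C _; rewrite big_distrr /=; apply: eq_bigr => K _.
    by rewrite big_distrr /=; apply: eq_bigr => K' _; rewrite mulrCA.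
  apply: sum_sub_le => // C; apply: sumr_ge0 => e _; apply: sumr_ge0 => e' _.
  by rewrite sumr_ge0 // => K _; rewrite sumr_ge0 // => K' _; exact: QG.
rewrite -mulrA; apply: ler_wpM2l; first exact: exprn_ge0.
apply: le_trans (ler_wpM2l _ sumG); last exact: ler0n.
apply: count_tuples => // e e' C K K' /and5P[CC]; rewrite !inE => /andP[_ eC] /andP[_ eC'] _.
move=> /and3P[/andP[PK _] /andP[PK' _] _]; split => //.
by apply: card3; rewrite // /PP CC.
Qed.

Definition ErrX e e' x := Err e e' (fun K => KP e (inl K)) (fun K => KP e' (inl K) && ~~ xpair x e' K).

Definition sh1 (e e' : E) (x : X) := [&& e != e', x \in bd e, x \in bd e' &
  (bd e :|: hh e) :&: (bd e' :|: hh e') == [set x]].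

Lemma sh1P e e' x : sh1 e e' x -> e != e' /\ bd e :&: bd e' = [set x].
Proof.
case/and4P => ee' xe xe' /eqP h; split => //; apply/setP => y; rewrite -h !inE.
case: (eqVneq y x) => [->|yx]; first by rewrite xe xe'.
have := congr1 (fun A : {set X} => y \in A) h; rewrite !inE (negbTE yx).
by case: (y \in bd e); case: (y \in bd e'); case: (y \in hh e); case: (y \in hh e').
Qed.

(** The pair [[set e; e']] takes the place of [C]: both copies are unsampled, so [dR ^+ 2] times
    their factors [aS] is at least 1 and may be inserted. The exception in [A3] is what the
    exclusion of [xpair] removes. *)
Lemma claimB : \sum_e \sum_e' \sum_(x | sh1 e e' x)
    ((e \notin sS st) && (e' \notin sS st))%:R * ErrX e e' x <=
  dR ^+ 2 * (2 ^+ J * (cnt (3 * J))%:R * Phi).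
Proof.
have dRb : 1 <= dR * (b / dR) by rewrite mulrCA divff ?mulr1 // gt_eqF.
pose Q (e e' : E) (C K K' : {set E}) := [&& C == [set e; e'], PP C, KP e (inl K) & KP e' (inl K')].
have QG e e' C K K' : 0 <= (Q e e' C K K')%:R * G (C :|: K :|: K').
  by apply: mulr_ge0 => //; exact: G0.
have step e e' x : sh1 e e' x -> ((e \notin sS st) && (e' \notin sS st))%:R * ErrX e e' x <=
     dR ^+ 2 * (2 ^+ J * \sum_C \sum_K \sum_K' (Q e e' C K K')%:R * G (C :|: K :|: K')).
  move=> /sh1P[ee' bdx].
  have R0 : 0 <= dR ^+ 2 * (2 ^+ J * \sum_C \sum_K \sum_K' (Q e e' C K K')%:R * G (C :|: K :|: K')).
    apply: mulr_ge0; first by rewrite exprn_ge0 // ltW.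
    apply: mulr_ge0; first exact: exprn_ge0.
    by do 3! (apply: sumr_ge0 => ? _); exact: QG.
  case eS: (e \notin sS st); last by rewrite mul0r.
  case eS': (e' \notin sS st); last by rewrite mul0r.
  rewrite mul1r; have : x \in bd e :&: bd e' by rewrite bdx inE.
  rewrite inE => /andP[xe xe'].
  have PC : PP [set e; e'].
    by apply: PP_olap; rewrite /olap ee' -setI_eq0; apply/set0Pn; exists x; rewrite inE xe.
  have CJ : (#|[set e; e']| <= J)%N by rewrite cards2 ee'.
  have Pe : 1 <= dR ^+ 2 * \prod_(g in [set e; e']) aS g.
    rewrite big_setU1 ?big_set1 ?inE //= /aS (negbTE eS) (negbTE eS') !add0r.
    have -> : dR ^+ 2 * (b / dR * (b / dR)) = (dR * (b / dR)) * (dR * (b / dR)) by ring.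
    by rewrite -[1]mul1r; apply: ler_pM.
  have X0 : 0 <= ErrX e e' x by exact: Err_ge0.
  rewrite -[leLHS]mul1r; apply: le_trans (ler_wpM2r X0 Pe) _.
  rewrite -mulrA; apply: ler_wpM2l; first by rewrite exprn_ge0 // ltW.
  rewrite (bigD1 [set e; e']) //= mulrDr -[leLHS]addr0; apply: lerD; last first.
    apply: mulr_ge0; first exact: exprn_ge0.
    by do 3! (apply: sumr_ge0 => ? _); exact: QG.
  rewrite /ErrX /Err !big_distrr big_mkcond /=; apply: ler_sum => K _; rewrite !big_distrr /=.
  have QG' K' : 0 <= 2 ^+ J * ((Q e e' [set e; e'] K K')%:R * G ([set e; e'] :|: K :|: K')).
    by apply: mulr_ge0; [exact: exprn_ge0 | exact: QG].
  case: ifP => [/andP[PK eK]|_]; last by apply: sumr_ge0 => K' _.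
  rewrite big_mkcond /=; apply: ler_sum => K' _.
  case: ifP => [/andP[/andP[/andP[PK' eK'] nx] m]|_]; last exact: QG'.
  have -> : Q e e' [set e; e'] K K' by rewrite /Q eqxx PC /= PK eK PK' eK'.
  rewrite mul1r.
  have eC : e \in [set e; e'] by rewrite !inE eqxx.
  have eC' : e' \in [set e; e'] by rewrite !inE eqxx orbT.
  have [bD|[KC KC']|[g [y [Ce KE KE' ge' [ye ye' yg]]]]] := tuple_bad PC PK PK' ee' eC eC' eK eK' m.
  - exact: term_bad.
  - move: m; rewrite /meets KC KC' => /set0Pn[z]; rewrite !inE.
    by case: (z == e); case: (z == e').
  - case/negP: nx; apply/existsP; exists g; rewrite ge' KE' eqxx andbT.
    suff -> : x = y by [].
    by apply/esym/set1P; rewrite -bdx inE ye.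
apply: le_trans (_ : \sum_e \sum_e' dR ^+ 2 * (2 ^+ J * \sum_C \sum_K \sum_K'
    (Q e e' C K K')%:R * G (C :|: K :|: K')) <= _).
  apply: ler_sum => e _; apply: ler_sum => e' _.
  case: (pickP (sh1 e e')) => [x hx|h]; last first.
    rewrite big_pred0 //; apply: mulr_ge0; first by rewrite exprn_ge0 // ltW.
    apply: mulr_ge0; first exact: exprn_ge0.
    by do 3! (apply: sumr_ge0 => ? _); exact: QG.
  rewrite (big_pred1 x); first exact: step.
  move=> y; have [ee' bdx] := sh1P hx; apply/idP/eqP => [/sh1P[_]|->//].
  by rewrite bdx => /set1_inj.
rewrite (eq_bigr (fun e => dR ^+ 2 * \sum_e' (2 ^+ J * \sum_C \sum_K \sum_K'
    (Q e e' C K K')%:R * G (C :|: K :|: K')))) => [|e _]; last by rewrite -big_distrr.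
rewrite -big_distrr /=; apply: ler_wpM2l; first by rewrite exprn_ge0 // ltW.
rewrite (eq_bigr (fun e => 2 ^+ J * \sum_e' \sum_C \sum_K \sum_K'
    (Q e e' C K K')%:R * G (C :|: K :|: K'))) => [|e _]; last by rewrite -big_distrr.
rewrite -big_distrr -mulrA /=; apply: ler_wpM2l; first exact: exprn_ge0.
apply: le_trans (ler_wpM2l _ sumG); last exact: ler0n.
apply: count_tuples => // e e' C K K' /and4P[/eqP -> PC /andP[PK _] /andP[PK' _]].
by rewrite !inE !eqxx orbT; split => //; apply: card3.
Qed.

(** The generic part of the second moment of the degrees; the other pairs of copies through [x] are
    counted by [NB]. *)
Definition W st := \sum_e \sum_e' \sum_(x | sh1 e e' x) M st e * M st e'.

Lemma EZ_W : EZ (fun Z => W (next u st Z)) <=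
  W st / (1 - delta) + (b / vlow) ^+ 2 * (J%:R * (dR ^+ 2 * (2 ^+ J * (cnt (3 * J))%:R * Phi))).
Proof.
have d1 : 0 < 1 - delta by have /andP[] := delta01; rewrite subr_gt0.
have b'0 : 0 <= b / vlow := le_trans ler01 b'1.
apply: le_trans (_ : W st / (1 - delta) + (b / vlow) ^+ 2 * (J%:R *
  \sum_e \sum_e' \sum_(x | sh1 e e' x) ((e \notin sS st) && (e' \notin sS st))%:R * ErrX e e' x) <= _);
  last first.
  rewrite lerD2l; apply: ler_wpM2l; first by rewrite exprn_ge0.
  by apply: ler_wpM2l => //; exact: claimB.
rewrite /W /EZ /Ex Exl_sum mulr_suml !mulr_sumr -big_split /=; apply: ler_sum => e _.
rewrite Exl_sum mulr_suml !mulr_sumr -big_split /=; apply: ler_sum => e' _.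
rewrite Exl_sum mulr_suml !mulr_sumr -big_split /=; apply: ler_sum => x /sh1P[ee' bdx].
have E0 : 0 <= ErrX e e' x by exact: Err_ge0.
have R0 : 0 <= M st e * M st e' / (1 - delta) by rewrite divr_ge0 ?mulr_ge0 ?M_ge0 // ltW.
case BB : ((e \in sB st) && (e' \in sB st)).
  have /andP[eB eB'] := BB; rewrite (inv_S I eB) (inv_S I eB') mul1r.
  exact: EZ_MM.
apply: le_trans (_ : 0 <= _); last first.
  by apply: addr_ge0 => //; apply: mulr_ge0; [rewrite exprn_ge0 | rewrite !mulr_ge0].
rewrite -[leRHS](Exl_cst (pr u st) (enum {: E + X}) 0 set0).
apply: (le_Exl pr01) => Z; rewrite !M_next /M.
by move: BB; case: (e \in sB st) => //=; [move=> -> | move=> _]; rewrite !mul0r ?mulr0.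
Qed.

(** A potential for conflicts: a sampled copy counts 1 and an available one [lam * M / d]. A later
    value at [lam] is bounded by an earlier one at a larger [lam], so no joint law of several steps
    is required. *)
Definition TT (lam : R) st := \sum_(C in Conf) dR ^- #|C| * \prod_(g in C) (lam * M st g + dR * (g \in sS st)%:R).

Lemma EZ_TT lam : 0 <= lam <= 2 -> EZ (fun Z => TT lam (next u st Z)) <=
  TT (lam + theta * u) st + (4 * (b / vlow)) ^+ J * (J%:R * (2 ^+ J * (cnt (3 * J) + J ^ 2)%:R * Phi)).
Proof.
move=> lam02; have b'0 : 0 <= b / vlow := le_trans ler01 b'1.
have c0 : 0 <= (4 * (b / vlow)) ^+ J by rewrite exprn_ge0 // mulr_ge0.
have dm0 k : 0 <= dR ^- k by rewrite invr_ge0 exprn_ge0 // ltW.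
apply: le_trans (_ : TT (lam + theta * u) st + (4 * (b / vlow)) ^+ J * (J%:R *
   \sum_(C in Conf) (\prod_(g in C) aS g) * Ep C) <= _); last first.
  by rewrite lerD2l; apply: ler_wpM2l => //; apply: ler_wpM2l => //; exact: claimA.
rewrite /TT /EZ /Ex Exl_sum !mulr_sumr -big_split /=; apply: ler_sum => C CC.
rewrite ExlZ; apply: le_trans (ler_wpM2l (dm0 _) (EZ_conf CC lam02)) _.
rewrite mulrDr lerD2l.
have E0 : 0 <= Ep C by apply: sumr_ge0 => a _; apply: sumr_ge0 => a' _; apply: Err_ge0.
have -> : dR ^- #|C| * ((4 * (b / vlow)) ^+ J * (J%:R * (dR ^+ #|C :&: sS st| * Ep C))) =
  (4 * (b / vlow)) ^+ J * (J%:R * ((dR ^- #|C| * dR ^+ #|C :&: sS st|) * Ep C)) by ring.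
do 2! (apply: ler_wpM2l => //); apply: ler_wpM2r => //.
rewrite -(cardsID (sS st) C) exprD invfM mulrAC mulVf ?mul1r ?gt_eqF ?exprn_gt0 //.
rewrite [leRHS](big_setID (sS st)) /= -[leLHS]mul1r; apply: ler_pM; [by [] | exact: dm0 | |].
  apply: le_trans (_ : \prod_(g in C :&: sS st) (1 : R) <= _); first by rewrite big1.
  by apply: ler_prod => g; rewrite inE ler01 /= => /andP[_ gS]; rewrite /aS gS lerDl.
rewrite -exprVn -prodr_const; apply: ler_prod => g; rewrite inE => /andP[/negbTE gS _].
have dV0 : 0 <= dR^-1 by rewrite invr_ge0 ltW.
by rewrite dV0 /aS gS add0r ler_peMl.
Qed.

(** * Total weight and variance of the degrees *)

Definition Ms st := \sum_e M st e.
Definition VV st := \sum_x (Y u st x - (x \in sA st)%:R) ^+ 2.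

(** A form of Chebyshev's inequality: [y / (y - 1) ^+ 2] decreases for [y > 1], and its value at
    [1 + delta] is the constant. For a covered pair the deviation is [y] itself, which is larger
    than [y - 1]. *)
Lemma badM : \sum_e M st e * (\sum_(x in bd e) (~~ good u st x)%:R) <=
  dR / u * ((1 + delta) / delta ^+ 2) * VV st.
Proof.
have /andP[dl0 dl1] := delta01; have /andP[u0 u1] := u01.
rewrite (eq_bigr (fun e => \sum_(x in bd e) M st e * (~~ good u st x)%:R)) => [|e _]; last by rewrite mulr_sumr.
rewrite (exchange_big_dep predT) //= /VV mulr_sumr; apply: ler_sum => x _.
have c0 : 0 <= dR / u by rewrite divr_ge0 // ltW.
have c1 : 0 <= (1 + delta) / delta ^+ 2 by rewrite divr_ge0 ?exprn_ge0 ?ltW // addr_gt0.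
rewrite -mulr_suml; case gx: (good u st x).
  by rewrite mulr0; apply: mulr_ge0; [exact: mulr_ge0 | exact: sqr_ge0].
rewrite mulr1; have -> : \sum_(i | x \in bd i) M st i = dR / u * Y u st x.
  by rewrite /Y -/dR; field; rewrite !gt_eqF.
rewrite -[leRHS]mulrA; apply: ler_wpM2l => //.
move: gx => /negbT; rewrite /good -ltNge; set y := Y u st x => hy.
have d2 : 0 < delta ^+ 2 by rewrite exprn_gt0.
rewrite mulrAC ler_pdivlMr //.
have h : 0 <= (y - 1 - delta) * ((1 + delta) * y - 1).
  by apply: mulr_ge0; [lra | have : 0 <= delta * y by apply: mulr_ge0; lra]; lra.
have -> : y * delta ^+ 2 = (1 + delta) * (y - 1) ^+ 2 - (y - 1 - delta) * ((1 + delta) * y - 1) by ring.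
apply: le_trans (_ : (1 + delta) * (y - 1) ^+ 2 <= _); first by rewrite lerBlDr lerDl.
apply: ler_wpM2l; first by lra.
by rewrite ler_sqr ?nnegrE; case: (x \in sA st); rewrite /=; lra.
Qed.

(** Each term [M st e] times the sampling probabilities of the rest of [C] is a term of [TT 1] up to
    the factor [theta * dR]. The [theta] comes from an unsampled copy other than [e], which exists
    because [e] is still available. *)
Lemma Mw : \sum_e M st e * w u st e <= theta * dR * J%:R * TT 1 st.
Proof.
have dV0 : 0 <= dR^-1 by rewrite invr_ge0 ltW.
have Md g : 0 <= M st g / dR by rewrite mulr_ge0 ?M_ge0.
have F0 g : 0 <= M st g + dR * (g \in sS st)%:R by rewrite addr_ge0 ?M_ge0 // mulr_ge0 // ltW.
rewrite (eq_bigr (fun e => \sum_(C in Conf | e \in C) M st e * \prod_(g in C :\ e :\: sS st) pe u st g)); last first.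
  by move=> e _; rewrite /w mulr_sumr.
rewrite (exchange_big_dep (mem Conf)) /=; last by move=> ? ? _ /andP[].
rewrite /TT mulr_sumr; apply: ler_sum => C CC.
pose q := theta * dR * (dR ^- #|C| * \prod_(g in C) (1 * M st g + dR * (g \in sS st)%:R)).
have qE : q = theta * dR * \prod_(g in C) (M st g / dR + (g \in sS st)%:R).
  rewrite /q -exprVn -prodr_const -big_split /=; congr (_ * _); apply: eq_bigr => g _.
  by rewrite mul1r mulrDr mulrA mulVf ?gt_eqF // mul1r mulrC.
have q0 : 0 <= q.
  rewrite qE; apply: mulr_ge0; first by rewrite mulr_ge0 ?ltW.
  by apply: prodr_ge0 => g _; apply: addr_ge0.
apply: le_trans (_ : \sum_(e in C) q <= _); last first.
  rewrite sumr_const -[leLHS]mulr_natl.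
  have -> : theta * dR * J%:R * (dR ^- #|C| * \prod_(g in C) (1 * M st g + dR * (g \in sS st)%:R)) = J%:R * q.
    by rewrite /q; ring.
  by apply: ler_wpM2r => //; rewrite ler_nat; have /andP[] := conf_card CC.
rewrite (eq_bigl (mem C)) => [|e]; last by rewrite /= CC.
apply: ler_sum => e eC; case eB: (e \in sB st); last by rewrite /M eB mul0r.
have PC : PP C by rewrite /PP CC.
have /subsetPn[g0 g0C g0S] := inv_K I eB PC eC.
have g0U : g0 \in C :\ e :\: sS st by rewrite inE g0S.
have -> : q = M st e * (theta * \prod_(g in C :\ e :\: sS st) (M st g / dR)).
  rewrite qE (big_setD1 e) //= (big_setID (sS st)) /= [X in _ * (X * _)]big1; last first.
    move=> g; rewrite inE => /andP[_ gS]; rewrite /M; case: ifP => [gB|_].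
      by move: (inv_S I gB); rewrite gS.
    by rewrite mul0r add0r gS.
  rewrite (negbTE (inv_S I eB)) addr0 mul1r.
  rewrite (eq_bigr (fun g => M st g / dR)) => [|g]; last first.
    by rewrite inE => /andP[/negbTE -> _]; rewrite addr0.
  set P := \prod_(_ in _) _.
  have -> : theta * dR * (M st e / dR * P) = M st e * (theta * P) * (dR / dR) by ring.
  by rewrite divff ?mulr1 // gt_eqF.
apply: ler_wpM2l; first exact: M_ge0.
rewrite (bigD1 g0) //= [X in _ <= _ * X](bigD1 g0) //= mulrA; apply: ler_pM.
- exact: pe_ge0.
- by apply: prodr_ge0 => *; apply: pe_ge0.
- exact: pe_theta.
- by apply: ler_prod => g _; rewrite pe_ge0 pe_M.
Qed.

Lemma EZ_Ms_le : EZ (fun Z => Ms (next u st Z)) <= Ms st.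
Proof. by rewrite /EZ /Ex Exl_sum; apply: ler_sum => e _; apply: EZ_M_le. Qed.

(** Weight is lost on sampled copies, on copies with [w] above [kap], bounded by Markov's inequality
    and [Mw], and on copies with a bad pair, bounded by [badM]. *)
Lemma EZ_Ms : (0 < kap)%N ->
  Ms st - b / dR * Ms st - kap%:R^-1 * (theta * dR * J%:R * TT 1 st) -
    dR / u * ((1 + delta) / delta ^+ 2) * VV st <= EZ (fun Z => Ms (next u st Z)).
Proof.
move=> k0; have kR : 0 < kap%:R :> R by rewrite ltr0n.
have kV : 0 <= kap%:R^-1 :> R by rewrite invr_ge0 ltW.
apply: le_trans (_ : Ms st - b / dR * Ms st - kap%:R^-1 * (\sum_e M st e * w u st e) -
   \sum_e M st e * (\sum_(x in bd e) (~~ good u st x)%:R) <= _).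
  by have := badM; have := ler_wpM2l kV Mw; lra.
rewrite /EZ /Ex Exl_sum /Ms !mulr_sumr -!sumrB; apply: ler_sum => e _.
apply: le_trans (EZ_M_ge e).
have M0 := M_ge0 e; have w0 : 0 <= w u st e.
  by apply: sumr_ge0 => C _; apply: prodr_ge0 => h _; apply: pe_ge0.
have p1 : M st e * pe u st e <= b / dR * M st e by rewrite mulrC; apply: ler_wpM2r => //; exact: pe_bd.
have S0 : 0 <= \sum_(x in bd e) (~~ good u st x)%:R :> R by apply: sumr_ge0.
have t1 : 0 <= kap%:R^-1 * (M st e * w u st e) by rewrite !mulr_ge0.
have t2 := mulr_ge0 M0 S0.
have b0 : 0 <= b / dR * M st e by rewrite mulr_ge0.
case ne: (nice u st e); first by rewrite mulr1; lra.
rewrite mulr0; move: ne => /negbT; rewrite negb_and => /orP[wk|].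
  have : M st e <= kap%:R^-1 * (M st e * w u st e).
    rewrite mulrCA -[leLHS]mulr1; apply: ler_wpM2l => //.
    by rewrite ler_pdivlMl // mulr1 ltW // ltNge.
  by lra.
rewrite negb_forall => /existsP[x]; rewrite negb_imply => /andP[xe gx].
have : M st e <= M st e * \sum_(x in bd e) (~~ good u st x)%:R.
  by rewrite -[leLHS]mulr1; apply: ler_wpM2l => //; rewrite (bigD1 x) //= gx lerDl sumr_ge0.
by lra.
Qed.

Definition NB : R := \sum_x \sum_e \sum_e' [&& x \in bd e, x \in bd e' & ~~ sh1 e e' x]%:R.

Lemma sumM_bd : \sum_x \sum_(e | x \in bd e) M st e = s%:R * Ms st.
Proof.
rewrite (exchange_big_dep predT) //= /Ms mulr_sumr; apply: eq_bigr => e _.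
by rewrite sumr_const bd_s mulr_natl.
Qed.

Lemma VV_le : VV st <= u ^+ 2 / dR ^+ 2 * (W st + b ^+ 2 * NB) -
  2 * (u / dR * (s%:R * Ms st)) + #|sA st|%:R.
Proof.
have /andP[u0 u1] := u01.
(* Available copies have all their pairs uncovered, so the cross term of the square is the full sum
   of the degrees, that is, the total weight. *)
have YA x : Y u st x * (x \in sA st)%:R = Y u st x.
  case xA: (x \in sA st); first by rewrite mulr1.
  rewrite mulr0 /Y big1 ?mulr0 // => e xe; rewrite /M; case: ifP => // eB.
  by move: (subsetP (inv_A I eB) x xe); rewrite xA.
have -> : VV st = \sum_x (Y u st x) ^+ 2 - 2 * (u / dR * (s%:R * Ms st)) + #|sA st|%:R.
  rewrite -sumM_bd -sum1_card natr_sum [X in _ + X]big_mkcond /= !mulr_sumr -sumrB -big_split /=.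
  apply: eq_bigr => x _; rewrite -/(Y u st x).
  have -> : (if x \in sA st then 1 else 0) = (x \in sA st)%:R :> R by case: (_ \in _).
  have h : (x \in sA st)%:R ^+ 2 = (x \in sA st)%:R :> R by case: (_ \in _); rewrite ?expr1n ?expr0n.
  by have := YA x; set y := Y u st x => hy; rewrite sqrrB h hy mulr2n; ring.
rewrite -[in leRHS]addrA -[leLHS]addrA lerD2r.
have -> : u ^+ 2 / dR ^+ 2 = (u / dR) ^+ 2 by rewrite expr_div_n.
have -> : W st = \sum_x \sum_e \sum_e' (sh1 e e' x)%:R * (M st e * M st e').
  rewrite /W [RHS]exchange_big /=; apply: eq_bigr => e _; rewrite [RHS]exchange_big /=; apply: eq_bigr => e' _.
  by rewrite big_mkcond; apply: eq_bigr => x _; case: (sh1 _ _ _); rewrite ?mul1r ?mul0r.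
rewrite /NB mulr_sumr -big_split mulr_sumr /=; apply: ler_sum => x _.
rewrite /Y exprMn; apply: ler_wpM2l; first exact: sqr_ge0.
rewrite expr2 mulr_suml mulr_sumr -big_split /= big_mkcond /=; apply: ler_sum => e _.
have b0 : 0 <= b ^+ 2 by rewrite exprn_ge0 // (le_trans ler01).
rewrite [in leRHS]mulr_sumr -big_split /=.
have R0 : 0 <= \sum_e' ((sh1 e e' x)%:R * (M st e * M st e') +
     b ^+ 2 * [&& x \in bd e, x \in bd e' & ~~ sh1 e e' x]%:R).
  by apply: sumr_ge0 => e' _; (apply: addr_ge0; apply: mulr_ge0 => //; apply: mulr_ge0; exact: M_ge0).
case xe: (x \in bd e) => //; last by move: R0; rewrite xe.
rewrite mulr_sumr big_mkcond /=; apply: ler_sum => e' _.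
case xe': (x \in bd e'); last by (apply: addr_ge0; apply: mulr_ge0 => //; apply: mulr_ge0; exact: M_ge0).
case: (sh1 _ _ _); rewrite /= ?mul1r ?mul0r ?mulr0 ?mulr1 ?addr0 ?add0r //.
by rewrite expr2; apply: ler_pM; rewrite ?M_ge0 ?M_le.
Qed.

Lemma EZ_Acc2 : theta * u / dR * ((1 - s%:R * delta) * Ms st -
    dR / u * ((1 + delta) / delta ^+ 2) * VV st - theta * dR * J%:R * TT 1 st) <=
  EZ (fun Z => #|sAcc (next u st Z)|%:R) - #|sAcc st|%:R.
Proof.
have /andP[u0 u1] := u01.
apply: le_trans EZ_Acc.
rewrite (eq_bigr (fun g => theta * u / dR * (M st g * (1 - \sum_(x in bd g) (~~ good u st x)%:R -
    s%:R * delta - w u st g)))) => [|g _]; last by rewrite /pe -/dR mulrA.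
rewrite -mulr_sumr; apply: ler_wpM2l.
  by rewrite divr_ge0 ?mulr_ge0 // ltW.
apply: le_trans (_ : (1 - s%:R * delta) * Ms st - \sum_e M st e * (\sum_(x in bd e) (~~ good u st x)%:R) -
   \sum_e M st e * w u st e <= _); first by have := badM; have := Mw; lra.
rewrite /Ms mulr_sumr -!sumrB; apply: ler_sum => e _.
by rewrite le_eqVlt; apply/orP; left; apply/eqP; ring.
Qed.

End OneStep.

(** * The process started from a random reserved set *)

Section Process.
Variables (p : R) (a Rn : nat).
Hypothesis p01 : 0 <= p < 1.
Hypothesis hh_a : forall e, #|hh e| = a.
Hypothesis bdhh : forall e, [disjoint bd e & hh e].
Definition y0 : R := (1 - p) ^+ s * p ^+ a.
Hypothesis y0_gt0 : 0 < y0.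

Definition st0 (H : {set X}) :=
  State H (~: H) [set e | [disjoint bd e & H] && (hh e \subset H)] set0 (fun=> y0) set0.
(** Bounds the mean proportion of uncovered pairs: a pair avoids the reserved set with probability
    [1 - p], and then each step with probability at most [1 - delta]. *)
Definition uu r : R := (1 - p) * (1 - delta) ^+ r.
Definition bb r : R := y0^-1 / vlow ^+ r.
Notation bg := (bb Rn).
Hypothesis bg4 : bg / dR <= 4^-1.

(** The last step is innermost, so a conditional bound for one step is inserted under [Est r] by
    monotonicity. *)
Fixpoint Est (r : nat) (F : state -> R) : R :=
  if r is r'.+1 then Est r' (fun st => Ex (pr (uu r') st) (fun Z => F (next (uu r') st Z)))
  else Ex (fun=> p) (fun H => F (st0 H)).

Lemma y0_le1 : y0 <= 1.
Proof.
have /andP[p0 p1] := p01.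
by apply: mulr_ile1; rewrite ?exprn_ge0 ?exprn_ile1 ?subr_ge0 ?(ltW p1) // lerBlDr lerDl.
Qed.

Lemma uu01 r : 0 < uu r <= 1.
Proof.
have /andP[p0 p1] := p01; have /andP[d0 d1] := delta01.
rewrite /uu mulr_gt0 ?exprn_gt0 ?subr_gt0 //=.
by apply: mulr_ile1; rewrite ?exprn_ge0 ?exprn_ile1 ?subr_ge0 ?(ltW p1) ?(ltW d1) // lerBlDr lerDl // ltW.
Qed.

Lemma bb1 r : 1 <= bb r.
Proof.
have vr : 0 < vlow ^+ r by rewrite exprn_gt0 // vlow_gt0.
have vr1 : vlow ^+ r <= 1 by apply: exprn_ile1; rewrite ?vlow_le1 // ltW // vlow_gt0.
by rewrite /bb -[1]mulr1; apply: ler_pM => //; rewrite invf_ge1 // y0_le1.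
Qed.

Lemma bb_le r : (r <= Rn)%N -> bb r <= bg.
Proof.
move=> rR; rewrite /bb ler_pM2l ?invr_gt0 // lef_pV2 ?posrE ?exprn_gt0 ?vlow_gt0 //.
by apply: ler_wiXn2l; rewrite ?vlow_le1 // ltW // vlow_gt0.
Qed.

Lemma Inv_mono b b' st : b <= b' -> Inv b st -> Inv b' st.
Proof.
move=> bb' I; split; try by case: I.
by move=> e eB; have [h1 h2] := inv_y I eB; split => //; apply: le_trans bb'.
Qed.

Lemma PP_card2 K : PP K -> (1 < #|K|)%N.
Proof.
case/orP => [/conf_card/andP[h _]|/existsP[e /existsP[g /andP[/andP[eg _] /eqP ->]]]].
  exact: ltnW.
by rewrite cards2 eg.
Qed.

Lemma Inv0 H : Inv (bb 0) (st0 H).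
Proof.
split => /=.
- by move=> e _; rewrite y0_gt0 /bb expr0 divr1.
- by move=> e; rewrite inE => /andP[h _]; rewrite -disjoints_subset.
- move=> e K _ /PP_card2 K2 eK; rewrite subset0 -card_gt0.
  by move: K2; rewrite (cardsD1 e) eK.
- by move=> e _; rewrite inE.
- exact: sub0set.
- by move=> e g; rewrite inE.
- by move=> C /conf_card/andP[h _]; rewrite subset0 -card_gt0; apply: leq_trans h.
- by move=> e; rewrite !inE orbF.
Qed.

Lemma bb4 r : (r <= Rn)%N -> bb r / dR <= 4^-1.
Proof.
move=> /bb_le h; apply: le_trans bg4; apply: ler_wpM2r => //.
by rewrite invr_ge0 ltW.
Qed.

Lemma Est_le r F G : (r <= Rn)%N -> (forall st, Inv (bb r) st -> F st <= G st) -> Est r F <= Est r G.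
Proof.
elim: r F G => [|r IH] F G rR FG /=.
  apply: le_Exl => [x|H]; first by have /andP[-> /ltW] := p01.
  by apply: FG; apply: Inv0.
apply: IH => [|st I]; first exact: ltnW.
have b4 := bb4 (ltnW rR).
apply: le_Exl => [t|Z]; first exact: (pr01 (bb1 r) (uu01 r) b4 I).
apply: FG; have := Inv_next (bb1 r) (uu01 r) b4 I Z.
by rewrite /bb exprSr [(vlow ^+ r * vlow)^-1]invfM mulrA.
Qed.

Lemma Est_ext r F G : F =1 G -> Est r F = Est r G.
Proof.
elim: r F G => [|r IH] F G FG /=; first by apply: eq_Exl => H; apply: FG.
by apply: IH => st; apply: eq_Exl => Z; apply: FG.
Qed.

Lemma EstD r F G : Est r (fun st => F st + G st) = Est r F + Est r G.
Proof.
elim: r F G => [|r IH] F G /=; first exact: ExlD.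
by rewrite -IH; apply: Est_ext => st; apply: ExlD.
Qed.

Lemma EstZ r c F : Est r (fun st => c * F st) = c * Est r F.
Proof.
elim: r F => [|r IH] F /=; first exact: ExlZ.
by rewrite -IH; apply: Est_ext => st; apply: ExlZ.
Qed.

Lemma Est_cst r c : Est r (fun=> c) = c.
Proof.
elim: r => [|r IH] /=; first exact: Exl_cst.
by rewrite -[RHS]IH; apply: Est_ext => st; apply: Exl_cst.
Qed.

Lemma Est_sum r I (rr : seq I) (P : pred I) (F : I -> state -> R) :
  Est r (fun st => \sum_(i <- rr | P i) F i st) = \sum_(i <- rr | P i) Est r (F i).
Proof.
elim: rr => [|i rr IH].
  by rewrite big_nil -[RHS](Est_cst r); apply: Est_ext => st; rewrite big_nil.
rewrite big_cons -IH; case: ifP => Pi.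
  by rewrite -EstD; apply: Est_ext => st; rewrite big_cons Pi.
by apply: Est_ext => st; rewrite big_cons Pi.
Qed.

Lemma EstN r F : Est r (fun st => - F st) = - Est r F.
Proof.
rewrite -[RHS]mulN1r -EstZ; apply: Est_ext => st.
by rewrite mulN1r.
Qed.

Lemma Est_le_g r F G : (r <= Rn)%N -> (forall st, Inv bg st -> F st <= G st) -> Est r F <= Est r G.
Proof. by move=> rR FG; apply: Est_le => // st I; apply/FG/(Inv_mono (bb_le rR) I). Qed.

Lemma Est_exists r F c : (r <= Rn)%N -> c < Est r F -> exists st, Inv bg st /\ c < F st.
Proof.
move=> rR h; apply: Classical_Prop.NNPP => n.
suff : Est r F <= c by rewrite leNgt h.
rewrite -[leRHS](Est_cst r); apply: Est_le_g => // st I.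
by rewrite leNgt; apply/negP => h'; apply: n; exists st.
Qed.

Lemma base_prob (L : {set E}) :
  [disjoint \bigcup_(e in L) hh e & \bigcup_(e in L) bd e] ->
  Ex (fun=> p) (fun H => \prod_(e in L) M (st0 H) e) =
    y0^-1 ^+ #|L| * (p ^+ #|\bigcup_(e in L) hh e| * (1 - p) ^+ #|\bigcup_(e in L) bd e|).
Proof.
move=> dj; rewrite -!prodr_const -(Ex_mixed _ dj) prodr_const -ExlZ; apply: eq_Exl => H.
case: (boolP (_ && _)) => [/andP[/bigcupsP h1 h2]|h].
  rewrite mulr1 -prodr_const; apply: eq_bigr => e eL; rewrite /M /= inE h1 // andbT.
  by rewrite (disjointWl _ h2) // (bigcup_sup e).
suff [e eL eH] : exists2 e, e \in L & ~~ ([disjoint bd e & H] && (hh e \subset H)).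
  by rewrite mulr0 (bigD1 e) //= /M /= inE (negbTE eH) mul0r.
apply/exists_inP; rewrite -negb_forall_in; apply: contraNN h => /forall_inP h.
apply/andP; split; first by apply/bigcupsP => e /h/andP[].
rewrite disjoints_subset; apply/bigcupsP => e /h/andP[].
by rewrite disjoints_subset.
Qed.

Lemma base_M e : Est 0 (fun st => M st e) = 1.
Proof.
have -> : Est 0 (fun st => M st e) = Ex (fun=> p) (fun H => \prod_(g in [set e]) M (st0 H) g).
  by apply: eq_Exl => H; rewrite /= big_set1.
rewrite base_prob !big_set1; last by rewrite disjoint_sym bdhh.
by rewrite cards1 expr1 bd_s hh_a [X in _ * X]mulrC mulVf // gt_eqF.
Qed.

Lemma card_bigcup_dis (F : E -> {set X}) k (l : seq E) : uniq l -> (forall e, #|F e| = k) ->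
  (forall e g, e \in l -> g \in l -> e != g -> [disjoint F e & F g]) ->
  #|\bigcup_(e <- l) F e| = (k * size l)%N.
Proof.
move=> + Fk; elim: l => [|e l IH] /=; first by rewrite big_nil cards0 muln0.
move=> /andP[el ul] dj; rewrite big_cons cardsU Fk IH //; last first.
  by move=> x y xl yl; apply: dj; rewrite inE ?xl ?yl orbT.
rewrite (_ : _ :&: _ = set0) ?cards0 ?subn0 ?mulnS //.
apply/eqP; rewrite setI_eq0 disjoint_sym big_seq disjoints_subset.
elim/big_ind: _ => [|A B hA hB|g gl]; first exact: sub0set.
  by rewrite subUset hA.
rewrite -disjoints_subset; apply: dj; rewrite ?inE ?gl ?eqxx ?orbT //.
by apply: contraNneq el => <-.
Qed.

Lemma base_C C : C \in Conf -> Est 0 (fun st => \prod_(g in C) M st g) = 1.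
Proof.
move=> CC.
have cd (F : E -> {set X}) k : (forall e, #|F e| = k) -> (forall e, F e \subset bd e :|: hh e) ->
    #|\bigcup_(e in C) F e| = (k * #|C|)%N.
  move=> Fk Fs; have := @card_bigcup_dis F k (enum C) (enum_uniq _) Fk; rewrite big_enum -cardE => -> //.
  move=> e g; rewrite !mem_enum => eC gC eg.
  exact: disjointWl (Fs e) (disjointWr (Fs g) (conf_dis CC eC gC eg)).
have hs e : hh e \subset bd e :|: hh e by apply: subsetUr.
have bs e : bd e \subset bd e :|: hh e by apply: subsetUl.
rewrite /= base_prob; last first.
  rewrite disjoints_subset; apply/bigcupsP => e eC; rewrite -disjoints_subset disjoint_sym disjoints_subset.
  apply/bigcupsP => g gC; rewrite -disjoints_subset; case: (eqVneq g e) => [->|ge]; first exact: bdhh.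
  exact: disjointWl (bs g) (disjointWr (hs e) (conf_dis CC gC eC ge)).
by rewrite (cd _ _ hh_a hs) (cd _ _ bd_s bs) !exprM -exprMn -exprMn [p ^+ a * _]mulrC mulVf ?expr1n // gt_eqF.
Qed.

(** The union has [2 * s - 1] covered pairs, one less than two separate copies. The factor gained is
    the inverse of [uu 0], the normalization used in [Est_W]. *)
Lemma base_sh e e' x : sh1 e e' x -> Est 0 (fun st => M st e * M st e') = (1 - p)^-1.
Proof.
have /andP[p0 p1] := p01; have q0 : 1 - p != 0 by rewrite subr_eq0 gt_eqF.
move=> sh; have [ee' bdx] := sh1P sh; case/and4P: sh => _ xe xe' /eqP h.
have key y : (y \in bd e :|: hh e) && (y \in bd e' :|: hh e') -> y = x.
  by rewrite -in_setI h => /set1P.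
have nh : x \notin hh e by apply/negP => xh; have := bdhh e; rewrite -setI_eq0 => /eqP/setP/(_ x); rewrite !inE xe xh.
have nh' : x \notin hh e' by apply/negP => xh; have := bdhh e'; rewrite -setI_eq0 => /eqP/setP/(_ x); rewrite !inE xe' xh.
have d0 (A B : {set X}) : (forall y, y \in A -> y \in B -> False) -> [disjoint A & B].
  by move=> AB; rewrite -setI_eq0; apply/eqP/setP => y; rewrite !inE; apply/negP => /andP[/AB].
have hd : [disjoint hh e & bd e'].
  apply: d0 => y yh yb; move: nh; rewrite -(key y) ?yh //.
  by rewrite !inE yh yb orbT.
have hd' : [disjoint hh e' & bd e].
  apply: d0 => y yh yb; move: nh'; rewrite -(key y) ?yh //.
  by rewrite !inE yh yb orbT.
have hh' : [disjoint hh e & hh e'].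
  apply: d0 => y yh yb; move: nh; rewrite -(key y) ?yh //.
  by rewrite !inE yh yb !orbT.
have -> : Est 0 (fun st => M st e * M st e') = Ex (fun=> p) (fun H => \prod_(g in [set e; e']) M (st0 H) g).
  by apply: eq_Exl => H; rewrite /= big_setU1 ?big_set1 ?inE.
rewrite base_prob; last first.
  rewrite !big_setU1 ?big_set1 ?inE //=; apply: d0 => y; rewrite !inE.
  case/orP => h1 /orP[h2|h2].
  - by rewrite (disjointFr (bdhh e) h2) in h1.
  - by rewrite (disjointFr hd h1) in h2.
  - by rewrite (disjointFr hd' h1) in h2.
  - by rewrite (disjointFr (bdhh e') h2) in h1.
rewrite !big_setU1 ?big_set1 ?inE //= cards2 ee' !cardsU bdx cards1 !bd_s !hh_a.
move: hh'; rewrite -setI_eq0 => /eqP ->; rewrite cards0 subn0 expr2 !exprD.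
have -> : (s + s - 1 = s + s.-1)%N by move: s_gt0; case: (s) => // n _; rewrite addnS subn1.
rewrite exprD; have -> : (1 - p) ^+ s.-1 = (1 - p) ^+ s / (1 - p).
  by move: s_gt0; case: (s) => // n _; rewrite exprSr mulfK.
have -> : y0^-1 * y0^-1 * (p ^+ a * p ^+ a * ((1 - p) ^+ s * ((1 - p) ^+ s / (1 - p)))) =
  (y0^-1 * y0) * (y0^-1 * y0) / (1 - p) by rewrite {4 6}/y0; ring.
by rewrite mulVf ?gt_eqF // !mul1r.
Qed.

Hypothesis deg : forall x, #|[set e | x \in bd e]| = d.
Variables (eta Lam : R).
Notation N := (#|X|%:R : R).
Notation b' := (bg / vlow).
Hypothesis Lam0 : 0 <= Lam.
Hypothesis d_eta : dR^-1 <= eta.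
Hypothesis Hbad : \sum_(D : {set E} | bad D && (#|D| <= 3 * J)%N) dR ^- #|D| <= eta * N.
Hypothesis HConf : \sum_(C in Conf) dR ^- #|C| <= Lam * N.

Let eta0 : 0 < eta. Proof. by apply: lt_le_trans d_eta; rewrite invr_gt0. Qed.
Let bg1 : 1 <= bg := bb1 Rn.
Let b'0 : 0 <= b'. Proof. by apply: divr_ge0; [exact: le_trans ler01 bg1 | exact/ltW/vlow_gt0]. Qed.

Lemma EstS r F : Est r.+1 F = Est r (fun st => Ex (pr (uu r) st) (fun Z => F (next (uu r) st Z))).
Proof. by []. Qed.

Definition ff : R := (2 ^+ Rn * bg) ^+ (3 * J) * (eta + bg * eta * Lam).

Lemma ff0 : 0 <= ff.
Proof.
have b0 : 0 <= bg := le_trans ler01 bg1.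
apply: mulr_ge0; first by rewrite exprn_ge0 // mulr_ge0 // exprn_ge0.
by apply: addr_ge0; [exact: ltW | do !apply: mulr_ge0 => //; exact: ltW].
Qed.

(** Nothing is sampled at the start, and each step costs a factor 2 per copy; this is harmless as
    the number of steps and the size of [D] are bounded. *)
Lemma Est_aS r (D : {set E}) : (r <= Rn)%N ->
  Est r (fun st => \prod_(g in D) aS bg st g) <= (2 ^+ r * bg) ^+ #|D| * dR ^- #|D|.
Proof.
elim: r => [|r IH] rR.
  rewrite -[leRHS](Exl_cst (fun=> p) (enum X) _ set0) /= expr0 mul1r.
  apply: le_Exl => [x|H]; first by have /andP[-> /ltW] := p01.
  rewrite -exprVn -exprMn -prodr_const; apply: ler_prod => g _.
  rewrite /aS /= inE /= add0r lexx andbT; apply: divr_ge0; [exact: le_trans ler01 bg1 | exact: ltW].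
have rR' := ltnW rR.
apply: le_trans (_ : Est r (fun st => 2 ^+ #|D| * \prod_(g in D) aS bg st g) <= _).
  rewrite EstS; apply: Est_le_g => // st I; by apply: (@EZ_S bg) => //; apply: uu01.
rewrite EstZ; apply: le_trans (ler_wpM2l _ (IH rR')) _; first exact: exprn_ge0.
by rewrite mulrA -exprMn exprS mulrA.
Qed.

Lemma Est_Phi r : (r <= Rn)%N -> Est r (Phi bg) <= ff * N.
Proof.
move=> rR; have b0 : 0 <= bg := le_trans ler01 bg1.
have B1 : 1 <= 2 ^+ Rn * bg by rewrite -[leLHS]mul1r; apply: ler_pM => //; apply: exprn_ege1; rewrite ler1n.
have key (D : {set E}) : (#|D| <= 3 * J)%N ->
    Est r (fun st => \prod_(g in D) aS bg st g) <= (2 ^+ Rn * bg) ^+ (3 * J) * dR ^- #|D|.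
  move=> DJ; apply: le_trans (Est_aS D rR) _; apply: ler_wpM2r.
    by rewrite invr_ge0 exprn_ge0 // ltW.
  apply: le_trans (_ : (2 ^+ Rn * bg) ^+ #|D| <= _); last by rewrite ler_weXn2l.
  have nn k : 0 <= 2 ^+ k * bg by apply: mulr_ge0 => //; exact: exprn_ge0.
  apply: lerXn2r; [by rewrite nnegrE | by rewrite nnegrE |].
  by apply: ler_wpM2r => //; rewrite ler_weXn2l // ler1n.
have B0 : 0 <= (2 ^+ Rn * bg) ^+ (3 * J) by rewrite exprn_ge0 // (le_trans ler01).
rewrite EstD EstZ !Est_sum /ff.
have -> : (2 ^+ Rn * bg) ^+ (3 * J) * (eta + bg * eta * Lam) * N =
  (2 ^+ Rn * bg) ^+ (3 * J) * (eta * N) + bg * eta * ((2 ^+ Rn * bg) ^+ (3 * J) * (Lam * N)) by ring.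
apply: lerD.
  apply: le_trans (ler_wpM2l B0 Hbad); rewrite mulr_sumr; apply: ler_sum => D /andP[_]; exact: key.
apply: ler_pM.
- by apply: divr_ge0 => //; exact: ltW.
- apply: sumr_ge0 => C _; rewrite -(Est_cst r 0); apply: Est_le_g => // st I.
  by apply: prodr_ge0 => g _; apply: aS_ge0.
- exact: ler_wpM2l.
apply: le_trans (ler_wpM2l B0 HConf); rewrite mulr_sumr; apply: ler_sum => C /conf_card/andP[_ CJ].
by apply: key; apply: leq_trans CJ _; rewrite leq_pmull.
Qed.

Lemma sum_deg2 : \sum_x \sum_(e | x \in bd e) \sum_(e' | x \in bd e') (1 : R) = N * dR ^+ 2.
Proof.
have h x : \sum_(e | x \in bd e) (1 : R) = dR.
  by rewrite /dR -(deg x) -sum1_card natr_sum; apply: eq_bigl => e; rewrite inE.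
rewrite (eq_bigr (fun=> dR ^+ 2)) => [|x _]; first by rewrite sumr_const mulr_natl.
rewrite (eq_bigr (fun=> dR * 1)) => [|e _]; last by rewrite h mulr1.
by rewrite -mulr_sumr h expr2.
Qed.

Definition cW : R := b' ^+ 2 * (J%:R * (2 ^+ J * (cnt (3 * J))%:R)).

(** The division by [1 - delta] in each step is cancelled by the decrease of [uu], so the normalized
    second moment grows only through the errors. *)
Lemma Est_W r : (r <= Rn)%N -> uu r * Est r W <= N * dR ^+ 2 * (1 + r%:R * (cW * ff)).
Proof.
have /andP[p0 p1] := p01; have q0 : 0 < 1 - p by rewrite subr_gt0.
have /andP[d0 d1] := delta01; have dl0 : 0 < 1 - delta by rewrite subr_gt0.
elim: r => [|r IH] rR.
  rewrite mul0r addr0 mulr1 /uu expr0 mulr1 -sum_deg2 /W !Est_sum.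
  apply: le_trans (_ : \sum_e \sum_e' \sum_(x | sh1 e e' x) 1 <= _).
    rewrite mulr_sumr; apply: ler_sum => e _; rewrite Est_sum mulr_sumr; apply: ler_sum => e' _.
    rewrite Est_sum mulr_sumr; apply: ler_sum => x sh.
    by rewrite (base_sh sh) divff // gt_eqF.
  rewrite [leRHS](eq_bigr (fun x => \sum_e \sum_e' ((x \in bd e) && (x \in bd e'))%:R)); last first.
    move=> x _; rewrite big_mkcond; apply: eq_bigr => e _; case: (x \in bd e) => /=; last by rewrite big1.
    by rewrite big_mkcond; apply: eq_bigr => e' _; case: (x \in bd e').
  rewrite [leRHS]exchange_big; apply: ler_sum => e _; rewrite [leRHS]exchange_big; apply: ler_sum => e' _ /=.
  rewrite big_mkcond; apply: ler_sum => x _; case: ifP => // /and4P[_ xe xe' _].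
  by rewrite xe xe'.
have rR' := ltnW rR; have b4 := bb4 (leqnn Rn).
have st1 : Est r.+1 W <= Est r (fun st => (1 - delta)^-1 * W st +
     b' ^+ 2 * (J%:R * (dR ^+ 2 * (2 ^+ J * (cnt (3 * J))%:R))) * Phi bg st).
  rewrite EstS; apply: Est_le_g => // st I; apply: le_trans (EZ_W bg1 (uu01 r) b4 I) _.
  by rewrite le_eqVlt; apply/orP; left; apply/eqP; ring.
have u0 : 0 <= uu r.+1 by have /andP[/ltW] := uu01 r.+1.
apply: le_trans (ler_wpM2l u0 st1) _; rewrite EstD !EstZ mulrDr.
have -> : uu r.+1 * ((1 - delta)^-1 * Est r W) = uu r * Est r W.
  by rewrite /uu exprSr; field; rewrite gt_eqF.
rewrite -[r.+1%:R]natr1 mulrDl mul1r addrA mulrDr; apply: lerD; first exact: IH.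
have cc : 0 <= b' ^+ 2 * (J%:R * (dR ^+ 2 * (2 ^+ J * (cnt (3 * J))%:R))).
  by do !apply: mulr_ge0 => //; apply: exprn_ge0 => //; rewrite ltW.
have u1 : uu r.+1 <= 1 by have /andP[] := uu01 r.+1.
apply: le_trans (_ : b' ^+ 2 * (J%:R * (dR ^+ 2 * (2 ^+ J * (cnt (3 * J))%:R))) * (ff * N) <= _).
  rewrite -[leRHS]mul1r; apply: ler_pM => //.
    apply: mulr_ge0 => //; rewrite -(Est_cst r 0); apply: Est_le_g => // st I.
    apply: addr_ge0; first by apply: sumr_ge0 => D _; apply: prodr_ge0 => g _; apply: aS_ge0.
    apply: mulr_ge0; first by apply: divr_ge0; [exact: le_trans ler01 bg1 | exact: ltW].
    by apply: sumr_ge0 => D _; apply: prodr_ge0 => g _; apply: aS_ge0.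
  by apply: ler_wpM2l => //; exact: Est_Phi.
by rewrite /cW le_eqVlt; apply/orP; left; apply/eqP; ring.
Qed.

Definition cT : R := (4 * b') ^+ J * (J%:R * (2 ^+ J * (cnt (3 * J) + J ^ 2)%:R)).
Definition tt : R := 2 ^+ J * Lam + Rn%:R * (cT * ff).

Let cT0 : 0 <= cT.
Proof.
apply: mulr_ge0; first by rewrite exprn_ge0 // mulr_ge0.
by do !apply: mulr_ge0 => //; apply: exprn_ge0.
Qed.

(** Going back from step [r] to the start, the parameter grows by [theta * uu i] each time. Keeping
    the total at most 2 allows the final evaluation to cost at most [2 ^+ J]. *)
Lemma Est_TT_r r lam : (r <= Rn)%N -> 0 <= lam -> lam + \sum_(i < r) theta * uu i <= 2 ->
  Est r (TT lam) <= (2 ^+ J * Lam + r%:R * (cT * ff)) * N.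
Proof.
elim: r lam => [|r IH] lam rR l0 l2.
  rewrite mul0r addr0 -mulrA; move: l2; rewrite big_ord0 addr0 => l2.
  apply: le_trans (ler_wpM2l _ HConf); last exact: exprn_ge0.
  rewrite mulr_sumr Est_sum; apply: ler_sum => C CC; rewrite EstZ mulrC.
  have dm0 : 0 <= dR ^- #|C| by rewrite invr_ge0 exprn_ge0 // ltW.
  apply: ler_wpM2r => //.
  have -> : Est 0 (fun st => \prod_(g in C) (lam * M st g + dR * (g \in sS st)%:R)) =
     lam ^+ #|C| * Est 0 (fun st => \prod_(g in C) M st g).
    rewrite -EstZ; apply: eq_Exl => H; rewrite -prodr_const -big_split /=; apply: eq_bigr => g _.
    by rewrite inE mulr0 addr0.
  rewrite base_C // mulr1; apply: le_trans (_ : 2 ^+ #|C| <= _); first by apply: lerXn2r; rewrite ?nnegrE.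
  by rewrite ler_weXn2l ?ler1n //; have /andP[] := conf_card CC.
have rR' := ltnW rR; have b4 := bb4 (leqnn Rn).
have tu i : 0 <= theta * uu i by rewrite mulr_ge0 ?ltW //; have /andP[] := uu01 i.
have lam2 : lam <= 2.
  by apply: le_trans l2; rewrite lerDl; apply: sumr_ge0 => i _; apply: tu.
apply: le_trans (_ : Est r (fun st => TT (lam + theta * uu r) st + cT * Phi bg st) <= _).
  rewrite EstS; apply: Est_le_g => // st I; apply: le_trans (EZ_TT bg1 (uu01 r) b4 I _) _; first by rewrite l0.
  by rewrite lerD2l /cT le_eqVlt; apply/orP; left; apply/eqP; ring.
rewrite EstD EstZ -[r.+1%:R]natr1.
rewrite [leRHS](_ : _ = (2 ^+ J * Lam + r%:R * (cT * ff)) * N + cT * ff * N); last by ring.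
apply: lerD.
  apply: IH => //; first exact: addr_ge0.
  by move: l2; rewrite big_ord_recr /= addrA addrAC.
by rewrite -mulrA; apply: ler_wpM2l => //; exact: Est_Phi.
Qed.

Lemma sum_uu r : delta * \sum_(i < r) uu i = (1 - p) * (1 - (1 - delta) ^+ r).
Proof.
elim: r => [|r IH]; first by rewrite big_ord0 expr0 subrr !mulr0.
by rewrite big_ord_recr /= mulrDr IH /uu exprS; ring.
Qed.

Lemma Est_TT r : (r <= Rn)%N -> Est r (TT 1) <= tt * N.
Proof.
move=> rR; apply: le_trans (Est_TT_r rR ler01 _) _.
  have /andP[p0 p1] := p01; have /andP[d0 d1] := delta01.
  rewrite -mulr_sumr -[2]/(1 + 1) lerD2l.
  apply: le_trans (_ : delta * \sum_(i < r) uu i <= _).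
    apply: ler_wpM2r; first by apply: sumr_ge0 => i _; have /andP[/ltW] := uu01 i.
    by have := mulr_ge0 (ltW theta0) (ltW d0); move: thetaE; rewrite mulrDr mulr1; lra.
  rewrite sum_uu; have e0 : 0 <= (1 - delta) ^+ r by rewrite exprn_ge0 // subr_ge0 ltW.
  have e1 : (1 - delta) ^+ r <= 1 by apply: exprn_ile1; lra.
  by apply: mulr_ile1; lra.
apply: ler_wpM2r => //; rewrite lerD2l; apply: ler_wpM2r; last by rewrite ler_nat.
by rewrite mulr_ge0 // ff0.
Qed.

Lemma Est_A r : (r <= Rn)%N -> Est r (fun st => #|sA st|%:R) <= uu r * N.
Proof.
have /andP[d0 d1] := delta01; have dl0 : 0 <= 1 - delta by rewrite subr_ge0 ltW.
elim: r => [|r IH] rR.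
  have -> : uu 0 * N = \sum_(x : X) (1 - p) by rewrite /uu expr0 mulr1 sumr_const mulr_natr.
  apply: le_trans (_ : \sum_(x : X) Ex (fun=> p) (fun H : {set X} => ([disjoint [set x] & H])%:R) <= _).
    rewrite /Ex -Exl_sum; apply: le_Exl => [x|H]; first by have /andP[-> /ltW] := p01.
    rewrite -sum1_card natr_sum big_mkcond /=; apply: ler_sum => x _.
    by rewrite disjoints1 inE; case: (x \in H).
  by apply: ler_sum => x _; rewrite Ex_disjoint big_set1.
have rR' := ltnW rR; have b4 := bb4 (leqnn Rn).
apply: le_trans (_ : Est r (fun st => (1 - delta) * #|sA st|%:R) <= _).
  by rewrite EstS; apply: Est_le_g => // st I; exact: (EZ_A_le bg1 (uu01 r) b4 I).
rewrite EstZ /uu exprS mulrCA -mulrA; apply: ler_wpM2l => //.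
exact: IH.
Qed.

Hypothesis X0 : (0 < #|X|)%N.
Hypothesis kap0 : (0 < kap)%N.
Let N0 : 0 < N. Proof. by rewrite ltr0n. Qed.
Let s0 : 0 < s%:R :> R. Proof. by rewrite ltr0n. Qed.

Definition mu r : R := s%:R / (dR * N) * Est r Ms.
Definition cc : R := (1 + delta) / delta ^+ 2.
Definition gg : R := Rn%:R * (cW * ff) + bg ^+ 2 * ((1 + 4 * s%:R) * eta).
Definition AA : R := 2 * s%:R * cc.
(** [tau] bounds the relative loss of weight in a step, apart from the feedback [AA] of earlier
    losses through the variance; [rho] bounds the loss accumulated over all steps; [beta] bounds
    from below the useful proportion of the samples. *)
Definition tau : R := bg * eta + s%:R * (theta * J%:R * tt / kap%:R) + s%:R * cc * gg.
Definition rho : R := tau * Rn%:R * (1 + AA) ^+ Rn.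
Definition beta : R := 1 - s%:R * delta - (1 + AA) * rho - tau - s%:R * (theta * J%:R * tt).

Lemma double_count : s%:R * #|E|%:R = dR * N.
Proof.
have h x : \sum_(e | x \in bd e) (1 : R) = dR.
  by rewrite /dR -(deg x) -sum1_card natr_sum; apply: eq_bigl => e; rewrite inE.
have <- : \sum_x \sum_(e | x \in bd e) (1 : R) = dR * N.
  by rewrite (eq_bigr (fun=> dR)) => [|x _]; [rewrite sumr_const mulr_natr | exact: h].
rewrite (exchange_big_dep predT) //= (eq_bigr (fun=> s%:R)) => [|e _]; last by rewrite sumr_const bd_s.
by rewrite sumr_const mulr_natr.
Qed.

Lemma mu_0 : mu 0 = 1.
Proof.
rewrite /mu /Ms Est_sum (eq_bigr (fun=> 1)) => [|e _]; last exact: base_M.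
have -> : \sum_(e : E) (1 : R) = #|E|%:R by rewrite sumr_const.
by rewrite mulrAC double_count divff // mulf_neq0 ?gt_eqF.
Qed.

Lemma mu_le1 r : (r <= Rn)%N -> mu r <= 1.
Proof.
elim: r => [|r IH] rR; first by rewrite mu_0.
have rR' := ltnW rR; have b4 := bb4 (leqnn Rn).
apply: le_trans (IH rR'); apply: ler_wpM2l; first by rewrite divr_ge0 // ltW // mulr_gt0.
by rewrite EstS; apply: Est_le_g => // st I; exact: (EZ_Ms_le bg1 (uu01 r) b4 I).
Qed.

(** Equal copies contribute [N * d], at most [eta * N * d ^ 2]. By [A4] all others are bad sets of
    two copies; each of these accounts for at most 4 ordered pairs, and for [s] choices of the
    common pair. *)
Lemma NB_le : NB <= (1 + 4 * s%:R) * eta * N * dR ^+ 2.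
Proof.
have dd : dR ^+ 2 * dR ^- 2 = 1 by rewrite divff // expf_neq0 // gt_eqF.
have d0 : 0 <= dR ^+ 2 by rewrite exprn_ge0 // ltW.
have h x : \sum_(e | x \in bd e) (1 : R) = dR.
  by rewrite /dR -(deg x) -sum1_card natr_sum; apply: eq_bigl => e; rewrite inE.
pose B2 e e' := (e != e') && bad [set e; e'].
apply: le_trans (_ : \sum_x \sum_(e | x \in bd e) 1 + \sum_x \sum_e \sum_e' ((x \in bd e) && B2 e e')%:R <= _).
  rewrite -big_split /=; apply: ler_sum => x _; rewrite [X in _ <= X + _]big_mkcond -big_split /=.
  apply: ler_sum => e _; case xe: (x \in bd e); last first.
    rewrite [leLHS]big1 => [|e' _]; last by [].
    by apply: addr_ge0 => //; apply: sumr_ge0.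
  rewrite [X in _ <= X + _](_ : _ = \sum_e' (if e' == e then 1 else 0)); last first.
    by rewrite -big_mkcond big_pred1_eq.
  rewrite -big_split /=; apply: ler_sum => e' _.
  case xe': (x \in bd e') => /=; last by apply: addr_ge0 => //; case: (e' == e).
  case: (eqVneq e' e) => [->|e'e]; first by apply: le_trans (_ : 1 <= _); [case: (sh1 _ _ _) | rewrite lerDl].
  rewrite add0r ler_nat; case: (boolP (sh1 e e' x)) => //= nsh.
  rewrite lt0b /B2 eq_sym e'e /=.
  have ee' : e != e' by rewrite eq_sym.
  case: (A4 ee' xe xe') => // h4; case/negP: nsh; apply/and4P; split => //.
  exact/eqP.
have -> : (1 + 4 * s%:R) * eta * N * dR ^+ 2 = eta * N * dR ^+ 2 + s%:R * (4 * (dR ^+ 2 * (eta * N))) by ring.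
apply: lerD.
  rewrite (eq_bigr (fun=> dR)) => [|x _]; last exact: h.
  rewrite sumr_const -[leLHS]mulr_natr mulrAC expr2.
  have : dR * 1 <= dR * (eta * dR).
    by apply: ler_wpM2l; [exact: ltW | rewrite -ler_pdivrMr // mul1r].
  by move=> h1; have := ler_wpM2r (ltW N0) h1; rewrite mulr1 => /le_trans; apply; rewrite le_eqVlt; apply/orP; left; apply/eqP; ring.
apply: le_trans (_ : \sum_e \sum_e' s%:R * (B2 e e')%:R <= _).
  rewrite [leLHS]exchange_big; apply: ler_sum => e _; rewrite [leLHS]exchange_big; apply: ler_sum => e' _ /=.
  rewrite -(bd_s e) -sum1_card natr_sum mulr_suml [leRHS]big_mkcond /=; apply: ler_sum => x _.
  by case: (x \in bd e); rewrite /= ?mul1r.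
rewrite (eq_bigr (fun e => s%:R * \sum_e' (B2 e e')%:R)) => [|e _]; last by rewrite mulr_sumr.
rewrite -mulr_sumr; apply: ler_wpM2l; first exact: ltW.
pose Q (D : {set E}) := [&& bad D, #|D| <= 3 * J & #|D| == 2]%N.
apply: le_trans (_ : \sum_e \sum_e' \sum_(D | Q D) ((e \in D) && (e' \in D))%:R <= _).
  apply: ler_sum => e _; apply: ler_sum => e' _; case: (boolP (B2 e e')) => [/andP[ee' b2]|_]; last exact: sumr_ge0.
  have q : Q [set e; e'].
    by rewrite /Q b2 cards2 ee' eqxx andbT /=; apply: leq_trans J2 _; rewrite leq_pmull.
  by rewrite (bigD1 [set e; e']) //= !inE !eqxx orbT lerDl sumr_ge0.
have -> : \sum_e \sum_e' \sum_(D | Q D) ((e \in D) && (e' \in D))%:R = \sum_(D | Q D) (4 : R).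
  rewrite (eq_bigr (fun e => \sum_(D | Q D) \sum_e' ((e \in D) && (e' \in D))%:R)) => [|e _]; last exact: exchange_big.
  rewrite exchange_big /=; apply: eq_bigr => D /and3P[_ _ /eqP D2].
  have sD : \sum_(e' : E) ((e' \in D)%:R : R) = 2.
    have <- : #|D|%:R = 2 :> R by rewrite D2.
    rewrite -sum1_card natr_sum [RHS]big_mkcond /=; apply: eq_bigr => e _.
    by case: (e \in D).
  rewrite (eq_bigr (fun e => (e \in D)%:R * 2)) => [|e _]; last first.
    by rewrite -sD mulr_sumr; apply: eq_bigr => e' _; rewrite -natrM mulnb.
  by rewrite -mulr_suml sD; ring.
rewrite (eq_bigr (fun D : {set E} => 4 * (dR ^+ 2 * dR ^- #|D|))) => [|D /and3P[_ _ /eqP ->]]; last first.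
  by rewrite dd mulr1.
rewrite -mulr_sumr; apply: ler_wpM2l => //; rewrite -mulr_sumr; apply: ler_wpM2l => //.
apply: le_trans Hbad; apply: sum_sub_le => [D /and3P[-> -> _] //|D].
by rewrite invr_ge0 exprn_ge0 // ltW.
Qed.

(** In the expanded square the second moment and the number of uncovered pairs contribute about 1
    each, and the cross term is [- 2 * mu r]. The degrees are therefore concentrated as long as the
    weight is preserved. *)
Lemma Est_VV r : (r <= Rn)%N -> Est r (VV (uu r)) <= uu r * N * (2 * (1 - mu r) + gg).
Proof.
move=> rR; have /andP[u0 u1] := uu01 r; set u := uu r in u0 u1 *.
have c0 : 0 <= u ^+ 2 / dR ^+ 2 by rewrite divr_ge0 ?exprn_ge0 // ltW.
apply: le_trans (_ : Est r (fun st => u ^+ 2 / dR ^+ 2 * W st + (u ^+ 2 / dR ^+ 2 * (bg ^+ 2 * NB) +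
    (- (2 * (u / dR * s%:R)) * Ms st + #|sA st|%:R))) <= _).
  apply: Est_le_g => // st I.
  have h : VV u st <= u ^+ 2 / dR ^+ 2 * (W st + bg ^+ 2 * NB) - 2 * (u / dR * (s%:R * Ms st)) + #|sA st|%:R.
    by apply: VV_le => //; apply: uu01.
  by apply: le_trans h _; rewrite le_eqVlt; apply/orP; left; apply/eqP; ring.
set F := (fun st : state => _).
have -> : Est r F = u ^+ 2 / dR ^+ 2 * Est r W + (u ^+ 2 / dR ^+ 2 * (bg ^+ 2 * NB) +
    (- (2 * (u / dR * s%:R)) * Est r Ms + Est r (fun st => #|sA st|%:R))).
  by rewrite /F !EstD Est_cst !EstZ.
have h1 : u ^+ 2 / dR ^+ 2 * Est r W <= u * N * (1 + Rn%:R * (cW * ff)).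
  have -> : u ^+ 2 / dR ^+ 2 * Est r W = u / dR ^+ 2 * (u * Est r W) by ring.
  apply: le_trans (ler_wpM2l _ (Est_W rR)) _; first by rewrite divr_ge0 ?exprn_ge0 // ltW.
  have -> : u / dR ^+ 2 * (N * dR ^+ 2 * (1 + r%:R * (cW * ff))) = u * N * (1 + r%:R * (cW * ff)).
    by field; rewrite gt_eqF.
  apply: ler_wpM2l; first by rewrite mulr_ge0 // ltW.
  rewrite lerD2l; apply: ler_wpM2r; last by rewrite ler_nat.
  rewrite mulr_ge0 ?ff0 // /cW; do !apply: mulr_ge0 => //; exact: exprn_ge0.
have h2 : u ^+ 2 / dR ^+ 2 * (bg ^+ 2 * NB) <= u * N * (bg ^+ 2 * ((1 + 4 * s%:R) * eta)).
  have b20 : 0 <= bg ^+ 2 by rewrite exprn_ge0 // (le_trans ler01).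
  apply: le_trans (ler_wpM2l c0 (ler_wpM2l b20 NB_le)) _.
  have -> : u ^+ 2 / dR ^+ 2 * (bg ^+ 2 * ((1 + 4 * s%:R) * eta * N * dR ^+ 2)) =
     u * (u * N * (bg ^+ 2 * ((1 + 4 * s%:R) * eta))) by field; rewrite gt_eqF.
  apply: ler_piMl => //; apply: mulr_ge0; first by apply: mulr_ge0; apply: ltW.
  by apply: mulr_ge0 => //; apply: mulr_ge0; [rewrite addr_ge0 // mulr_ge0 // ltW | exact: ltW].
have h3 := Est_A rR; rewrite -/u in h3.
have -> : - (2 * (u / dR * s%:R)) * Est r Ms = - (2 * (u * N * mu r)).
  by rewrite /mu; field; rewrite !gt_eqF.
rewrite /gg; lra.
Qed.

Let J0 : 0 < J%:R :> R. Proof. by rewrite ltr0n (leq_trans _ J2). Qed.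
Let tt0 : 0 <= tt.
Proof.
apply: addr_ge0; first by apply: mulr_ge0 => //; exact: exprn_ge0.
by apply: mulr_ge0 => //; apply: mulr_ge0; [exact: cT0 | exact: ff0].
Qed.
Let cc0 : 0 <= cc.
Proof.
have /andP[d0 d1] := delta01.
apply: divr_ge0; first by rewrite addr_ge0 // ltW.
by rewrite exprn_ge0 // ltW.
Qed.
Let gg0 : 0 <= gg.
Proof.
have b0 : 0 <= bg ^+ 2 by rewrite exprn_ge0 // (le_trans ler01).
apply: addr_ge0.
  apply: mulr_ge0 => //; apply: mulr_ge0; last exact: ff0.
  by rewrite /cW; do !apply: mulr_ge0 => //; exact: exprn_ge0.
by do !apply: mulr_ge0 => //; [rewrite addr_ge0 ?mulr_ge0 // ltW | exact: ltW].
Qed.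
Let scg : 0 <= s%:R * cc * gg.
Proof. by do !apply: mulr_ge0 => //; exact: ltW. Qed.
Let AA0 : 0 <= AA.
Proof. by do !apply: mulr_ge0 => //; exact: ltW. Qed.
Let tau_scg : s%:R * cc * gg <= tau.
Proof.
rewrite /tau lerDr; apply: addr_ge0.
  by apply: mulr_ge0; [exact: le_trans ler01 bg1 | exact: ltW].
by apply: mulr_ge0 => //; apply: divr_ge0 => //; do !apply: mulr_ge0 => //; exact: ltW.
Qed.

Lemma Est_VV_mu r : (r <= Rn)%N -> s%:R / (dR * N) * (dR / uu r * cc * Est r (VV (uu r))) <=
  AA * (1 - mu r) + s%:R * cc * gg.
Proof.
move=> rR; have /andP[u0 u1] := uu01 r.
have -> : AA * (1 - mu r) + s%:R * cc * gg = s%:R / (dR * N) * (dR / uu r * cc * (uu r * N * (2 * (1 - mu r) + gg))).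
  by rewrite /AA; field; rewrite !gt_eqF.
apply: ler_wpM2l; first by rewrite divr_ge0 // ltW // mulr_gt0.
apply: ler_wpM2l; last exact: Est_VV.
by rewrite mulr_ge0 // divr_ge0 // ltW.
Qed.

(** The losses feed back: the weight lost is bounded through the variance, and the variance through
    the weight lost so far. *)
Lemma mu_step r : (r < Rn)%N -> 1 - mu r.+1 <= (1 + AA) * (1 - mu r) + tau.
Proof.
move=> rR; have rR' := ltnW rR; have b4 := bb4 (leqnn Rn); have /andP[u0 u1] := uu01 r.
have kR : 0 < kap%:R :> R by rewrite ltr0n.
have h : Est r (fun st => Ms st + (- (bg / dR) * Ms st + (- (kap%:R^-1 * (theta * dR * J%:R)) * TT 1 st +
    (- (dR / uu r * cc)) * VV (uu r) st))) <= Est r.+1 Ms.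
  rewrite EstS; apply: Est_le_g => // st I; apply: le_trans (EZ_Ms bg1 (uu01 r) b4 I kap0).
  by rewrite /cc le_eqVlt; apply/orP; left; apply/eqP; ring.
have {}h : Est r Ms + (- (bg / dR) * Est r Ms + (- (kap%:R^-1 * (theta * dR * J%:R)) * Est r (TT 1) +
    (- (dR / uu r * cc)) * Est r (VV (uu r)))) <= Est r.+1 Ms.
  by apply: le_trans h; rewrite !EstD !EstZ.
have c0 : 0 <= s%:R / (dR * N) by rewrite divr_ge0 // ltW // mulr_gt0.
have := ler_wpM2l c0 h; rewrite -/(mu _) !mulrDr -/(mu _).
have -> : s%:R / (dR * N) * (- (bg / dR) * Est r Ms) = - (bg / dR * mu r) by rewrite /mu; ring.
have hT : s%:R / (dR * N) * (kap%:R^-1 * (theta * dR * J%:R) * Est r (TT 1)) <= s%:R * (theta * J%:R * tt / kap%:R).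
  have -> : s%:R * (theta * J%:R * tt / kap%:R) = s%:R / (dR * N) * (kap%:R^-1 * (theta * dR * J%:R) * (tt * N)).
    by field; rewrite !gt_eqF.
  apply: ler_wpM2l => //; apply: ler_wpM2l; last exact: Est_TT.
  by apply: mulr_ge0; [rewrite invr_ge0 | do !apply: mulr_ge0 => //; exact: ltW].
have hV := Est_VV_mu rR'.
have hb : bg / dR * mu r <= bg * eta.
  have b0 : 0 <= bg := le_trans ler01 bg1.
  apply: le_trans (_ : bg / dR * 1 <= _).
    by apply: ler_wpM2l (mu_le1 rR'); rewrite divr_ge0 // ltW.
  by rewrite mulr1; apply: ler_wpM2l.
by rewrite /tau !mulNr !mulrN; move: hT hV hb; lra.
Qed.

(** A discrete Gronwall argument, the number of steps being fixed. *)
Lemma mu_rho r : (r <= Rn)%N -> 1 - mu r <= rho.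
Proof.
have t0 : 0 <= tau := le_trans scg tau_scg.
have A1' : 1 <= 1 + AA by rewrite lerDl.
move=> rR; suff h : 1 - mu r <= tau * r%:R * (1 + AA) ^+ r.
  apply: le_trans h _; rewrite /rho -!mulrA; apply: ler_wpM2l => //.
  by apply: ler_pM; rewrite ?ler_nat ?exprn_ge0 ?ler_weXn2l // (le_trans ler01).
elim: r rR => [|r IH] rR; first by rewrite mu_0 subrr mulr0 mul0r.
apply: le_trans (mu_step rR) _.
have := ler_wpM2l (le_trans ler01 A1') (IH (ltnW rR)).
have h1 : tau <= tau * (1 + AA) ^+ r.+1 by rewrite ler_peMr // exprn_ege1.
have -> : tau * r.+1%:R * (1 + AA) ^+ r.+1 = (1 + AA) * (tau * r%:R * (1 + AA) ^+ r) + tau * (1 + AA) ^+ r.+1.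
  by rewrite -[r.+1%:R]natr1 exprS; ring.
by move: h1; lra.
Qed.

Lemma Est_Acc r : (r <= Rn)%N ->
  N / s%:R * (theta * (\sum_(i < r) uu i) * beta) <= Est r (fun st => #|sAcc st|%:R).
Proof.
elim: r => [|r IH] rR.
  rewrite big_ord0 mulr0 mul0r mulr0.
  have -> : 0 = Est 0 (fun=> 0) by rewrite Est_cst.
  by apply: Est_le => // st I; exact: ler0n.
have rR' := ltnW rR; have b4 := bb4 (leqnn Rn); have /andP[u0 u1] := uu01 r.
have h : Est r (fun st => #|sAcc st|%:R + theta * uu r / dR * ((1 - s%:R * delta) * Ms st +
    (- (dR / uu r * cc) * VV (uu r) st + (- (theta * dR * J%:R)) * TT 1 st))) <= Est r.+1 (fun st => #|sAcc st|%:R).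
  rewrite EstS; apply: Est_le_g => // st I; have := EZ_Acc2 bg1 (uu01 r) b4 I.
  rewrite /cc; set e1 := Ex _ _; set q := theta * uu r / dR.
  by move=> h; rewrite -lerBrDl; apply: le_trans h; rewrite le_eqVlt; apply/orP; left; apply/eqP; ring.
apply: le_trans h.
set F := (fun st : state => _).
have -> : Est r F = Est r (fun st => #|sAcc st|%:R) + theta * uu r / dR * ((1 - s%:R * delta) * Est r Ms +
    (- (dR / uu r * cc) * Est r (VV (uu r)) + (- (theta * dR * J%:R)) * Est r (TT 1))).
  by rewrite /F EstD EstZ !EstD !EstZ.
rewrite big_ord_recr /=.
have -> : N / s%:R * (theta * (\sum_(i < r) uu i + uu r) * beta) =
  N / s%:R * (theta * (\sum_(i < r) uu i) * beta) + N / s%:R * (theta * uu r * beta) by ring.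
apply: lerD; first exact: IH.
have -> : theta * uu r / dR * ((1 - s%:R * delta) * Est r Ms + (- (dR / uu r * cc) * Est r (VV (uu r)) +
   (- (theta * dR * J%:R)) * Est r (TT 1))) = N / s%:R * (theta * uu r * ((1 - s%:R * delta) * mu r -
   s%:R / (dR * N) * (dR / uu r * cc * Est r (VV (uu r))) - s%:R / (dR * N) * (theta * dR * J%:R * Est r (TT 1)))).
  by rewrite /mu; field; rewrite !gt_eqF.
apply: ler_wpM2l; first by rewrite divr_ge0 // ltW.
apply: ler_wpM2l; first by rewrite mulr_ge0 // ltW.
have hT : s%:R / (dR * N) * (theta * dR * J%:R * Est r (TT 1)) <= s%:R * (theta * J%:R * tt).
  have -> : s%:R * (theta * J%:R * tt) = s%:R / (dR * N) * (theta * dR * J%:R * (tt * N)).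
    by field; rewrite !gt_eqF.
  apply: ler_wpM2l; first by rewrite divr_ge0 // ltW // mulr_gt0.
  apply: ler_wpM2l; last exact: Est_TT.
  by do !apply: mulr_ge0 => //; exact: ltW.
have hV := Est_VV_mu rR'; have hr := mu_rho rR'; have m1 := mu_le1 rR'.
have /andP[d0 d1] := delta01.
have q1 : 0 <= s%:R * delta * (1 - mu r) by rewrite !mulr_ge0 ?subr_ge0 // ltW.
have q2 : 0 <= AA * (rho - (1 - mu r)) by rewrite mulr_ge0 // subr_ge0.
by rewrite /beta; move: hT hV tau_scg q1 q2 hr; lra.
Qed.

(** Subtracting the number of sampled bad sets inside the expectation yields one outcome that is
    good for both counts, so that a copy of each bad set can be deleted afterwards. *)
Lemma nibble_state c : c < N / s%:R * (theta * (\sum_(i < Rn) uu i) * beta) - ff * N ->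
  exists st, Inv bg st /\
    c < #|sAcc st|%:R - \sum_(D : {set E} | bad D && (#|D| <= 3 * J)%N) (D \subset sS st)%:R.
Proof.
move=> hc; apply: (@Est_exists Rn) => //; apply: lt_le_trans hc _.
rewrite EstD EstN; apply: lerB; first exact: Est_Acc.
apply: le_trans (Est_Phi (leqnn Rn)); apply: Est_le_g => // st I; rewrite /Phi -[leLHS]addr0.
apply: lerD; last first.
  apply: mulr_ge0; first by apply: divr_ge0; [exact: le_trans ler01 bg1 | exact: ltW].
  by apply: sumr_ge0 => D _; apply: prodr_ge0 => g _; apply: aS_ge0.
apply: ler_sum => D _; case: (boolP (D \subset sS st)) => [/subsetP DS|_]; last first.
  by apply: prodr_ge0 => g _; apply: aS_ge0.
rewrite -[leLHS](@big1 _ _ *%R _ (index_enum E) (mem D) (fun=> 1)) //.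
apply: ler_prod => g /DS gS; rewrite ler01 /= /aS gS lerDl.
by apply: divr_ge0; [exact: le_trans ler01 bg1 | exact: ltW].
Qed.

End Process.
End Nibble.

End Nibble.

(** * Choice of the constants and removal of the bad sets *)

Module Packing.
Import mathcomp.algebra_tactics.ring mathcomp.algebra_tactics.lra.
Import Order.TTheory GRing.Theory Num.Theory.
Import Correlation Nibble.

Local Open Scope ring_scope.

Lemma bernoulli (R : realFieldType) (x : R) n : 0 <= x <= 1 -> (1 - x) ^+ n * (1 + n%:R * x) <= 1.
Proof.
move=> /andP[x0 x1]; elim: n => [|n IH]; first by rewrite mul0r addr0 mulr1.
apply: le_trans IH; rewrite exprSr -mulrA; apply: ler_wpM2l; first by rewrite exprn_ge0 // subr_ge0.
rewrite -[n.+1%:R]natr1; have : 0 <= (n%:R + 1) * x * x :> R by rewrite !mulr_ge0 // addr_ge0.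
by lra.
Qed.

Lemma small_mul (R : realFieldType) (l : seq (R * R)) :
  (forall q, q \in l -> 0 <= q.1 /\ 0 < q.2) ->
  exists2 eta : R, 0 < eta & forall q, q \in l -> q.1 * eta <= q.2.
Proof.
elim: l => [|q l IH] h; first by exists 1.
have [|eta e0 he] := IH; first by move=> q' ql; apply: h; rewrite inE ql orbT.
have [q0 q1] := h q (mem_head _ _).
have c0 : 0 < q.1 + 1 by rewrite ltr_wpDl.
exists (Num.min eta (q.2 / (q.1 + 1))).
  by rewrite lt_min e0 divr_gt0.
move=> q'; rewrite inE => /orP[/eqP ->|ql].
  apply: le_trans (_ : q.1 * (q.2 / (q.1 + 1)) <= _).
    by apply: ler_wpM2l => //; rewrite ge_min lexx orbT.
  by rewrite mulrCA -[leRHS]mulr1; apply: ler_wpM2l; [exact: ltW | rewrite ler_pdivrMr // mul1r lerDl].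
have [q'0 _] : 0 <= q'.1 /\ 0 < q'.2 by apply: h; rewrite inE ql orbT.
by apply: le_trans (he q' ql); apply: ler_wpM2l => //; rewrite ge_min lexx.
Qed.

Section Packing.
Variable R : archiRealFieldType.

Lemma exists_nat_gt (x : R) : exists n : nat, x <= n%:R.
Proof.
exists (Num.bound `|x|); apply: le_trans (ler_norm x) _.
by apply: ltW; apply: archi_boundP.
Qed.

(** The constants are chosen in the order [delta], [Rn], [kap], [b], [eta]. The bound [b] on the
    weights is exponential in [Rn] and [kap], so [eta] has to come last. *)
Theorem packing (s J a : nat) (p Lam eps : R) :
  (0 < s)%N -> (1 < J)%N -> 0 <= p < 1 -> 0 < (1 - p) ^+ s * p ^+ a -> 0 <= Lam -> 0 < eps <= 1 ->
  exists2 eta : R, 0 < eta &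
  forall (X E : finType) (bd hh : E -> {set X}) (Conf : {set {set E}}) (bad : pred {set E}) (d : nat),
  (0 < d)%N -> (0 < #|X|)%N ->
  (forall e, #|bd e| = s) -> (forall e, #|hh e| = a) -> (forall e, [disjoint bd e & hh e]) ->
  (forall x, #|[set e | x \in bd e]| = d) ->
  (forall C, C \in Conf -> (2 < #|C| <= J)%N) ->
  (forall C e g, C \in Conf -> e \in C -> g \in C -> e != g ->
     [disjoint bd e :|: hh e & bd g :|: hh g]) ->
  (forall D, bad D -> D != set0) ->
  (forall K1 K2, PP bd Conf K1 -> PP bd Conf K2 -> K1 != K2 -> (1 < #|K1 :&: K2|)%N -> bad (K1 :|: K2)) ->
  (forall D K, bad D -> PP bd Conf K -> K :&: D != set0 -> bad (D :|: K)) ->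
  (forall C K K' e e', PP bd Conf C -> PP bd Conf K -> PP bd Conf K' -> e != e' ->
    e \in C -> e' \in C -> e \in K -> e' \in K' -> e' \notin K -> e \notin K' ->
    (K :\ e) :&: (K' :\ e') != set0 ->
    bad (C :|: K :|: K') \/ exists g x, [/\ C = [set e; e'], K = [set e; g], K' = [set e'; g],
     g != e' & [/\ x \in bd e, x \in bd e' & x \in bd g]]) ->
  (forall e e' x, e != e' -> x \in bd e -> x \in bd e' ->
    (bd e :|: hh e) :&: (bd e' :|: hh e') = [set x] \/ bad [set e; e']) ->
  d%:R^-1 <= eta ->
  \sum_(D : {set E} | bad D && (#|D| <= 3 * J)%N) d%:R ^- #|D| <= eta * #|X|%:R ->
  \sum_(C in Conf) d%:R ^- #|C| <= Lam * #|X|%:R ->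
  exists Acc : {set E}, exists H : {set X},
  [/\ (1 - eps) * ((1 - p) * #|X|%:R / s%:R) <= #|Acc|%:R,
      (forall e g, e \in Acc -> g \in Acc -> e != g -> [disjoint bd e & bd g]),
      (forall e, e \in Acc -> [disjoint bd e & H] /\ hh e \subset H),
      (forall C, C \in Conf -> ~~ (C \subset Acc)) &
      (forall D, bad D -> (#|D| <= 3 * J)%N -> ~~ (D \subset Acc))].
Proof.
move=> s_gt0 J2 p01 y0 Lam0 /andP[ep0 ep1].
have /andP[p0 p1] := p01; have q0 : 0 < 1 - p by rewrite subr_gt0.
have sR : 0 < s%:R :> R by rewrite ltr0n.
have JR : 0 < J%:R :> R by rewrite ltr0n (leq_trans _ J2).
(* Three factors at least [1 - e1] (division by [1 + delta], uncovered remainder, accepted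
   proportion) and a loss [e1 / 2] for the bad sets must fit into [eps]. *)
pose e1 := eps / 5; have e10 : 0 < e1 by rewrite divr_gt0.
have e15 : e1 <= 5^-1 by rewrite /e1; lra.
have e13 : 0 <= 3 - e1 by lra.
have e11 : 0 <= 1 - e1 by lra.
(* This will bound [tt] once [eta] is small, which lets [delta] be chosen before [eta]. *)
pose T1 := 2 ^+ J * Lam + 1.
have T10 : 1 <= T1 by rewrite lerDr mulr_ge0 // exprn_ge0.
have [delta dl0 hdl] : exists2 delta : R, 0 < delta & forall q, q \in [:: (1, 2^-1); (1, e1); (s%:R, 1);
    (s%:R + s%:R * (J%:R * T1), e1 / 2)] -> q.1 * delta <= q.2.
  apply: small_mul => q; rewrite !inE => /or4P[]/eqP -> /=; split => //; rewrite ?invr_gt0 ?divr_gt0 //.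
  by rewrite addr_ge0 // mulr_ge0 // mulr_ge0 // (le_trans ler01).
have dl2 : delta <= 2^-1 by have := hdl (1, 2^-1); rewrite !inE eqxx /= mul1r; apply.
have dle1 : delta <= e1 by have := hdl (1, e1); rewrite !inE eqxx /= orbT mul1r; apply.
have sd1 : s%:R * delta <= 1 by have := hdl (s%:R, 1); rewrite !inE eqxx /= !orbT; apply.
have sdJ : (s%:R + s%:R * (J%:R * T1)) * delta <= e1 / 2.
  by have := hdl (s%:R + s%:R * (J%:R * T1), e1 / 2); rewrite !inE eqxx /= !orbT; apply.
clear hdl; have delta01 : 0 < delta < 1 by apply/andP; split => //; lra.
have d10 : 0 < 1 + delta by lra.
have i1 : 1 - e1 <= (1 + delta)^-1.
  apply: le_trans (_ : 1 - delta <= _); first by lra.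
  by rewrite -[leRHS]mul1r ler_pdivlMr //; have := sqr_ge0 delta; lra.
pose theta := delta / (1 + delta).
have theta0 : 0 < theta by rewrite divr_gt0.
have thetaE : theta * (1 + delta) = delta by rewrite /theta divfK // gt_eqF.
have thle : theta <= delta by have := mulr_gt0 theta0 dl0; move: thetaE; rewrite mulrDr mulr1; lra.
have [Rn hRn] := exists_nat_gt (e1^-1 / delta).
have pR : (1 - delta) ^+ Rn <= e1.
  have := @bernoulli R delta Rn; rewrite (ltW dl0) /= => /(_ (ltW (proj2 (andP delta01)))) h.
  have x0 : 0 <= (1 - delta) ^+ Rn by rewrite exprn_ge0 // subr_ge0; lra.
  have : (1 - delta) ^+ Rn * e1^-1 <= 1.
    apply: le_trans h; apply: ler_wpM2l => //.
    by move: hRn; rewrite ler_pdivrMr //; lra.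
  by rewrite ler_pdivrMr // mul1r.
pose A := AA delta s; have A0 : 0 <= A.
  by rewrite /A /AA /cc !mulr_ge0 // ?invr_ge0 ?exprn_ge0 // ltW.
pose K1 := (1 + A) * (Rn%:R * (1 + A) ^+ Rn) + 1.
have K10 : 0 < K1.
  by rewrite ltr_wpDl // mulr_ge0 ?addr_ge0 // mulr_ge0 // exprn_ge0 // addr_ge0.
(* Each of the three terms of [tau] will be at most [e2], and [K1 * tau] has to stay below
   [e1 / 2]. *)
pose e2 := e1 / (6 * K1); have e20 : 0 < e2 by rewrite divr_gt0 // mulr_gt0.
have [kap hkap] := exists_nat_gt (Num.max 1 (s%:R * (theta * J%:R * T1) / e2)).
have kap0 : (0 < kap)%N.
  by rewrite -(ltr0n R); apply: lt_le_trans hkap; rewrite lt_max ltr01.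
have kR : 0 < kap%:R :> R by rewrite ltr0n.
have hk : s%:R * (theta * J%:R * T1 / kap%:R) <= e2.
  have : s%:R * (theta * J%:R * T1) / e2 <= kap%:R by apply: le_trans hkap; rewrite le_max lexx orbT.
  by rewrite ler_pdivrMr // => h; rewrite mulrA ler_pdivrMr // [leRHS]mulrC.
pose b := bb delta kap s p a Rn; have b0 : 1 <= b.
  by apply: (@bb1 R delta kap delta01 s p a p01 y0 Rn).
pose K3 := (2 ^+ Rn * b) ^+ (3 * J) * (1 + b * Lam).
have bg0 : 0 <= b by apply: le_trans b0.
have K30 : 0 <= K3.
  apply: mulr_ge0; last by rewrite addr_ge0 // mulr_ge0.
  by apply: exprn_ge0; apply: mulr_ge0 => //; exact: exprn_ge0.
have ffE eta : ff delta kap s J p a Rn eta Lam = K3 * eta by rewrite /ff /K3 -/b; ring.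
pose cw := cW delta kap s J p a Rn; pose ct := cT delta kap s J p a Rn.
have v0 : 0 <= b / vlow delta kap s.
  by rewrite divr_ge0 //; apply/ltW/vlow_gt0.
have cw0 : 0 <= cw.
  rewrite /cw /cW -/b; do !apply: mulr_ge0 => //; exact: exprn_ge0.
have ct0 : 0 <= ct.
  rewrite /ct /cT -/b; apply: mulr_ge0; first by rewrite exprn_ge0 // mulr_ge0.
  by do !apply: mulr_ge0 => //; exact: exprn_ge0.
pose c1 := cc delta; have c10 : 0 <= c1.
  by rewrite /c1 /cc divr_ge0 ?exprn_ge0 // ltW.
pose G := Rn%:R * (cw * K3) + b ^+ 2 * (1 + 4 * s%:R).
have G0 : 0 <= G.
  apply: addr_ge0; first by do !apply: mulr_ge0 => //.
  by apply: mulr_ge0; [exact: exprn_ge0 | rewrite addr_ge0 // mulr_ge0 // ltW].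
have [eta et0 het] : exists2 eta : R, 0 < eta & forall q, q \in [:: (b, 4^-1); (b, e2);
    (Rn%:R * (ct * K3), 1); (K3, e1 / 2 * ((1 - p) / s%:R)); (s%:R * c1 * G, e2)] -> q.1 * eta <= q.2.
  apply: small_mul => q; rewrite !inE => /or4P[| | |/orP[]]/eqP -> /=; split => //.
  - by rewrite invr_gt0.
  - by rewrite mulr_ge0 // mulr_ge0.
  - by rewrite mulr_gt0 // divr_gt0.
  - by rewrite mulr_ge0 // mulr_ge0 // ltW.
have be4 : b * eta <= 4^-1 by have := het (b, 4^-1); rewrite !inE eqxx /=; apply.
have be2 : b * eta <= e2 by have := het (b, e2); rewrite !inE eqxx /= orbT; apply.
have ce1 : Rn%:R * (ct * K3) * eta <= 1 by have := het (Rn%:R * (ct * K3), 1); rewrite !inE eqxx /= !orbT; apply.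
have Ke : K3 * eta <= e1 / 2 * ((1 - p) / s%:R).
  by have := het (K3, e1 / 2 * ((1 - p) / s%:R)); rewrite !inE eqxx /= !orbT; apply.
have Ge : s%:R * c1 * G * eta <= e2 by have := het (s%:R * c1 * G, e2); rewrite !inE eqxx /= !orbT; apply.
clear het; exists eta => // X E bd hh Conf bad d d_gt0 X0 bd_s hh_a bdhh deg conf_card conf_dis bad0
  A1 A2 A3 A4 d_eta Hbad HConf.
have dR : 0 < d%:R :> R by rewrite ltr0n.
have N0 : 0 < #|X|%:R :> R by rewrite ltr0n.
have bg4 : b / d%:R <= 4^-1 by apply: le_trans be4; apply: ler_wpM2l.
pose t := tt delta kap s J p a Rn eta Lam.
have tT : t <= T1.
  rewrite /t /tt /T1 ffE lerD2l -/ct; apply: le_trans ce1.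
  by rewrite le_eqVlt; apply/orP; left; apply/eqP; ring.
have t0 : 0 <= t.
  rewrite /t /tt ffE -/ct; apply: addr_ge0; first by apply: mulr_ge0 => //; exact: exprn_ge0.
  by do !apply: mulr_ge0 => //; exact: ltW.
pose g := gg delta kap s J p a Rn eta Lam.
have gE : g = G * eta by rewrite /g /gg ffE -/cw -/b /G; ring.
pose ta := tau theta delta kap s J p a Rn eta Lam.
have taE : ta = b * eta + s%:R * (theta * J%:R * t / kap%:R) + s%:R * c1 * g by [].
have h2 : s%:R * (theta * J%:R * t / kap%:R) <= e2.
  apply: le_trans hk; apply: ler_wpM2l; first exact: ltW.
  by apply: ler_wpM2r; [rewrite invr_ge0 ltW | apply: ler_wpM2l => //; rewrite mulr_ge0 // ltW].
have ta3 : ta <= 3 * e2 by move: be2 h2 Ge; rewrite taE gE mulrA; lra.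
have K1t : K1 * ta <= e1 / 2.
  apply: le_trans (ler_wpM2l (ltW K10) ta3) _.
  by rewrite le_eqVlt; apply/orP; left; apply/eqP; rewrite /e2; field; rewrite gt_eqF.
pose be := beta theta delta kap s J p a Rn eta Lam.
have beE : be = 1 - s%:R * delta - K1 * ta - s%:R * (theta * J%:R * t).
  by rewrite /be /beta /rho -/ta -/A -/t /K1; ring.
have st1 : s%:R * (theta * J%:R * t) <= s%:R * (J%:R * T1) * delta.
  have -> : s%:R * (J%:R * T1) * delta = s%:R * (delta * J%:R * T1) by ring.
  apply: ler_wpM2l; first exact: ltW.
  apply: ler_pM => //; first by rewrite mulr_ge0 // ltW.
  by apply: ler_wpM2r.
have be1 : 1 - e1 <= be by move: sdJ K1t st1; rewrite beE; lra.
have tS : theta * (\sum_(i < Rn) uu delta p i) = (1 - p) * ((1 - (1 - delta) ^+ Rn) / (1 + delta)).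
  have := @sum_uu R delta p Rn => h.
  have -> : theta * (\sum_(i < Rn) uu delta p i) = (delta * \sum_(i < Rn) uu delta p i) / (1 + delta).
    by rewrite /theta; ring.
  by rewrite h; ring.
have x1 : 1 - e1 <= 1 - (1 - delta) ^+ Rn by rewrite lerD2l lerN2.
have prod3 : 1 - 3 * e1 <= (1 - (1 - delta) ^+ Rn) / (1 + delta) * be.
  apply: le_trans (_ : (1 - e1) * (1 - e1) * (1 - e1) <= _).
    have h3 : 0 <= e1 * e1 * (3 - e1) by apply: mulr_ge0 => //; apply: mulr_ge0; exact: ltW.
    have -> : (1 - e1) * (1 - e1) * (1 - e1) = 1 - 3 * e1 + e1 * e1 * (3 - e1) by ring.
    by rewrite lerDl.
  by apply: ler_pM => //; [exact: mulr_ge0 | exact: ler_pM].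
pose c := (1 - eps) * ((1 - p) * #|X|%:R / s%:R).
have hc : c < #|X|%:R / s%:R * (theta * (\sum_(i < Rn) uu delta p i) * be) - ff delta kap s J p a Rn eta Lam * #|X|%:R.
  rewrite tS ffE; pose q := (1 - p) * #|X|%:R / s%:R.
  have qq : 0 < q by rewrite divr_gt0 // mulr_gt0.
  have -> : #|X|%:R / s%:R * ((1 - p) * ((1 - (1 - delta) ^+ Rn) / (1 + delta)) * be) =
     q * ((1 - (1 - delta) ^+ Rn) / (1 + delta) * be) by rewrite /q; ring.
  have h4 : K3 * eta * #|X|%:R <= q * (e1 / 2).
    apply: le_trans (ler_wpM2r (ltW N0) Ke) _.
    by rewrite le_eqVlt; apply/orP; left; apply/eqP; rewrite /q; ring.
  have h5 := ler_wpM2l (ltW qq) prod3.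
  have h6 : 0 < q * e1 by rewrite mulr_gt0.
  rewrite /c -/q; have -> : eps = 5 * e1 by rewrite /e1; field.
  move: h4 h5 h6; clear; rewrite !mulrBr; lra.
have thetaE' : theta * (1 + delta) <= delta by rewrite thetaE.
have [st [I hst]] := @nibble_state R X E bd hh Conf theta delta kap d d_gt0 delta01 thetaE' theta0 s bd_s s_gt0
  J J2 conf_card conf_dis bad A1 A2 A3 A4 p a Rn p01 hh_a bdhh y0 bg4 deg eta Lam Lam0 d_eta Hbad HConf X0 kap0 c hc.
pose B := [set D : {set E} | [&& bad D, (#|D| <= 3 * J)%N & D \subset sAcc st]].
pose pk (D : {set E}) := if [pick e in D] is Some e then [set e] else set0.
pose Del := \bigcup_(D in B) pk D.
have DelB : (#|Del| <= #|B|)%N.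
  have -> : #|B| = (\sum_(D in B) 1)%N by rewrite sum1_card.
  apply: (big_ind2 (fun (A : {set E}) n => (#|A| <= n)%N)).
  - by rewrite cards0.
  - by move=> A1' n1 A2' n2 h1 h2'; apply: leq_trans (leq_card_setU _ _) _; apply: leq_add.
  - by move=> D _; rewrite /pk; case: pickP => [e _|_]; rewrite ?cards1 ?cards0.
have BS : #|B|%:R <= \sum_(D : {set E} | bad D && (#|D| <= 3 * J)%N) (D \subset sS st)%:R :> R.
  rewrite -sum1_card natr_sum big_mkcond [leRHS]big_mkcond /=; apply: ler_sum => D _; rewrite inE.
  case: (bad D) => //=; case: (_ <= _)%N => //=; case: (boolP (D \subset sAcc st)) => // h.
  by rewrite (subset_trans h (inv_Acc I)).
exists (sAcc st :\: Del), (sH st); split.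
- have : #|sAcc st|%:R <= #|sAcc st :\: Del|%:R + #|B|%:R :> R.
    rewrite -natrD ler_nat -(cardsID Del (sAcc st)) addnC leq_add2l.
    by apply: leq_trans DelB; apply/subset_leq_card/subsetIr.
  by move: hst BS; rewrite -/c; lra.
- move=> e1' g1; rewrite !inE => /andP[_ eA] /andP[_ gA] eg.
  by have := inv_olap I eA gA; rewrite /olap eg /= negbK.
- move=> e1'; rewrite inE => /andP[_ eA]; apply/andP; apply: (inv_H I).
  by rewrite inE eA orbT.
- move=> C CC; apply: contraNN (inv_Conf I CC) => h; apply: subset_trans h _; exact: subsetDl.
- move=> D bD DJ; apply/negP => h.
  have DB : D \in B by rewrite inE bD DJ /=; apply: subset_trans h _; exact: subsetDl.
  have /set0Pn[e0 e0D] := bad0 D bD.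
  have [e' e'D e'p] : exists2 e', e' \in D & e' \in pk D.
    rewrite /pk; case: pickP => [e' e'D|/(_ e0)]; last by rewrite e0D.
    by exists e'; rewrite ?inE.
  have := subsetP h e' e'D; rewrite inE => /andP[/negP []].
  by apply/bigcupP; exists D.
Qed.

End Packing.

End Packing.

(** * Random copies of a gadget *)
Module Copies.
Import mathcomp.algebra_tactics.ring mathcomp.algebra_tactics.lra.
Import Order.TTheory GRing.Theory Num.Theory.
Import Correlation Nibble Packing.

(** * Overlaps of copies and submodularity *)

Section Gadget.
Variables (VF : finType) (Jp : {set {set VF}}).
Hypothesis Jp2 : forall P, P \in Jp -> #|P| = 2.
Local Notation m := #|VF|.
Hypothesis m2 : 2 < m.

Section Fixed_n.
Variable n : nat.

Definition Emb := {f : {ffun VF -> 'I_n} | injectiveb f}.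
Definition Prs := {A : {set 'I_n} | #|A| == 2}.

Implicit Types (e g : Emb) (x : Prs) (D K C : {set Emb}).

Definition im e (P : {set VF}) : {set 'I_n} := [set val e v | v in P].
Definition Ve e := im e setT.
Definition VD D := \bigcup_(e in D) Ve e.
Definition bdf e : {set Prs} := [set x | [exists P in Jp, val x == im e P]].
Definition hhf e : {set Prs} := [set x | [exists P : {set VF}, [&& #|P| == 2, P \notin Jp & val x == im e P]]].
(* In terms of [f D = #|VD D| - (m - 2) * #|D| - 2], which is submodular on intersecting
   sets, [badf] asks for [f D < 0], and [Conff] consists of the minimal sets with [f <= 0]. *)
Definition badf : pred {set Emb} := fun D => (D != set0) && (#|VD D| <= (m - 2) * #|D| + 1).
Definition Conff : {set {set Emb}} := [set C : {set Emb} | [&& 2 < #|C| <= 7, #|VD C| <= (m - 2) * #|C| + 2 &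
  [forall D : {set Emb}, (D \proper C) ==> (1 < #|D|) ==> ((m - 2) * #|D| + 3 <= #|VD D|)]]].

Lemma emb_inj e : injective (val e).
Proof. by case: e => f fi; apply/injectiveP. Qed.

Lemma im_inj e : injective (im e).
Proof. exact: imset_inj (@emb_inj e). Qed.

Lemma card_im e P : #|im e P| = #|P|.
Proof. by rewrite card_imset //; apply: emb_inj. Qed.

Lemma im_sub e P : im e P \subset Ve e.
Proof. by apply: imsetS; apply: subsetT. Qed.

Lemma card_Ve e : #|Ve e| = m.
Proof. by rewrite card_im cardsT. Qed.

Lemma bd_hh_E e x : (x \in bdf e :|: hhf e) = (val x \subset Ve e).
Proof.
rewrite !inE; apply/orP/idP => [[/existsP[P /andP[_ /eqP ->]]|/existsP[P /and3P[_ _ /eqP ->]]]|h].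
- exact: im_sub.
- exact: im_sub.
pose P := [set v | val e v \in val x].
have xP : val x = im e P.
  apply/setP => i; apply/idP/imsetP => [ix|[v]]; last by rewrite inE => vx ->.
  by have /imsetP[v _ iv] := subsetP h i ix; exists v; rewrite // inE -iv.
have P2 : #|P| == 2 by rewrite -(card_im e) -xP; have := valP x.
case: (boolP (P \in Jp)) => PJ; [left|right].
  by apply/existsP; exists P; rewrite PJ xP eqxx.
by apply/existsP; exists P; rewrite P2 PJ xP eqxx.
Qed.

Lemma bd_sub e x : x \in bdf e -> val x \subset Ve e.
Proof. by move=> h; rewrite -bd_hh_E in_setU h. Qed.

Lemma bd_hh_dis e : [disjoint bdf e & hhf e].
Proof.
rewrite -setI_eq0; apply/eqP/setP => x; rewrite !inE; apply/negP => /andP[/existsP[P /andP[PJ /eqP h]]].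
by case/existsP => Q /and3P[_ QJ]; rewrite h => /eqP/im_inj PQ; rewrite -PQ PJ in QJ.
Qed.

Lemma card_image e (S : {set {set VF}}) (B : {set Prs}) : (forall P, P \in S -> #|P| = 2) ->
  (forall x, (x \in B) = [exists P in S, val x == im e P]) -> #|B| = #|S|.
Proof.
move=> S2 SB; rewrite -(card_imset (mem B) val_inj) -(card_imset (mem S) (@im_inj e)).
congr #|pred_of_set _|; apply/setP => A; apply/imsetP/imsetP => [[x xB ->]|[P PS ->]].
  by move: xB; rewrite SB => /existsP[P /andP[PS /eqP ->]]; exists P.
have h : #|im e P| == 2 by rewrite card_im S2.
exists (exist _ (im e P) h) => //; rewrite SB; apply/existsP; exists P; rewrite PS eqxx //.
Qed.

Lemma card_bd e : #|bdf e| = #|Jp|.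
Proof. by apply: (card_image (e := e)) => // x; rewrite inE. Qed.

Definition nJ := [set P : {set VF} | (#|P| == 2) && (P \notin Jp)].

Lemma card_hh e : #|hhf e| = #|nJ|.
Proof.
apply: (card_image (e := e)) => [P|x]; first by rewrite inE => /andP[/eqP].
by rewrite inE; apply: eq_existsb => P; rewrite inE -andbA.
Qed.

Lemma VD1 e : VD [set e] = Ve e.
Proof. by rewrite /VD big_set1. Qed.

Lemma VDU D K : VD (D :|: K) = VD D :|: VD K.
Proof. by rewrite /VD bigcup_setU. Qed.

Lemma VDS D K : D \subset K -> VD D \subset VD K.
Proof. by move=> h; apply/bigcupsP => e eD; apply: (bigcup_sup e) => //; apply: (subsetP h). Qed.

Lemma VD2 e g : VD [set e; g] = Ve e :|: Ve g.
Proof. by rewrite VDU !VD1. Qed.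

Lemma VD_submod D K : #|VD (D :|: K)| + #|VD (D :&: K)| <= #|VD D| + #|VD K|.
Proof.
rewrite VDU -(cardsUI (VD D) (VD K)) leq_add2l; apply: subset_leq_card.
by rewrite subsetI !VDS ?subsetIl ?subsetIr.
Qed.

Lemma card_pair e g : e != g -> (m - 2) * #|[set e; g]| = 2 * m - 4.
Proof. by move=> h; rewrite cards2 h; lia. Qed.

Lemma card_VD2 e g : #|VD [set e; g]| + #|Ve e :&: Ve g| = 2 * m.
Proof. by rewrite VD2 cardsUI !card_Ve mul2n addnn. Qed.

Local Notation PP := (PP bdf Conff).

Lemma olap_shared e g : olap bdf e g -> exists2 x, x \in bdf e & x \in bdf g.
Proof. by case/andP => _; rewrite -setI_eq0 => /set0Pn[x]; rewrite inE => /andP[]; exists x. Qed.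

Lemma olap_VD e g : olap bdf e g -> #|VD [set e; g]| <= (m - 2) * #|[set e; g]| + 2.
Proof.
move=> o; have /andP[eg _] := o; have [x xe xg] := olap_shared o; rewrite card_pair //.
have : #|val x| <= #|Ve e :&: Ve g| by apply: subset_leq_card; rewrite subsetI !bd_sub.
by rewrite (eqP (valP x)); have := card_VD2 e g; lia.
Qed.

Lemma PP_f K : PP K -> [/\ 1 < #|K|, #|VD K| <= (m - 2) * #|K| + 2 &
  forall D, D \proper K -> 1 < #|D| -> (m - 2) * #|D| + 3 <= #|VD D|].
Proof.
case/orP => [|/existsP[e /existsP[g /andP[o /eqP ->]]]].
  rewrite inE => /and3P[/andP[h _] h1 /forallP h2]; split => //; first exact: ltnW.
  by move=> D DC D1; have := h2 D; rewrite DC D1.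
have /andP[eg _] := o; split; [by rewrite cards2 eg | exact: olap_VD |].
by move=> D /proper_card; rewrite cards2 eg => h h'; move: h; rewrite ltnNge h'.
Qed.

Lemma one_le D : D != set0 -> #|D| <= 1 -> #|VD D| = (m - 2) * #|D| + 2.
Proof.
rewrite -card_gt0 => h0 h1; have /eqP/cards1P[e ->] : #|D| = 1 by lia.
by rewrite VD1 cards1 card_Ve; lia.
Qed.

Lemma two_le (A : {set Emb}) e g : e != g -> e \in A -> g \in A -> 1 < #|A|.
Proof.
move=> eg eA gA; have <- : #|[set e; g]| = 2 by rewrite cards2 eg.
by apply/subset_leq_card/subsetP => h /set2P[]->.
Qed.

Lemma cardsUI_m D K : (m - 2) * #|D :|: K| + (m - 2) * #|D :&: K| = (m - 2) * #|D| + (m - 2) * #|K|.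
Proof. by rewrite -!mulnDr cardsUI. Qed.

Lemma cardU_ge D K : #|D| <= #|D :|: K|.
Proof. by apply/subset_leq_card/subsetUl. Qed.

(** With [f] as above, [f] is at most 0 on both sets and at least 1 on their intersection, which has
    two elements and is a proper subset of one of them; submodularity makes [f] negative on the
    union. *)
Lemma badA1 K1 K2 : PP K1 -> PP K2 -> K1 != K2 -> 1 < #|K1 :&: K2| -> badf (K1 :|: K2).
Proof.
move=> P1 P2 K12 I2; have [c1 f1 p1] := PP_f P1; have [c2 f2 p2] := PP_f P2.
have fI : (m - 2) * #|K1 :&: K2| + 3 <= #|VD (K1 :&: K2)|.
  case: (boolP (K1 :&: K2 \proper K1)) => h; first exact: p1.
  apply: p2 => //; rewrite properE subsetIr /= subsetI subxx andbT.
  move: h; rewrite properE subsetIl /= negbK subsetI subxx /= => h.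
  by apply/negP => h'; move/eqP: K12; apply; apply/eqP; rewrite eqEsubset h.
rewrite /badf -card_gt0; have := VD_submod K1 K2; have := cardsUI_m K1 K2; have := cardU_ge K1 K2.
by move: c1 c2 f1 f2 fI I2; lia.
Qed.

(** Here [f] is negative on [D], at most 0 on [K], and nonnegative on the nonempty intersection if
    that is not all of [K]. *)
Lemma badA2 D K : badf D -> PP K -> K :&: D != set0 -> badf (D :|: K).
Proof.
move=> /andP[D0 fD] PK KD; have [c f p] := PP_f PK; have := VD_submod D K; have := cardsUI_m D K; have := cardU_ge D K.
case: (boolP (K \subset D)) => [KsD|nKD].
  by move=> _ _ _; rewrite (setUidPl KsD) /badf D0.
have fI : (m - 2) * #|D :&: K| + 2 <= #|VD (D :&: K)|.
  case: (ltnP 1 #|D :&: K|) => h.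
    have /(p _)/(_ h) : D :&: K \proper K by rewrite properE subsetIr /= subsetI subxx andbT.
    by lia.
  by rewrite one_le // setIC.
rewrite /badf -!card_gt0 in D0 *; move: D0 c fD f fI; lia.
Qed.

(** When the three sets meet pairwise in single copies and one of them has three elements, it meets
    the union of the other two in exactly two copies, a proper subset where [f] is at least 1
    ([key]). If all are overlaps, two different common pairs give a copy three vertices in common
    with the other two; a single common pair is the exception. *)
Lemma badA3 C K K' e e' : PP C -> PP K -> PP K' -> e != e' ->
    e \in C -> e' \in C -> e \in K -> e' \in K' -> e' \notin K -> e \notin K' ->
    (K :\ e) :&: (K' :\ e') != set0 ->
    badf (C :|: K :|: K') \/ exists g x, [/\ C = [set e; e'], K = [set e; g], K' = [set e'; g],
     g != e' & [/\ x \in bdf e, x \in bdf e' & x \in bdf g]].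
Proof.
move=> PC PK PK' ee' eC eC' eK eK' e'K eKp /set0Pn[g]; rewrite !inE => /andP[/andP[ge gK] /andP[ge' gK']].
have [cC fC pC] := PP_f PC; have [cK fK pK] := PP_f PK; have [cK' fK' pK'] := PP_f PK'.
have nCK : C != K by apply: contraNneq e'K => <-.
have nCK' : C != K' by apply: contraNneq eKp => <-.
have nKK' : K != K' by apply: contraNneq eKp => <-.
have mt (A B : {set Emb}) z : z \in A -> z \in B -> A :&: B != set0.
  by move=> zA zB; apply/set0Pn; exists z; rewrite inE zA.
case: (ltnP 1 #|C :&: K|) => CK.
  left; apply: badA2 => //; first exact: badA1.
  by apply: (mt _ _ e'); rewrite // inE eC'.
case: (ltnP 1 #|C :&: K'|) => CK'.
  left; rewrite setUAC; apply: badA2 => //; first exact: badA1.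
  by apply: (mt _ _ e); rewrite // inE eC.
case: (ltnP 1 #|K :&: K'|) => KK'.
  left; rewrite -setUA setUC; apply: badA2 => //; first exact: badA1.
  by apply: (mt _ _ e); rewrite // inE eK.
have uniq1 (A B : {set Emb}) y z : #|A :&: B| <= 1 -> y \in A -> y \in B -> z \in A -> z \in B -> z = y.
  move=> h yA yB zA zB; apply/eqP; apply: contraLR h => zy; rewrite -ltnNge.
  by apply: (two_le zy); rewrite inE ?zA ?yA.
have key (A B B' : {set Emb}) y z w : 2 < #|A| -> PP A -> PP B -> PP B' -> y != z ->
    y \in A -> y \in B -> z \in A -> z \in B' -> w \in B -> w \in B' ->
    #|A :&: B| <= 1 -> #|A :&: B'| <= 1 -> #|B :&: B'| <= 1 -> badf (A :|: (B :|: B')).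
  move=> A3 PA PB PB' yz yA yB zA zB' wB wB' h1 h2 h3.
  have [cA fA pA] := PP_f PA; have [cB fB pB] := PP_f PB; have [cB' fB' pB'] := PP_f PB'.
  have EI : A :&: (B :|: B') = [set y; z].
    apply/setP => t; rewrite !inE; apply/andP/orP => [[tA /orP[tB|tB']]|[/eqP ->|/eqP ->]].
    - by left; apply/eqP; apply: (uniq1 A B).
    - by right; apply/eqP; apply: (uniq1 A B').
    - by rewrite yA yB.
    - by rewrite zA zB' orbT.
  have pyz : [set y; z] \proper A.
    rewrite properEcard cards2 yz A3 andbT; apply/subsetP => t /set2P[]-> //.
  have fyz := pA _ pyz; rewrite cards2 yz /= in fyz; have {}fyz := fyz isT.
  have BB' : B :&: B' != set0 by apply: (mt _ _ w).
  have f1 := one_le BB' h3.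
  have := VD_submod A (B :|: B'); have := cardsUI_m A (B :|: B').
  have := VD_submod B B'; have := cardsUI_m B B'; have := cardU_ge A (B :|: B').
  have : #|B :&: B'| = 1 by apply/eqP; rewrite eqn_leq h3 card_gt0.
  rewrite /badf -card_gt0 => i1; rewrite EI cards2 yz /= i1.
  move: cA fA fB fB' fyz f1 A3; rewrite i1; clear; move: (#|VF| - 2) => q.
  move: #|A :|: (B :|: B')| #|VD (A :|: (B :|: B'))| #|VD [set y; z]| #|VD (B :|: B')| #|VD (B :&: B')| #|B :|: B'| #|VD A| #|VD B| #|VD B'| #|A| #|B| #|B'| => a1 a2 a3 a4 a5 a6 a7 a8 a9 a10 a11 a12.
  lia.
case: (ltnP 2 #|C|) => C3.
  by left; rewrite -setUA; apply: (key C K K' e e' g).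
case: (ltnP 2 #|K|) => K3.
  left; rewrite [C :|: K]setUC -setUA; apply: (key K C K' e g e'); rewrite // 1?eq_sym //.
  by rewrite setIC.
case: (ltnP 2 #|K'|) => K3'.
  left; rewrite setUC; apply: (key K' C K e' g e); rewrite // 1?eq_sym // setIC //.
have pairE (A : {set Emb}) y z : y != z -> y \in A -> z \in A -> #|A| <= 2 -> A = [set y; z].
  move=> yz yA zA A2; apply/esym/eqP; rewrite eqEcard cards2 yz A2 andbT.
  by apply/subsetP => t /set2P[]->.
have EC := pairE C e e' ee' eC eC' C3.
have eg : e != g by rewrite eq_sym.
have EK := pairE K e g eg eK gK K3.
have e'g : e' != g by rewrite eq_sym.
have EK' := pairE K' e' g e'g eK' gK' K3'.
have ol (A : {set Emb}) y z : PP A -> #|A| <= 2 -> y \in A -> z \in A -> y != z -> olap bdf y z.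
  case/orP => [|/existsP[y' /existsP[z' /andP[o /eqP ->]]]].
    by rewrite inE => /and3P[/andP[h _] _ _]; rewrite leqNgt h.
  move=> _ /set2P[]-> /set2P[]->; rewrite ?eqxx // => _.
  by move: o; rewrite /olap eq_sym disjoint_sym.
have [y ye ye'] := olap_shared (ol C e e' PC C3 eC eC' ee').
have [z ze zg] := olap_shared (ol K e g PK K3 eK gK eg).
have [w we' wg] := olap_shared (ol K' e' g PK' K3' eK' gK' e'g).
have exc t : t \in bdf e -> t \in bdf e' -> t \in bdf g ->
   exists g x, [/\ C = [set e; e'], K = [set e; g], K' = [set e'; g],
     g != e' & [/\ x \in bdf e, x \in bdf e' & x \in bdf g]].
  by move=> te te' tg; exists g, t; split.
case: (eqVneq z w) => [zw|zw]; first by right; apply: (exc z); rewrite // zw.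
left; have -> : C :|: K :|: K' = [set e; e'] :|: [set g].
  rewrite EC EK EK'; apply/setP => t; rewrite !inE.
  by case: (t == e); case: (t == e'); case: (t == g).
have c3 : #|[set e; e'] :|: [set g]| = 3.
  by rewrite setUC cardsU1 !inE cards2 ee' (negbTE ge) (negbTE ge').
rewrite /badf -card_gt0 c3 VDU VD2 VD1 /=.
have h1 := card_VD2 e e'; rewrite VD2 in h1.
have h2 := cardsUI (Ve e :|: Ve e') (Ve g); rewrite card_Ve in h2.
have h3 : 2 <= #|Ve e :&: Ve e'|.
  have <- : #|val y| = 2 by apply/eqP; have := valP y.
  by apply: subset_leq_card; rewrite subsetI !bd_sub.
have h4 : 3 <= #|(Ve e :|: Ve e') :&: Ve g|.
  have zz : #|val z| = 2 by apply/eqP; have := valP z.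
  have ww : #|val w| = 2 by apply/eqP; have := valP w.
  apply: leq_trans (_ : #|val z :|: val w| <= _); last first.
    apply: subset_leq_card; rewrite subsetI !subUset !(bd_sub zg, bd_sub wg) andbT.
    by rewrite (subset_trans (bd_sub ze)) ?subsetUl // (subset_trans (bd_sub we')) ?subsetUr.
  rewrite ltnNge; apply: contraNN zw => zw2; apply/eqP/val_inj.
  have e1 : val z :|: val w = val z by apply/esym/eqP; rewrite eqEcard subsetUl zz.
  by apply/eqP; rewrite eq_sym eqEcard zz ww leqnn andbT -e1 subsetUr.
move: h1 h2 h3 h4 m2; clear.
move: #|Ve e :|: Ve e' :|: Ve g| #|(Ve e :|: Ve e') :&: Ve g| #|Ve e :|: Ve e'| #|Ve e :&: Ve e'| #|VF| => a1 a2 a3 a4 a5.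
lia.
Qed.

Lemma badA4 e e' x : e != e' -> x \in bdf e -> x \in bdf e' ->
  (bdf e :|: hhf e) :&: (bdf e' :|: hhf e') = [set x] \/ badf [set e; e'].
Proof.
move=> ee' xe xe'; case: (boolP ((bdf e :|: hhf e) :&: (bdf e' :|: hhf e') == [set x])) => [/eqP|h]; first by left.
right; have [y yx [ye ye']] : exists2 y, y != x & y \in bdf e :|: hhf e /\ y \in bdf e' :|: hhf e'.
  have : ~~ ((bdf e :|: hhf e) :&: (bdf e' :|: hhf e') \subset [set x]).
    apply: contraNN h => h; rewrite eqEsubset h sub1set !inE.
    by move: xe xe'; rewrite !inE => -> ->.
  by move=> /subsetPn[y]; rewrite in_setI in_set1 => /andP[h1 h2] h3; exists y.
rewrite /badf -card_gt0 card_pair // cards2 ee' /=.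
have := card_VD2 e e'; rewrite !bd_hh_E in ye ye'.
have xx : #|val x| = 2 by apply/eqP; have := valP x.
have yy : #|val y| = 2 by apply/eqP; have := valP y.
have : 3 <= #|Ve e :&: Ve e'|.
  apply: leq_trans (_ : #|val x :|: val y| <= _); last first.
    by apply: subset_leq_card; rewrite subsetI !subUset (bd_sub xe) (bd_sub xe') ye ye'.
  rewrite ltnNge; apply: contraNN yx => xy2; apply/eqP/val_inj.
  have e1 : val x :|: val y = val x by apply/esym/eqP; rewrite eqEcard subsetUl xx.
  by apply/eqP; rewrite eqEcard xx yy leqnn andbT -e1 subsetUr.
move: m2; clear; move: #|VD [set e; e']| #|Ve e :&: Ve e'| #|VF| => a1 a2 a3; lia.
Qed.

Lemma conf_disf C e g : C \in Conff -> e \in C -> g \in C -> e != g ->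
     [disjoint bdf e :|: hhf e & bdf g :|: hhf g].
Proof.
move=> CC eC gC eg; rewrite -setI_eq0; apply/eqP/setP => x; rewrite in_setI in_set0 !bd_hh_E.
apply/negP => /andP[xe xg]; have PC : PP C by rewrite /PP CC.
have [_ _ pC] := PP_f PC; have /andP[C3 _] : 2 < #|C| <= 7 by move: CC; rewrite inE => /and3P[].
have pr : [set e; g] \proper C.
  by rewrite properEcard cards2 eg C3 andbT; apply/subsetP => t /set2P[]->.
have := pC _ pr; rewrite card_pair // cards2 eg => /(_ isT).
have := card_VD2 e g; have xx : #|val x| = 2 by apply/eqP; have := valP x.
have : #|val x| <= #|Ve e :&: Ve g| by apply: subset_leq_card; rewrite subsetI xe xg.
rewrite xx; move: m2; clear; move: #|VD [set e; g]| #|Ve e :&: Ve g| #|VF| => a1 a2 a3; lia.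
Qed.

Lemma conf_cardf C : C \in Conff -> 2 < #|C| <= 7.
Proof. by rewrite inE => /and3P[]. Qed.

Lemma bad_neq0 D : badf D -> D != set0.
Proof. by case/andP. Qed.

End Fixed_n.
End Gadget.

(** * The number of sets of copies with few vertices *)

Section Counting.
Variables (VF : finType) (Jp : {set {set VF}}).
Hypothesis Jp2 : forall P, P \in Jp -> #|P| = 2.
Hypothesis Jp0 : Jp != set0.
Local Notation m := #|VF|.
Hypothesis m2 : 2 < m.

(** A set of copies is encoded by a list of its at most [v] vertices and by the set of maps from the
    gadget into positions of this list. *)
Lemma count_small n v : 0 < v -> #|[set D : {set Emb VF n} | (D != set0) && (#|VD D| <= v)]| <= n ^ v * 2 ^ (v ^ m).
Proof.
move=> v0.
pose g (q : {ffun 'I_v -> 'I_n} * {set {ffun VF -> 'I_v}}) : {set Emb VF n} :=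
  [set e : Emb VF n | [exists h in q.2, [forall x, val e x == q.1 (h x)]]].
apply: leq_trans (_ : #|[set g q | q in setT]| <= _); last first.
  apply: leq_trans (leq_imset_card _ _) _; rewrite cardsT card_prod card_ffun !card_ord leq_mul //.
  by rewrite -cardsT -powersetT card_powerset cardsT card_ffun card_ord.
apply/subset_leq_card/subsetP => D; rewrite inE => /andP[/set0Pn[e0 e0D] Dv].
have x0 : VF.
  by have := leq_trans (isT : 0 < 3) m2; rewrite cardE; case: (enum VF).
pose i0 : 'I_n := val e0 x0.
pose c := [ffun i : 'I_v => nth i0 (enum (VD D)) i].
have inV (e : Emb VF n) x : e \in D -> val e x \in enum (VD D).
  by move=> eD; rewrite mem_enum; apply/bigcupP; exists e => //; apply: imset_f; rewrite inE.
pose ix (e : Emb VF n) (x : VF) : 'I_v := insubd (Ordinal v0) (index (val e x) (enum (VD D))).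
have cix (e : Emb VF n) x : e \in D -> c (ix e x) = val e x.
  move=> eD; rewrite ffunE insubdK ?nth_index ?inV // -topredE /=.
  by apply: leq_trans Dv; rewrite cardE index_mem inV.
apply/imsetP; exists (c, [set [ffun x => ix e x] | e in D]) => //.
apply/setP => e; rewrite inE; apply/idP/existsP => [eD|[h /andP[/imsetP[e' e'D ->] /forallP he]]].
  exists [ffun x => ix e x]; rewrite imset_f //=; apply/forallP => x.
  by rewrite ffunE cix.
suff -> : e = e' by [].
apply: val_inj; apply/ffunP => x; rewrite (eqP (he x)) /= ffunE cix //.
Qed.

Section Regular.
Variable n : nat.
Local Notation E := (Emb VF n).
Implicit Types (e : E) (x y : Prs n).

Lemma perm_pairs x y : exists s : {perm 'I_n}, [set s i | i in val x] = val y.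
Proof.
have /cards2P[a [b [ab ->]]] : #|val x| == 2 := valP x.
have /cards2P[c [d [cd ->]]] : #|val y| == 2 := valP y.
exists (tperm a c * tperm (tperm a c b) d)%g.
rewrite imsetU1 imset_set1 !permM tpermL tpermL tpermD //; last by rewrite eq_sym.
by rewrite -[X in _ != X](tpermL a c) (inj_eq perm_inj) eq_sym.
Qed.

Definition shift (s : {perm 'I_n}) e : E :=
  insubd e [ffun v => s (val e v)].

Lemma shiftE s e v : val (shift s e) v = s (val e v).
Proof.
rewrite insubdK ?ffunE //; apply/injectiveP => a b; rewrite !ffunE => /perm_inj.
exact: (@emb_inj _ _ e).
Qed.

Lemma im_shift s e P : im (shift s e) P = [set s i | i in im e P].
Proof. by rewrite -imset_comp; apply: eq_imset => v; rewrite shiftE. Qed.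

(** Permutations of the vertices act on the copies and are transitive on pairs. *)
Lemma deg_le x y : #|[set e | x \in bdf Jp e]| <= #|[set e | y \in bdf Jp e]|.
Proof.
have [s sxy] := perm_pairs x y.
have inj : injective (shift s).
  move=> e e' h; apply: val_inj; apply/ffunP => v; apply: (@perm_inj _ s).
  by rewrite -!shiftE h.
rewrite -(card_imset _ inj); apply/subset_leq_card/subsetP => e' /imsetP[e].
rewrite !inE => /existsP[P /andP[PJ /eqP xP]] ->.
by apply/existsP; exists P; rewrite PJ im_shift -xP sxy eqxx.
Qed.

Lemma deg_eq x y : #|[set e | x \in bdf Jp e]| = #|[set e | y \in bdf Jp e]|.
Proof. by apply/eqP; rewrite eqn_leq !deg_le. Qed.

Lemma card_Prs : #|{: Prs n}| = 'C(n, 2).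
Proof.
rewrite card_sig -[in RHS](card_ord n) -card_draws -sum1dep_card sum1_card.
by apply: eq_card => A; rewrite inE.
Qed.

Lemma card_Emb : #|{: E}| = n ^_ m.
Proof.
rewrite card_sig -[in RHS](card_ord n) -card_inj_ffuns -sum1dep_card sum1_card.
by apply: eq_card => A; rewrite inE.
Qed.

Lemma deg_count x : #|[set e | x \in bdf Jp e]| * 'C(n, 2) = #|Jp| * n ^_ m.
Proof.
rewrite -card_Prs -card_Emb.
transitivity (\sum_(y : Prs n) \sum_(e : E | y \in bdf Jp e) 1).
  rewrite mulnC -sum_nat_const; apply: eq_bigr => y _; rewrite (deg_eq x y) -sum1_card.
  by apply: eq_bigl => e; rewrite inE.
rewrite (exchange_big_dep predT) //= mulnC -sum_nat_const; apply: eq_bigr => e _.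
by rewrite sum1_card card_bd.
Qed.

Lemma ffact_ge a k : (a - k) ^ k <= a ^_ k.
Proof.
elim: k => [|k IH]; first by rewrite ffactn0.
rewrite ffactnSr expnSr; apply: leq_mul; last by lia.
by apply: leq_trans IH; case: k => // k; rewrite leq_exp2r //; lia.
Qed.

Lemma deg_ge x : 2 * m <= n -> n ^ (m - 2) <= 2 ^ m * #|[set e | x \in bdf Jp e]|.
Proof.
move=> nm; have c := deg_count x; set d := #|_| in c *.
have s0 : 0 < #|Jp| by rewrite card_gt0.
have n2 : 0 < 'C(n, 2) by rewrite bin_gt0; move: nm m2; clear; move: #|VF| => k; lia.
have C2 : 'C(n, 2) * 2 = n * n.-1 by rewrite -[2]/(2`!) bin_ffact ffactnS ffactn1.
have dg : 2 * (n.-2) ^_ (m - 2) <= d.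
  rewrite -(leq_pmul2r n2) c; apply: leq_trans (_ : 1 * n ^_ m <= _); last by rewrite leq_mul2r s0 orbT.
  have -> : n ^_ m = 'C(n, 2) * 2 * (n.-2) ^_ (m - 2).
    have mE : (m - 2).+2 = m by move: m2; clear; move: #|VF| => k; lia.
    by rewrite -{1}mE !ffactnS mulnA C2.
  by rewrite mul1n leq_eqVlt; apply/orP; left; apply/eqP; ring.
have h : (n - m) ^ (m - 2) <= (n.-2) ^_ (m - 2).
  apply: leq_trans (ffact_ge _ _); rewrite (_ : n.-2 - (m - 2) = n - m) //.
  by move: m2 nm; clear; move: #|VF| => k; lia.
apply: leq_trans (_ : 2 ^ (m - 2) * (n - m) ^ (m - 2) <= _).
  rewrite -expnMn; have : 0 < m - 2 by rewrite subn_gt0.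
  move=> q0; rewrite leq_exp2r //; move: m2 nm; clear; move: #|VF| => k; lia.
apply: leq_mul; first by rewrite leq_exp2l // leq_subr.
by apply: leq_trans h _; apply: leq_trans dg; rewrite leq_pmull.
Qed.
End Regular.
End Counting.

Local Open Scope ring_scope.

(** * Packing the copies of a gadget *)

Section GadgetPacking.
Variables (VF : finType) (Jp : {set {set VF}}).
Hypothesis Jp2 : forall P, P \in Jp -> #|P| = 2%N.
Hypothesis Jp0 : Jp != set0.
Local Notation m := #|VF|.
Hypothesis m2 : (2 < m)%N.

(** There are at most of the order of [n ^ ((m - 2) * k + r)] sets with [k] copies, and [d] has
    order at least [n ^ (m - 2)]. Thus bad sets ([r = 1]) contribute O(n), negligible against the
    number of pairs, and conflicts ([r = 2]) contribute O(n^2), as [Lam] allows. *)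
Lemma sum_count (t r : nat) : (0 < r)%N -> exists K : nat, forall n d : nat,
  (0 < d)%N -> (0 < n)%N -> (n ^ (m - 2) <= 2 ^ m * d)%N ->
  \sum_(D : {set Emb VF n} | [&& D != set0, (#|D| <= t)%N & (#|VD D| <= (m - 2) * #|D| + r)%N])
    d%:R ^- #|D| <= K%:R * n%:R ^+ r :> rat.
Proof.
move=> r0; exists (\sum_(k < t.+1) 2 ^ (((m - 2) * k + r) ^ m) * (2 ^ m) ^ k)%N => n d d0 n0 nd.
have dR : 0 < d%:R :> rat by rewrite ltr0n.
have nR : 0 < n%:R :> rat by rewrite ltr0n.
rewrite (partition_big (fun D : {set Emb VF n} => inord #|D| : 'I_t.+1) predT) //= natr_sum mulr_suml.
apply: ler_sum => k _; set v := ((m - 2) * k + r)%N.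
apply: le_trans (_ : \sum_(D in [set D : {set Emb VF n} | (D != set0) && (#|VD D| <= v)%N]) d%:R ^- k <= _).
  rewrite big_mkcond [leRHS]big_mkcond /=; apply: ler_sum => D _; rewrite inE.
  case: ifP => [/andP[/and3P[-> Dt Dv] /eqP Dk]|_].
    have kD : k = #|D| :> nat by rewrite -Dk inordK // ltnS.
    by rewrite /v kD Dv.
  by case: ifP => // _; rewrite invr_ge0 exprn_ge0 // ltW.
rewrite sumr_const -[leLHS]mulr_natl.
have v0 : (0 < v)%N by rewrite /v addn_gt0 r0 orbT.
have h := @count_small VF m2 n v v0.
apply: le_trans (_ : (n ^ v * 2 ^ (v ^ m))%:R * d%:R ^- k <= _).
  by apply: ler_wpM2r; [rewrite invr_ge0 exprn_ge0 // ltW | rewrite ler_nat].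
rewrite ler_pdivrMr ?exprn_gt0 // !natrM !natrX.
have nk : (n%:R ^+ ((m - 2) * k) : rat) <= (2 ^+ m) ^+ k * d%:R ^+ k.
  rewrite -exprMn exprM; apply: lerXn2r.
  - by rewrite nnegrE exprn_ge0 // ltW.
  - by rewrite nnegrE mulr_ge0 ?exprn_ge0 // ltW.
  by rewrite -!natrX -natrM ler_nat.
have -> : (n%:R ^+ v : rat) = n%:R ^+ ((m - 2) * k) * n%:R ^+ r by rewrite -exprD.
set A := (2 ^+ (v ^ m))%R.
have -> : A * (2 ^+ m) ^+ k * n%:R ^+ r * d%:R ^+ k = ((2 ^+ m) ^+ k * d%:R ^+ k) * (n%:R ^+ r * A) by ring.
rewrite -[leLHS]mulrA; apply: ler_wpM2r => //.
by apply: mulr_ge0; rewrite exprn_ge0 // ltW.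
Qed.

Lemma bin_ge n : (1 < n)%N -> (n ^ 2 <= 4 * 'C(n, 2))%N.
Proof.
move=> n1; have C2 : ('C(n, 2) * 2 = n * n.-1)%N by rewrite -[X in (_ * X)%N]/(2`!) bin_ffact ffactnS ffactn1.
by move: ('C(n, 2)) C2 => c; rewrite expnS expn1; nia.
Qed.

Theorem gadget_packing (p eps : rat) : 0 <= p < 1 -> 0 < (1 - p) ^+ #|Jp| * p ^+ #|nJ Jp| -> 0 < eps <= 1 ->
  exists n0 : nat, forall n, (n0 <= n)%N -> exists Acc : {set Emb VF n},
  (1 - eps) * ((1 - p) * 'C(n, 2)%:R / #|Jp|%:R) <= #|Acc|%:R /\
  forall D : {set Emb VF n}, D \subset Acc -> (1 < #|D| <= 7)%N ->
    ((m - 2) * #|D| + 2 <= #|VD D|)%N /\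
    (#|VD D| = ((m - 2) * #|D| + 2)%N -> exists (e g : Emb VF n) (P Q : {set VF}),
      [/\ e \in D, g \in D, e != g, #|P| = 2%N /\ #|Q| = 2%N & [/\ P \notin Jp, Q \notin Jp & im e P = im g Q]]).
Proof.
move=> p01 y0 eps01.
have s0 : (0 < #|Jp|)%N by rewrite card_gt0.
(* 21 is three times the maximal size 7 of a conflict: unions of three configurations have to be
   counted. *)
have [K1 hK1] := @sum_count 21 1 isT.
have [K2 hK2] := @sum_count 7 2 isT.
pose Lam : rat := (4 * K2)%:R.
have [eta et0 H] := @packing rat #|Jp| 7 #|nJ Jp| p Lam eps s0 isT p01 y0 (ler0n _ _) eps01.
have [n1 hn1] := exists_nat_gt ((4 * K1)%:R / eta).
have [n2 hn2] := exists_nat_gt ((2 ^ m)%:R / eta).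
exists (2 * m + n1 + n2)%N => n hn.
have nm : (2 * m <= n)%N by apply: leq_trans hn; rewrite -addnA leq_addr.
have nn1 : (n1 <= n)%N by apply: leq_trans hn; rewrite addnAC leq_addl.
have nn2 : (n2 <= n)%N by apply: leq_trans hn; rewrite leq_addl.
have n2' : (1 < n)%N by move: nm m2; clear; move: #|VF| => k; lia.
have n0 : (0 < n)%N by apply: ltnW.
have X0 : (0 < #|{: Prs n}|)%N by rewrite card_Prs bin_gt0.
have /card_gt0P[x0 _] := X0.
pose d := #|[set e | x0 \in bdf Jp e]|.
have dn : (n ^ (m - 2) <= 2 ^ m * d)%N := @deg_ge VF Jp Jp2 Jp0 m2 n x0 nm.
have nR : 0 < n%:R :> rat by rewrite ltr0n.
have d0 : (0 < d)%N.
  rewrite lt0n; apply/eqP => h; move: dn; rewrite h muln0 leqn0 expn_eq0.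
  by move: n0; case: (n).
have dR : 0 < d%:R :> rat by rewrite ltr0n.
have nC : n%:R ^+ 2 <= 4 * 'C(n, 2)%:R :> rat.
  by rewrite -natrX -(natrM _ 4) ler_nat; apply: bin_ge.
have d_eta : d%:R^-1 <= eta.
  rewrite invf_ple ?posrE //.
  have h1 : (2 ^ m)%:R / eta <= (2 ^ m * d)%:R :> rat.
    apply: le_trans hn2 _; rewrite ler_nat; apply: leq_trans nn2 _; apply: leq_trans dn.
    have -> : (m - 2 = (m - 3).+1)%N by move: m2; clear; move: #|VF| => k; lia.
    by rewrite expnS leq_pmulr // expn_gt0 n0.
  by move: h1; rewrite natrM ler_pM2l // ltr0n expn_gt0.
have XE : #|{: Prs n}|%:R = 'C(n, 2)%:R :> rat by rewrite card_Prs.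
have hb : \sum_(D : {set Emb VF n} | badf D && (#|D| <= 3 * 7)%N) d%:R ^- #|D| <= eta * #|{: Prs n}|%:R.
  apply: le_trans (_ : (K1)%:R * n%:R ^+ 1 <= _).
    apply: le_trans (hK1 n d d0 n0 dn).
    rewrite le_eqVlt; apply/orP; left; apply/eqP/eq_bigl => D.
    by rewrite /badf -andbA; congr (_ && _); rewrite andbC.
  have hK : (4 * K1)%:R <= eta * n%:R :> rat.
    rewrite mulrC -ler_pdivrMr //; apply: le_trans hn1 _; by rewrite ler_nat.
  rewrite XE expr1; have h1 : eta * n%:R ^+ 2 <= eta * (4 * 'C(n, 2)%:R) by apply: ler_wpM2l => //; exact: ltW.
  have h2 : (4 * K1)%:R * n%:R <= eta * n%:R * n%:R :> rat by apply: ler_wpM2r => //; exact: ltW.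
  have four : 0 < 4 :> rat by [].
  rewrite -(ler_pM2l four) mulrA -natrM [leRHS]mulrCA; apply: le_trans h1; apply: le_trans h2 _.
  by rewrite expr2 mulrA.
have hc : \sum_(C in Conff VF n) d%:R ^- #|C| <= Lam * #|{: Prs n}|%:R.
  apply: le_trans (_ : (K2)%:R * n%:R ^+ 2 <= _).
    apply: le_trans (hK2 n d d0 n0 dn).
    apply: sum_sub_le => [C|C]; last by rewrite invr_ge0 exprn_ge0 // ltW.
    rewrite inE => /and3P[/andP[h1 h2] h3 _]; rewrite h2 h3 -card_gt0 !andbT.
    exact: leq_trans h1.
  rewrite XE /Lam natrM mulrAC -mulrA mulrCA; rewrite [leRHS](_ : _ = (K2)%:R * (4 * 'C(n, 2)%:R)); last by ring.
  exact: ler_wpM2l.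
have [Acc [Hs [hA hd hH hC hB]]] := H (Prs n) (Emb VF n) (bdf Jp (n:=n)) (hhf Jp (n:=n)) (Conff VF n) (@badf VF n) d d0 X0
  (card_bd Jp2 (n:=n)) (card_hh Jp (n:=n)) (bd_hh_dis Jp (n:=n)) (fun x => deg_eq Jp x x0)
  (@conf_cardf VF n) (@conf_disf VF Jp m2 n) (@bad_neq0 VF n) (@badA1 VF Jp m2 n) (@badA2 VF Jp m2 n)
  (@badA3 VF Jp m2 n) (@badA4 VF Jp m2 n) d_eta hb hc.
exists Acc; split; first by rewrite -XE.
move=> D DA /andP[D1 D7].
have D0 : D != set0 by rewrite -card_gt0 ltnW.
have nb (D' : {set Emb VF n}) : D' \subset D -> ~~ badf D'.
  move=> D'D; apply/negP => b; have D'J : (#|D'| <= 3 * 7)%N.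
    by apply: leq_trans (subset_leq_card D'D) _; apply: leq_trans D7 _.
  by move: (hB D' b D'J); rewrite (subset_trans D'D DA).
have lo (D' : {set Emb VF n}) : D' \subset D -> D' != set0 -> ((m - 2) * #|D'| + 2 <= #|VD D'|)%N.
  by move=> s D'0; have := nb D' s; rewrite /badf D'0 /= -ltnNge addn1 addn2.
split; first exact: lo.
(* A minimal tight subset with three or more copies is a conflict, which the packing avoids; so it
   consists of two copies with exactly two common vertices. *)
move=> DE; pose tight := fun D' : {set Emb VF n} => (1 < #|D'|)%N && (#|VD D'| <= (m - 2) * #|D'| + 2)%N.
have tD : tight D by rewrite /tight D1 DE leqnn.
have [C /minsetP[/andP[C1 Ct] Cm] CD] := minset_exists tD.
have CA : C \subset Acc := subset_trans CD DA.
have C0 : C != set0 by rewrite -card_gt0 ltnW.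
case: (ltnP 2 #|C|) => C3.
  have CC : C \in Conff VF n.
    rewrite inE C3 Ct (leq_trans (subset_leq_card CD) D7) /=; apply/forallP => D'.
    apply/implyP => D'C; apply/implyP => D'1; rewrite addn3 ltnNge -addn2; apply/negP => h.
    have /properP[sub [y yC yD']] := D'C.
    have tD' : tight D' by rewrite /tight D'1.
    by move: yD'; rewrite (Cm D' tD' sub) yC.
  by case/negP: (hC C CC).
have /cards2P[e [g [eg CE]]] : #|C| == 2%N by rewrite eqn_leq C3.
have eC : e \in C by rewrite CE !inE eqxx.
have gC : g \in C by rewrite CE !inE eqxx orbT.
have eA := subsetP CA e eC; have gA := subsetP CA g gC.
have I2 : #|Ve e :&: Ve g| == 2%N.
  have := lo C CD C0; move: Ct; rewrite CE card_pair //; have := card_VD2 e g; move: m2; clear.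
  move: #|VD [set e; g]| #|Ve e :&: Ve g| #|VF| => a1 a2 a3; lia.
pose x : Prs n := exist _ (Ve e :&: Ve g) I2.
have xe : x \in bdf Jp e :|: hhf Jp e by rewrite bd_hh_E subsetIl.
have xg : x \in bdf Jp g :|: hhf Jp g by rewrite bd_hh_E subsetIr.
(* The common pair is covered by neither copy: the other one would have to cover it too, against
   disjointness, or to have it in the reserved set, which covered pairs avoid. *)
have hh (a c : Emb VF n) : a \in Acc -> c \in Acc -> a != c -> x \in bdf Jp a :|: hhf Jp a ->
    x \in bdf Jp c :|: hhf Jp c -> x \in hhf Jp a.
  move=> aA cA ac; rewrite !in_setU => /orP[xa|//] /orP[xc|xc].
    by have := hd a c aA cA ac; rewrite disjoint_subset => /subsetP/(_ x xa); rewrite inE xc.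
  have [h1 _] := hH a aA; have [_ h2] := hH c cA.
  by move: h1; rewrite disjoint_subset => /subsetP/(_ x xa); rewrite inE (subsetP h2).
have ge : g != e by rewrite eq_sym.
have := hh e g eA gA eg xe xg; rewrite inE => /existsP[P /and3P[/eqP P2 PJ /eqP Pe]].
have := hh g e gA eA ge xg xe; rewrite inE => /existsP[Q /and3P[/eqP Q2 QJ /eqP Qe]].
exists e, g, P, Q; split => //; rewrite ?(subsetP CD) //; split => //.
by rewrite -Pe -Qe.
Qed.
End GadgetPacking.

End Copies.

(** * The gadget for k = 5 and k = 7 *)
Module Squares.
Import mathcomp.algebra_tactics.ring mathcomp.algebra_tactics.lra.
Import Order.TTheory GRing.Theory Num.Theory.

Section Squares.
Variable p : nat.
Hypothesis p_pr : prime p.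
Local Notation F := 'F_p.
Local Notation F2 := (F * F)%type.

(* An incident pair (P, l) in the affine plane over F_p is encoded as (x, a, b), with
   [l] the line y = a x + b and [P] its point of abscissa x. *)
Definition Inc := (F * F * F)%type.
Definition Gp := ({ffun F2 -> 'Z_3} * {ffun F2 -> 'Z_3})%type.
Definition pt (i : Inc) : F2 := (i.1.1, i.1.2 * i.1.1 + i.2)%R.
Definition ln (i : Inc) : F2 := (i.1.2, i.2).
(** Coefficients modulo 3 instead of 2 keep [dl u + dl u] nonzero, so the sum of two basis vectors
    determines both, even if they are equal. *)
Definition dl (u : F2) : {ffun F2 -> 'Z_3} := [ffun v => ((v == u) : nat)%:R]%R.

Lemma dl_inj : injective dl.
Proof.
move=> u v /ffunP/(_ u); rewrite !ffunE eqxx; case: eqP => [->//|_].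
by move=> /eqP.
Qed.

Lemma dl_sum a b c d : (dl a + dl b = dl c + dl d)%R -> (a = c /\ b = d) \/ (a = d /\ b = c).
Proof.
move=> h; case: (eqVneq a c) => [ac|ac].
  by left; split => //; move: h; rewrite ac => /addrI/dl_inj.
case: (eqVneq a d) => [ad|ad].
  by right; split => //; move: h; rewrite ad [RHS]addrC => /addrI/dl_inj.
move/ffunP/(_ a): h; rewrite !ffunE eqxx (negbTE ac) (negbTE ad).
by case: (a == b) => /eqP.
Qed.

Lemma ptln_inj i j : pt i = pt j -> ln i = ln j -> i = j.
Proof. by case: i => [[s m] c]; case: j => [[s' m'] c'] /= [-> _] [-> ->]. Qed.

Lemma two_points (m c m' c' s s' : F) : (m * s + c = m' * s + c')%R -> (m * s' + c = m' * s' + c')%R ->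
  s = s' \/ m = m' /\ c = c'.
Proof.
move=> h h'; case: (eqVneq m m') => [mm|mm].
  by right; split => //; move: h; rewrite mm => /addrI.
left; have : ((m - m') * (s - s') = 0)%R.
  have -> : ((m - m') * (s - s') = (m * s + c) - (m' * s + c') - ((m * s' + c) - (m' * s' + c')))%R by ring.
  by rewrite h h' !subrr.
by move/eqP; rewrite mulf_eq0 !subr_eq0 (negbTE mm) /= => /eqP.
Qed.

(** Two points incident with the same two lines: either the points or the lines coincide. *)
Lemma rectangle i1 i2 i3 i4 : pt i1 = pt i2 -> pt i3 = pt i4 -> ln i1 = ln i4 -> ln i3 = ln i2 ->
  pt i1 = pt i3 \/ ln i1 = ln i2.
Proof.
case: i1 => [[s1 m1] c1]; case: i2 => [[s2 m2] c2]; case: i3 => [[s3 m3] c3]; case: i4 => [[s4 m4] c4].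
rewrite /pt /ln /= => /pair_equal_spec[e1 h1] /pair_equal_spec[e3 h2] /pair_equal_spec[e4 f4] /pair_equal_spec[e5 f5]; subst s2 s4 m4 c4 m3 c3.
have [->|[-> ->]] := two_points h1 (esym h2); last by right.
by left; rewrite h2.
Qed.

(** Incident pairs form a Sidon-type set. Points and lines can be matched independently by [dl_sum];
    when the matchings agree the incidences are equal, and when they differ they form a
    [rectangle]. *)
Lemma sidon i1 i2 i3 i4 :
  (dl (pt i1) + dl (pt i3) = dl (pt i2) + dl (pt i4))%R ->
  (dl (ln i1) + dl (ln i3) = dl (ln i2) + dl (ln i4))%R -> i1 = i2 \/ i1 = i4.
Proof.
move=> /dl_sum[[P12 P34]|[P14 P32]] /dl_sum[[l12 l34]|[l14 l32]].
- by left; apply: ptln_inj.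
- have [P13|l12] := rectangle P12 P34 l14 l32.
    by right; apply: ptln_inj => //; rewrite P13.
  by left; apply: ptln_inj.
- have [P13|l14] := rectangle P14 P32 l12 l34.
    by left; apply: ptln_inj => //; rewrite P13.
  by right; apply: ptln_inj.
- by right; apply: ptln_inj.
Qed.

(* A square [(g, (P, l))] has two private vertices and one vertex in each of four copies
   [(t, e)] of [Gp]: the elements g and g + P + l in the copies with t = 0, and g + P and
   g + l in those with t = 1, where P and l stand for the basis vectors indexed by them.
   For each t, these two vertices form an edge, and as two points lie on at most one line,
   the bipartite graph of these edges contains no 4-cycle. *)
Definition Sq := (Gp * Inc)%type.
Definition VS := (Sq * bool + Gp * (bool * bool))%type.
Definition Bk := (Sq * bool)%type.

Definition wv (t e : bool) (Q : Sq) : Gp :=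
  (Q.1.1 + (if t (+) e then dl (pt Q.2) else 0), Q.1.2 + (if e then dl (ln Q.2) else 0))%R.

Definition ed1 (B : Bk) : {set VS} := [set inl (B.1, false); inr (wv B.2 false B.1, (B.2, false))].
Definition ed2 (B : Bk) : {set VS} := [set inl (B.1, true); inr (wv B.2 true B.1, (B.2, true))].
Definition bs (B : Bk) : {set VS} := ed1 B :|: ed2 B.
Definition six (Q : Sq) : {set VS} := bs (Q, false) :|: bs (Q, true).
Definition Jp : {set {set VS}} := [set P : {set VS} | (#|P| == 2) && [exists Q, P \subset six Q]].

Lemma add4 (V : zmodType) (a b x y z w : V) : (a + x = b + w -> b + y = a + z -> x + y = z + w)%R.
Proof.
by move=> h1 h2; apply: (@addrI _ (a + b)%R); rewrite addrACA h1 h2 addrACA [(b + a)%R]addrC [(w + z)%R]addrC.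
Qed.

(** Around a 4-cycle the base elements of the group cancel, leaving the relation excluded by [sidon]
    between the four incidences. *)
Lemma wv_C4 t Q1 Q2 Q3 Q4 : wv t false Q1 = wv t false Q2 -> wv t false Q3 = wv t false Q4 ->
  wv t true Q1 = wv t true Q4 -> wv t true Q3 = wv t true Q2 -> Q1 = Q2 \/ Q1 = Q4.
Proof.
case: Q1 => [[g1 h1] i1]; case: Q2 => [[g2 h2] i2]; case: Q3 => [[g3 h3] i3]; case: Q4 => [[g4 h4] i4].
rewrite /wv /= !addr0 => /pair_equal_spec[a1 b1] /pair_equal_spec[a2 b2] /pair_equal_spec[a3 b3] /pair_equal_spec[a4 b4]; subst h2 h4.
have Hl : (dl (ln i1) + dl (ln i3) = dl (ln i2) + dl (ln i4))%R := add4 b3 b4.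
have Hp : (dl (pt i1) + dl (pt i3) = dl (pt i2) + dl (pt i4))%R.
  case: t a1 a2 a3 a4 => /=; rewrite ?addr0 => a1 a2 a3 a4.
    by subst g4 g2; rewrite (add4 a1 a2) addrC.
  by subst g2 g4; exact: add4 a3 a4.
have [ii|ii] := sidon Hp Hl.
  left; subst i2; congr (_, _, _).
  by case: t a1 a2 a3 a4 => /=; rewrite ?addr0 => a1 a2 a3 a4; [move: a1 => /addIr|].
right; subst i4; congr (_, _, _); last by move: b3 => /addIr.
by case: t a1 a2 a3 a4 => /=; rewrite ?addr0 => a1 a2 a3 a4; [|move: a3 => /addIr].
Qed.

Lemma wv_inj t Q Q' : wv t false Q = wv t false Q' -> wv t true Q = wv t true Q' -> Q = Q'.
Proof. by move=> h h'; have [] := @wv_C4 t Q Q' Q' Q' h erefl h' erefl. Qed.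

(** A bipartite graph with sides l and r has at most l * r edges. If l + r is at most 4 and at most
    the number of edges, the graph is the complete one with l = r = 2, a 4-cycle. *)
Lemma edges_span t (S : {set Sq}) : S != set0 ->
  minn #|S| 4 + 1 <= #|[set wv t false Q | Q in S]| + #|[set wv t true Q | Q in S]|.
Proof.
move=> S0; set L := imset _ _; set Rr := imset _ _.
pose f Q := (wv t false Q, wv t true Q).
have fi : injective f by move=> Q Q' /pair_equal_spec[h h']; apply: wv_inj h h'.
have sub : [set f Q | Q in S] \subset setX L Rr.
  by apply/subsetP => q /imsetP[Q QS ->]; rewrite in_setX !imset_f.
have c : #|S| <= #|L| * #|Rr| by rewrite -cardsX -(card_imset (mem S) fi) subset_leq_card.
have [Q0 Q0S] := set0Pn _ S0.
have L0 : 0 < #|L| by apply/card_gt0P; exists (wv t false Q0); apply: imset_f.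
have R0 : 0 < #|Rr| by apply/card_gt0P; exists (wv t true Q0); apply: imset_f.
have S1 : 0 < #|S| by apply/card_gt0P; exists Q0.
rewrite leqNgt; apply/negP => h.
have /and3P[L2 R2 S4] : [&& #|L| == 2, #|Rr| == 2 & 4 <= #|S|].
  move: c L0 R0 S1 h; clear; move: #|L| #|Rr| #|S| => l r q c L0 R0 S1 h.
  have h' : l + r <= minn q 4 by move: h; rewrite addn1 ltnS.
  have lr := leq_trans h' (geq_minr q 4); have hq := leq_trans h' (geq_minl q 4).
  clear h h'; case: l c L0 lr hq => [|[|[|[|l]]]] //; case: r R0 => [|[|[|[|r]]]] //; move=> *; lia.
have full : [set f Q | Q in S] = setX L Rr.
  apply/eqP; rewrite eqEcard sub cardsX (eqP L2) (eqP R2) card_imset //.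
have /cards2P[l1 [l2 [ll LE]]] := L2; have /cards2P[r1 [r2 [rr RE]]] := R2.
have ex l r : l \in L -> r \in Rr -> exists Q, wv t false Q = l /\ wv t true Q = r.
  move=> lL rR; have : (l, r) \in setX L Rr by rewrite in_setX lL.
  by rewrite -full => /imsetP[Q _ /pair_equal_spec[-> ->]]; exists Q.
have m1 : l1 \in L by rewrite LE !inE eqxx.
have m2 : l2 \in L by rewrite LE !inE eqxx orbT.
have n1 : r1 \in Rr by rewrite RE !inE eqxx.
have n2 : r2 \in Rr by rewrite RE !inE eqxx orbT.
have [Q1 [a1 b1]] := ex l1 r1 m1 n1; have [Q2 [a2 b2]] := ex l1 r2 m1 n2.
have [Q3 [a3 b3]] := ex l2 r2 m2 n2; have [Q4 [a4 b4]] := ex l2 r1 m2 n1.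
have [Q12|Q14] := @wv_C4 t Q1 Q2 Q3 Q4 (etrans a1 (esym a2)) (etrans a3 (esym a4))
   (etrans b1 (esym b4)) (etrans b3 (esym b2)).
  by move: rr; rewrite -b1 -b2 Q12 eqxx.
by move: ll; rewrite -a1 -a4 Q14 eqxx.
Qed.

Definition cl (v : VS) : option (bool * bool) := if v is inr w then Some w.2 else None.

(** The vertices are counted by class: two private ones for each of the [q] squares and, for each
    [t], those of the edges of the blocks of type [t]. *)
Lemma span_ge (S : {set Bk}) (q := #|[set B.1 | B in S]|)
  (s0 := #|[set Q | (Q, false) \in S]|) (s1 := #|[set Q | (Q, true) \in S]|) :
  [/\ 2 * q + (if s0 == 0 then 0 else minn s0 4 + 1) + (if s1 == 0 then 0 else minn s1 4 + 1)
      <= #|\bigcup_(B in S) bs B|, s0 <= q, s1 <= q & s0 + s1 = #|S|].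
Proof.
pose U := \bigcup_(B in S) bs B; pose St t := [set Q | (Q, t) \in S].
have qle t : #|St t| <= q.
  apply/subset_leq_card/subsetP => Q; rewrite inE => QS.
  by apply/imsetP; exists (Q, t).
have cS : s0 + s1 = #|S|.
  have inj (t : bool) : injective (fun Q : Sq => (Q, t)) by move=> Q Q' /pair_equal_spec[].
  rewrite /s0 /s1 -(card_imset _ (inj false)) -(card_imset _ (inj true)) -cardsUI.
  have -> : [set (Q, false) | Q in [set Q | (Q, false) \in S]] :&: [set (Q, true) | Q in [set Q | (Q, true) \in S]] = set0.
    by apply/setP => B; rewrite !inE; apply/negP => /andP[/imsetP[Q _ ->] /imsetP[Q' _ /pair_equal_spec[]]].
  rewrite cards0 addn0.
  congr #|pred_of_set _|; apply/setP => -[Q t]; rewrite !inE; apply/orP/idP => [[]/imsetP[Q' + ->]|QS].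
  - by rewrite inE.
  - by rewrite inE.
  by case: t QS => QS; [right|left]; apply/imsetP; exists Q; rewrite ?inE.
have cU : #|U| = \sum_(k : option (bool * bool)) #|[set v in U | cl v == k]|.
  rewrite -sum1_card (partition_big cl predT) //=; apply: eq_bigr => k _.
  by rewrite -sum1_card; apply: eq_bigl => v; rewrite inE.
have cN : 2 * q <= #|[set v in U | cl v == None]|.
  have inj : injective (@inl (Sq * bool) (Gp * (bool * bool))) by move=> ? ? [].
  have -> : 2 * q = #|[set (inl x : VS) | x in setX [set B.1 | B in S] [set: bool]]|.
    by rewrite (card_imset _ inj) cardsX cardsT card_bool mulnC.
  apply/subset_leq_card/subsetP => v /imsetP[[Q c]]; rewrite in_setX => /andP[/imsetP[B BS /= ->] _] ->.
  rewrite inE andbT; apply/bigcupP; exists B => //; rewrite !inE.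
  by case: c; rewrite eqxx ?orbT.
have cw t e : #|[set wv t e Q | Q in St t]| <= #|[set v in U | cl v == Some (t, e)]|.
  have inj : injective (fun g : Gp => (inr (g, (t, e)) : VS)) by move=> g g' [].
  rewrite -(card_imset _ inj); apply/subset_leq_card/subsetP => v /imsetP[g /imsetP[Q]].
  rewrite inE => QS -> ->; rewrite inE eqxx andbT; apply/bigcupP; exists (Q, t) => //.
  by rewrite !inE /=; clear inj; case: e; rewrite eqxx ?orbT.
have cs t : (if #|St t| == 0 then 0 else minn #|St t| 4 + 1) <=
    #|[set v in U | cl v == Some (t, false)]| + #|[set v in U | cl v == Some (t, true)]|.
  case: ifP => // /negbT; rewrite cards_eq0 => h; apply: leq_trans (edges_span t h) _.
  exact: leq_add.
split; [|exact: (qle false)|exact: (qle true)|exact: cS].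
have -> : #|\bigcup_(B in S) bs B| = \sum_(k : option (bool * bool)) #|[set v in U | cl v == k]| := cU.
rewrite (bigD1 None) //= (bigD1 (Some (false, false))) //= (bigD1 (Some (false, true))) //=.
rewrite (bigD1 (Some (true, false))) //= (bigD1 (Some (true, true))) //=.
have := cs false; have := cs true; rewrite -/s0 -/s1; move: cN; clear.
move: #|[set v in U | _ == None]| #|[set v in U | _ == Some (false, false)]| #|[set v in U | _ == Some (false, true)]|
  #|[set v in U | _ == Some (true, false)]| #|[set v in U | _ == Some (true, true)]| => a b c d e.
by rewrite -/s0 -/s1; set x := if _ then _ else _; set y := if _ then _ else _; lia.
Qed.

(** Parity enters here. The bound [2 * s + 2] can be reached with [s0 = s1 = q]; for odd [s] the
    larger of [s0], [s1] forces [2 * q] to be at least [s + 1]. The cap 4 in [minn] is harmless up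
    to [s = 7]. *)
Lemma span_arith q s0 s1 s u :
  2 * q + (if s0 == 0 then 0 else minn s0 4 + 1) + (if s1 == 0 then 0 else minn s1 4 + 1) <= u ->
  s0 <= q -> s1 <= q -> s0 + s1 = s ->
  [/\ 0 < s <= 7 -> 2 * s + 2 <= u, s = 5 \/ s = 7 -> 2 * s + 3 <= u &
      0 < s <= 3 -> u = 2 * s + 2 -> q = 1].
Proof.
move=> h h0 h1 hs; split; case: eqP h => a; case: eqP => b h; lia.
Qed.

Lemma span_F1 (S : {set Bk}) : S != set0 -> #|S| <= 7 -> 2 * #|S| + 2 <= #|\bigcup_(B in S) bs B|.
Proof.
rewrite -card_gt0 => h1 h2; have [a b c d] := span_ge S.
by have [h _ _] := span_arith a b c d; apply: h; rewrite h1.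
Qed.

Lemma span_F2 (S : {set Bk}) : #|S| = 5 \/ #|S| = 7 -> 2 * #|S| + 3 <= #|\bigcup_(B in S) bs B|.
Proof.
have [a b c d] := span_ge S.
by have [_ h _] := span_arith a b c d.
Qed.

Lemma span_F3 (S : {set Bk}) (P : {set VS}) : #|S| <= 3 -> #|\bigcup_(B in S) bs B| = 2 * #|S| + 2 ->
  P \subset \bigcup_(B in S) bs B -> #|P| = 2 -> P \in Jp.
Proof.
move=> S3 SE sub P2.
have q1 : #|[set B.1 | B in S]| = 1.
  have [a b c d] := span_ge S; have [_ _ h] := span_arith a b c d; apply: h => //.
  rewrite S3 andbT card_gt0; apply/eqP => S0.
  by move: SE; rewrite S0 big_set0 !cards0.
have /cards1P[Q QE] : #|[set B.1 | B in S]| == 1 by apply/eqP.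
rewrite inE P2 /=; apply/existsP; exists Q; apply: subset_trans sub _; apply/bigcupsP => B BS.
have : B.1 \in [set Q] by rewrite -QE; apply: imset_f.
by rewrite inE => /eqP <-; rewrite /six; case: (B) => Q' [] /=; rewrite ?subsetUr ?subsetUl.
Qed.

Lemma Jp2 P : P \in Jp -> #|P| = 2.
Proof. by rewrite inE => /andP[/eqP]. Qed.

Lemma ed_Jp B : ed1 B \in Jp /\ ed2 B \in Jp.
Proof.
have c (x y : VS) : x != y -> #|[set x; y]| == 2 by move=> h; rewrite cards2 h.
case: B => Q t; split; rewrite inE c //=; apply/existsP; exists Q; rewrite /six /bs.
  by case: t; [apply: subset_trans (subsetUr _ _) | apply: subset_trans (subsetUl _ _)]; apply: subsetUl.
by case: t; [apply: subset_trans (subsetUr _ _) | apply: subset_trans (subsetUl _ _)]; apply: subsetUr.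
Qed.

Lemma ed1_inj : injective ed1.
Proof.
move=> [Q t] [Q' t'] h; have : inl (Q, false) \in ed1 (Q', t') by rewrite -h !inE eqxx.
rewrite !inE orbF => /eqP[->]; congr pair.
have : inr (wv t false Q, (t, false)) \in ed1 (Q', t') by rewrite -h !inE eqxx orbT.
by rewrite !inE => /eqP[].
Qed.

Lemma ed2_inj : injective ed2.
Proof.
move=> [Q t] [Q' t'] h; have : inl (Q, true) \in ed2 (Q', t') by rewrite -h !inE eqxx.
rewrite !inE orbF => /eqP[->]; congr pair.
have : inr (wv t true Q, (t, true)) \in ed2 (Q', t') by rewrite -h !inE eqxx orbT.
by rewrite !inE => /eqP[].
Qed.

Lemma ed1_ed2 B B' : ed1 B != ed2 B'.
Proof.
apply/eqP => h; have : inl (B.1, false) \in ed2 B' by rewrite -h !inE eqxx.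
by rewrite !inE orbF => /eqP[].
Qed.

Lemma card_bs B : #|bs B| = 4.
Proof.
rewrite cardsU !cards2 /= (_ : _ :&: _ = set0) ?cards0 //.
apply/setP => v; rewrite !inE; apply/negP => /andP[/orP[]/eqP -> /orP[]/eqP //].
Qed.

Lemma card_Bk : #|{: Bk}| = 2 * #|{: Sq}|.
Proof. by rewrite card_prod card_bool mulnC. Qed.

(* Nine of the fifteen pairs of a square meet its private vertices and two more
   are determined by it; the remaining four are shared by about [p] squares. *)
Lemma card_Jp : p * #|Jp| <= (11 * p + 4) * #|{: Sq}|.
Proof.
pose fW (k : bool * (bool * bool)) (Q : Sq) : {set VS} := [set inl (Q, k.1); inr (wv k.2.1 k.2.2 Q, k.2)].
pose fT (t : bool) (Q : Sq) : {set VS} := [set inr (wv t false Q, (t, false)); inr (wv t true Q, (t, true))].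
pose f0 (Q : Sq) : {set VS} := [set inl (Q, false); inl (Q, true)].
(* A pair between the copies with [t = 0] and [t = 1] differs by a point or by a line alone, so it
   is encoded by a group element and one of p^2 translations, whereas a square needs one of p^3
   incidences. *)
pose sft (b : bool) (u : F2) : Gp := if b then (dl u, 0)%R else (0, dl u)%R.
pose fX (k : bool * bool) (q : Gp * F2) : {set VS} :=
  [set inr ((if k.1 then q.1 + sft (k.1 == k.2) q.2 else q.1)%R, (false, k.1));
       inr ((if k.1 then q.1 else q.1 + sft (k.1 == k.2) q.2)%R, (true, k.2))].
pose I0 := [set f0 Q | Q in [set: Sq]].
pose IW := [set fW q.1 q.2 | q in [set: (bool * (bool * bool)) * Sq]].
pose IT := [set fT q.1 q.2 | q in [set: bool * Sq]].
pose IX := [set fX q.1 q.2 | q in [set: (bool * bool) * (Gp * F2)]].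
have sub : Jp \subset I0 :|: IW :|: IT :|: IX.
  apply/subsetP => P; rewrite inE => /andP[/cards2P[y [z [yz ->]]] /existsP[Q]].
  rewrite subUset !sub1set => /andP[yQ zQ].
  have cas v : v \in six Q -> (exists c, v = inl (Q, c)) \/ (exists t e, v = inr (wv t e Q, (t, e))).
    rewrite !inE /= -!orbA; do 7! (case/predU1P => [->|]; first by [left; eexists | right; do 2 eexists]).
    by move/eqP ->; right; do 2 eexists.
  have W c t e : [set inl (Q, c); inr (wv t e Q, (t, e))] \in I0 :|: IW :|: IT :|: IX.
    have h : [set inl (Q, c); inr (wv t e Q, (t, e))] \in IW by apply/imsetP; exists ((c, (t, e)), Q).
    by rewrite !in_setU h orbT.
  have X e e' : [set inr (wv false e Q, (false, e)); inr (wv true e' Q, (true, e'))] \in I0 :|: IW :|: IT :|: IX.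
    have h : [set inr (wv false e Q, (false, e)); inr (wv true e' Q, (true, e'))] \in IX.
      apply/imsetP; exists ((e, e'), (if e then wv true e' Q else wv false false Q, if e == e' then pt Q.2 else ln Q.2)) => //.
      by case: e; case: e'; rewrite /fX /wv /sft /= ?addr0; congr [set inr (_, _); inr (_, _)]; congr pair; rewrite /= ?addr0.
    by rewrite !in_setU h !orbT.
  have T t : [set inr (wv t false Q, (t, false)); inr (wv t true Q, (t, true))] \in I0 :|: IW :|: IT :|: IX.
    have h : [set inr (wv t false Q, (t, false)); inr (wv t true Q, (t, true))] \in IT by apply/imsetP; exists (t, Q).
    by rewrite !in_setU h !orbT.
  have Z : [set inl (Q, false); inl (Q, true)] \in I0 :|: IW :|: IT :|: IX.
    have h : [set inl (Q, false); inl (Q, true)] \in I0 by apply/imsetP; exists Q.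
    by rewrite !in_setU h.
  case: (cas y yQ) (cas z zQ) yz => [[c ->]|[t [e ->]]] [[c' ->]|[t' [e' ->]]] yz.
  - by case: c c' yz => -[] //; rewrite ?eqxx // setUC.
  - exact: W.
  - by rewrite setUC; exact: W.
  - case: t t' yz => -[] yz; [|by rewrite setUC; exact: X|exact: X|].
      by case: e e' yz => -[] //; rewrite ?eqxx // setUC => _; exact: (T true).
    by case: e e' yz => -[] //; rewrite ?eqxx // setUC => _; exact: (T false).
have cB (A B : {set {set VS}}) a b : #|A| <= a -> #|B| <= b -> #|A :|: B| <= a + b.
  by move=> h1 h2; apply: leq_trans (leq_card_setU _ _) _; apply: leq_add.
have c0 : #|I0| <= #|{: Sq}| by apply: leq_trans (leq_imset_card _ _) _; rewrite cardsT.
have cW : #|IW| <= 8 * #|{: Sq}|.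
  by apply: leq_trans (leq_imset_card _ _) _; rewrite cardsT !card_prod !card_bool.
have cT : #|IT| <= 2 * #|{: Sq}|.
  by apply: leq_trans (leq_imset_card _ _) _; rewrite cardsT !card_prod !card_bool.
have cF : #|{: F}| = p by rewrite card_Fp.
have cX : p * #|IX| <= 4 * #|{: Sq}|.
  apply: leq_trans (_ : p * (4 * (#|{: Gp}| * (p * p))) <= _).
    by rewrite leq_mul2l; apply/orP; right; apply: leq_trans (leq_imset_card _ _) _; rewrite cardsT !card_prod !card_bool !cF.
  have -> : #|{: Sq}| = #|{: Gp}| * (p * p * p) by rewrite card_prod; congr (_ * _); rewrite !card_prod !cF.
  by rewrite leq_eqVlt; apply/orP; left; apply/eqP; ring.
have := leq_trans (subset_leq_card sub) (cB _ _ _ _ (cB _ _ _ _ (cB _ _ _ _ c0 cW) cT) (leqnn _)).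
move: cX; clear; move: #|IX| #|{: Sq}| #|Jp| => x s j h1 h2.
have : p * j <= p * (s + 8 * s + 2 * s + x) by rewrite leq_mul2l h2 orbT.
lia.
Qed.

End Squares.

End Squares.

(** * From packings to colourings *)
Module Colourings.
Import Copies.

Section Blocks.
Variables (VF Bk : finType) (Jp : {set {set VF}}) (d1 d2 : Bk -> {set VF}).
Local Notation m := #|VF|.
Local Notation bs B := (d1 B :|: d2 B).
Local Notation span S := (\bigcup_(B in S) bs B).
Variable k : nat.
Hypothesis m2 : 2 < m.
Hypothesis k7 : k <= 7.
Hypothesis F1 : forall S : {set Bk}, S != set0 -> #|S| <= 7 -> 2 * #|S| + 2 <= #|span S|.
Hypothesis F2 : forall S : {set Bk}, #|S| = k -> 2 * k + 3 <= #|span S|.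
Hypothesis F3 : forall (S : {set Bk}) (P : {set VF}), #|S| <= 3 -> #|span S| = 2 * #|S| + 2 ->
  P \subset span S -> #|P| = 2 -> P \in Jp.
Variables (n : nat) (Acc : {set Emb VF n}).
Hypothesis star : forall D : {set Emb VF n}, D \subset Acc -> 1 < #|D| <= 7 ->
    (m - 2) * #|D| + 2 <= #|VD D| /\
    (#|VD D| = (m - 2) * #|D| + 2 -> exists (e g : Emb VF n) (P Q : {set VF}),
      [/\ e \in D, g \in D, e != g, #|P| = 2 /\ #|Q| = 2 & [/\ P \notin Jp, Q \notin Jp & im e P = im g Q]]).

Local Notation T := (Emb VF n * Bk)%type.
Definition Blk : {set T} := [set t | t.1 \in Acc].
Definition D1 (t : T) := im t.1 (d1 t.2).
Definition D2 (t : T) := im t.1 (d2 t.2).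

Lemma imU (e : Emb VF n) P Q : im e (P :|: Q) = im e P :|: im e Q.
Proof. exact: imsetU. Qed.

Lemma sub_im (e : Emb VF n) P Q : (im e P \subset im e Q) = (P \subset Q).
Proof.
apply/subsetP/subsetP => h v.
  by move=> vP; have := h _ (imset_f _ vP); rewrite mem_imset //; apply: emb_inj.
by move=> /imsetP[x xP ->]; apply: imset_f; apply: h.
Qed.

Lemma im_span (e : Emb VF n) (S : {set Bk}) :
  im e (span S) = \bigcup_(B in S) (im e (d1 B) :|: im e (d2 B)).
Proof.
apply/setP => i; apply/imsetP/bigcupP => [[v /bigcupP[B BS vB] ->]|[B BS]].
  by exists B => //; rewrite -imU; apply: imset_f.
by rewrite -imU => /imsetP[v vB ->]; exists v => //; apply/bigcupP; exists B.
Qed.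

(** Vertices of the copies outside the chosen blocks are added back to reach the bound on whole
    copies. If [2 * k + 3] fails, all estimates are tight and two copies share an uncovered pair; by
    [F3] each then contains at least four of the blocks, more than [k] in total. *)
Lemma block_span (T' : {set T}) : T' \subset Blk -> #|T'| = k -> 0 < k ->
  2 * k + 3 <= #|\bigcup_(t in T') (D1 t :|: D2 t)|.
Proof.
move=> TB Tk k0.
pose D := [set t.1 | t in T']; pose S e := [set B | (e, B) \in T'].
pose sp e := im e (span (S e)); pose pv e := Ve e :\: sp e.
have TU : \bigcup_(t in T') (D1 t :|: D2 t) = \bigcup_(e in D) sp e.
  apply/setP => i; apply/bigcupP/bigcupP => [[[e B] tT it]|[e eD]].
    exists e; first by apply/imsetP; exists (e, B).
    by rewrite /sp im_span; apply/bigcupP; exists B; [rewrite inE | exact: it].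
  rewrite /sp im_span => /bigcupP[B]; rewrite inE => BT iB.
  by exists (e, B).
rewrite TU; set U := \bigcup_(e in D) _.
have DA : D \subset Acc.
  by apply/subsetP => e /imsetP[t tT ->]; have := subsetP TB t tT; rewrite inE.
have sumS : \sum_(e in D) #|S e| = k.
  rewrite -Tk -[RHS]sum1_card (partition_big (fun t : T => t.1) (mem D)) /=; last first.
    by move=> t tT; apply/imsetP; exists t.
  apply: eq_bigr => e eD; rewrite -sum1_card.
  rewrite (reindex_onto (fun B => (e, B)) snd) /=; last by move=> [e' B] /andP[_ /eqP /= ->].
  by apply: eq_bigl => B; rewrite inE !eqxx !andbT.
have S0 e : e \in D -> S e != set0.
  by move=> /imsetP[[e' B] tT ->]; apply/set0Pn; exists B; rewrite inE.
have Sk e : e \in D -> #|S e| <= k.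
  by move=> eD; rewrite -sumS (bigD1 e) //= leq_addr.
have card_sp e : #|sp e| = #|span (S e)| by rewrite card_im.
have spF1 e : e \in D -> 2 * #|S e| + 2 <= #|sp e|.
  by move=> eD; rewrite card_sp; apply: F1; [exact: S0 | exact: leq_trans (Sk e eD) k7].
have D0 : 0 < #|D|.
  by have /card_gt0P[t tT] : 0 < #|T'| by [rewrite Tk]; apply/card_gt0P; exists t.1; apply: imset_f.
have Dk : #|D| <= k by rewrite -Tk leq_imset_card.
case: (leqP #|D| 1) => [D1'|D1'].
  have /cards1P[e De] : #|D| == 1 by rewrite eqn_leq D1'.
  have SE : #|S e| = k by rewrite -sumS De big_set1.
  by rewrite /U De big_set1 card_sp; apply: F2.
have [lo eqc] := star DA (introT andP (conj D1' (leq_trans Dk k7))).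
have sp_pv e : #|pv e| + #|sp e| = m.
  by rewrite addnC -(card_Ve e) -(cardsID (sp e) (Ve e)) (setIidPr _) // im_sub.
have sumP : \sum_(e in D) #|pv e| + \sum_(e in D) #|sp e| = m * #|D|.
  by rewrite -big_split /= (eq_bigr (fun=> m)) => [|e _]; [rewrite sum_nat_const mulnC | exact: sp_pv].
have bigle (F : Emb VF n -> {set 'I_n}) : #|\bigcup_(e in D) F e| <= \sum_(e in D) #|F e|.
  apply: (big_ind2 (fun (A : {set 'I_n}) c => #|A| <= c)) => //; first by rewrite cards0.
  by move=> A a B b ha hb; apply: leq_trans (leq_card_setU _ _) _; apply: leq_add.
have VDU F : (forall e, e \in D -> pv e \subset (\bigcup_(h in D) F h) :|: U) -> #|VD D| <= #|U| + \sum_(e in D) #|F e|.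
  move=> hF; apply: leq_trans (_ : #|U :|: \bigcup_(e in D) F e| <= _).
    apply/subset_leq_card/bigcupsP => e eD; apply/subsetP => v vV.
    case: (boolP (v \in sp e)) => vs.
      by rewrite inE; apply/orP; left; apply/bigcupP; exists e.
    have /(subsetP (hF e eD)) : v \in pv e by rewrite inE vs.
    by rewrite setUC.
  by apply: leq_trans (leq_card_setU _ _) _; rewrite leq_add2l.
have VDle : #|VD D| <= #|U| + \sum_(e in D) #|pv e| by apply: VDU => e eD; apply: subset_trans (subsetUl _ _); apply: (bigcup_sup e).
have sumSp : 2 * k + 2 * #|D| <= \sum_(e in D) #|sp e|.
  rewrite -sumS big_distrr /= mulnC -sum_nat_const -big_split /=.
  by apply: leq_sum => e eD; exact: spF1.
have tot : (m - 2) * #|D| + 2 * #|D| = m * #|D| by rewrite -mulnDl subnK // ltnW.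
rewrite leqNgt; apply/negP => h.
(* Under the opposite assumption the lower bounds on [VD D] and on the spans leave no slack. *)
have [e1 e2 e3] : [/\ #|VD D| = (m - 2) * #|D| + 2, \sum_(e in D) #|sp e| = 2 * k + 2 * #|D| &
   #|VD D| = #|U| + \sum_(e in D) #|pv e|].
  move: lo sumP VDle sumSp tot h; clear.
  move: (m * #|D|) ((m - 2) * #|D|) #|VD D| #|U| (\sum_(e in D) #|pv e|) (\sum_(e in D) #|sp e|) #|D| => a b c u x y r.
  by split; lia.
have tight e : e \in D -> #|sp e| = 2 * #|S e| + 2.
  move=> eD; apply/eqP; rewrite eqn_leq spF1 // andbT leqNgt; apply/negP => hs.
  have : 2 * k + 2 * #|D| < \sum_(e in D) #|sp e|.
    rewrite -sumS big_distrr /= [2 * #|D|]mulnC -sum_nat_const -big_split /=.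
    rewrite (bigD1 e) //= [X in _ < X](bigD1 e) //= -addSn; apply: leq_add; first exact: hs.
    by apply: leq_sum => e' /andP[e'D _]; exact: spF1.
  by rewrite e2 ltnn.
(* Otherwise [v] could be omitted from the extra vertices of [e], being supplied by [g], and the
   count [e3] would improve. *)
have shared e g v : e \in D -> g \in D -> e != g -> v \in Ve e -> v \in Ve g -> v \in sp e.
  move=> eD gD eg ve vg; apply: contraT => vs.
  pose F h := if h == e then pv e :\ v else pv h.
  have : #|VD D| <= #|U| + \sum_(h in D) #|F h|.
    apply: VDU => z zD; apply/subsetP => w wh; rewrite inE.
    case: (eqVneq w v) => [->|wv].
      case: (boolP (v \in sp g)) => vsg.
        by apply/orP; right; apply/bigcupP; exists g.
      apply/orP; left; apply/bigcupP; exists g => //.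
      by rewrite /F eq_sym (negbTE eg) inE vsg.
    apply/orP; left; apply/bigcupP; exists z => //; rewrite /F.
    by case: eqP => [he|//]; rewrite !inE wv -he; move: wh; rewrite inE.
  rewrite e3 leq_add2l leqNgt => /negP; case.
  rewrite (bigD1 e) //= [X in _ < X](bigD1 e) //= -addSn; apply: leq_add.
    rewrite /F eqxx [X in _ < X](cardsD1 v).
    by rewrite inE vs ve.
  by apply: leq_sum => z /andP[_ /negbTE ze]; rewrite /F ze.
have [e [g [P [Q [eD gD eg [P2 Q2] [PJ QJ PQ]]]]]] := eqc e1.
have big (z z' : Emb VF n) (R R' : {set VF}) : z \in D -> z' \in D -> z != z' -> #|R| = 2 -> R \notin Jp -> im z R = im z' R' -> 3 < #|S z|.
  move=> hD h'D hh' R2 RJ RR; rewrite ltnNge; apply: contraNN RJ => S3.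
  apply: (F3 S3) => //; first by rewrite -card_sp tight.
  rewrite -(sub_im z); apply/subsetP => v vR; apply: (shared z z') => //.
    exact: (subsetP (im_sub z R)).
  by rewrite RR in vR; exact: (subsetP (im_sub z' R')).
have b1 := big e g P Q eD gD eg P2 PJ PQ.
have ge : g != e by rewrite eq_sym.
have b2 := big g e Q P gD eD ge Q2 QJ (esym PQ).
move: k7; rewrite -sumS (bigD1 e) //= (bigD1 g) /=; last by rewrite gD ge.
by move: b1 b2; clear; move: #|S e| #|S g| => x y; lia.
Qed.

Section Edges.
Hypothesis d1_J : forall B, d1 B \in Jp.
Hypothesis d2_J : forall B, d2 B \in Jp.
Hypothesis Jp2 : forall P, P \in Jp -> #|P| = 2.
Hypothesis d1_inj : injective d1.
Hypothesis d2_inj : injective d2.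
Hypothesis d12 : forall B B', d1 B != d2 B'.

(** Distinct copies with a common pair are tight, so this pair is their whole intersection. By
    [star] it must then be uncovered in both, contrary to the assumption on [P] and [Q]. *)
Lemma copies_share (e g : Emb VF n) P Q : e \in Acc -> g \in Acc -> P \in Jp -> Q \in Jp ->
  im e P = im g Q -> e = g.
Proof.
move=> eA gA PJ QJ PQ; apply/eqP; apply: contraT => eg.
have DA : [set e; g] \subset Acc by apply/subsetP => h /set2P[]->.
have := star DA; rewrite cards2 eg => /(_ isT)[lo eqc].
have c := card_VD2 e g; have sub : im e P \subset Ve e :&: Ve g.
  by rewrite subsetI im_sub PQ im_sub.
have c2 : #|im e P| = 2 by rewrite card_im Jp2.
have le2 := subset_leq_card sub; rewrite c2 in le2.
have [ve vi] : #|VD [set e; g]| = (m - 2) * 2 + 2 /\ #|Ve e :&: Ve g| = 2.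
  move: lo c le2 m2; clear; move: #|VD [set e; g]| #|Ve e :&: Ve g| #|VF| => a b c.
  by move=> *; split; lia.
have [e' [g' [P' [Q' [e'D g'D eg' [P2 Q2] [PJ' QJ' PQ']]]]]] := eqc ve.
have key (h h' : Emb VF n) (R R' : {set VF}) : Ve h :&: Ve h' = im e P -> #|R| = 2 -> im h R = im h' R' -> im h R = im e P.
  move=> hh R2 RR; apply/eqP; rewrite eqEcard c2 card_im R2 leqnn andbT -hh subsetI im_sub RR im_sub //.
have IE : Ve e :&: Ve g = im e P by apply/esym/eqP; rewrite eqEcard sub c2 vi.
case/set2P: e'D eg' PQ' => ->; case/set2P: g'D => ->; rewrite ?eqxx // => _ PQ'.
  by have /im_inj h := key e g P' Q' IE P2 PQ'; move: PJ'; rewrite h PJ.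
have IE' : Ve g :&: Ve e = im e P by rewrite setIC.
have h := key g e P' Q' IE' P2 PQ'; rewrite PQ in h; have {}h := im_inj h.
by move: PJ'; rewrite h QJ.
Qed.

Lemma D_facts : [/\ {in Blk, forall t, #|D1 t| = 2 /\ #|D2 t| = 2}, {in Blk &, injective D1},
  {in Blk &, injective D2} & {in Blk &, forall t t', D1 t != D2 t'}].
Proof.
split.
- by move=> t _; rewrite /D1 /D2 !card_im !Jp2.
- move=> [e B] [g B']; rewrite !inE /D1 /= => eA gA h; have eg := copies_share eA gA (d1_J _) (d1_J _) h.
  by subst g; rewrite (d1_inj (im_inj h)).
- move=> [e B] [g B']; rewrite !inE /D2 /= => eA gA h; have eg := copies_share eA gA (d2_J _) (d2_J _) h.
  by subst g; rewrite (d2_inj (im_inj h)).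
- move=> [e B] [g B']; rewrite !inE /D1 /D2 /= => eA gA; apply/eqP => h.
  have eg := copies_share eA gA (d1_J _) (d2_J _) h; subst g.
  by move: (d12 B B'); rewrite (im_inj h) eqxx.
Qed.

Lemma card_Blk : #|Blk| = #|Acc| * #|{: Bk}|.
Proof.
rewrite -cardsT -cardsX; apply: eq_card => -[e B]; rewrite !inE andbT //.
Qed.

End Edges.
End Blocks.

(** * The colouring defined by a family of blocks *)

Section Colouring.
Variables (n k : nat) (T : finType) (Bl : {set T}) (d1 d2 : T -> {set 'I_n}).
Hypothesis n2 : 1 < n.
Hypothesis k0 : 0 < k.
Hypothesis c12 : {in Bl, forall t, #|d1 t| = 2 /\ #|d2 t| = 2}.
Hypothesis i1 : {in Bl &, injective d1}.
Hypothesis i2 : {in Bl &, injective d2}.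
Hypothesis i12 : {in Bl &, forall t t', d1 t != d2 t'}.
Hypothesis sp : forall T' : {set T}, T' \subset Bl -> #|T'| = k -> 2 * k + 3 <= #|\bigcup_(t in T') (d1 t :|: d2 t)|.

Definition Eg := [set A : {set 'I_n} | #|A| == 2].
Definition Col := Eg :\: [set d2 t | t in Bl].
Definition colE (A : {set 'I_n}) := if [pick t in Bl | d2 t == A] is Some t then d1 t else A.

Lemma card_Eg : #|Eg| = 'C(n, 2).
Proof. by rewrite /Eg cardsE -[in RHS](card_ord n) -card_draws cardsE. Qed.

Lemma card_Col : #|Col| = 'C(n, 2) - #|Bl|.
Proof.
rewrite cardsD card_Eg (setIidPr _) ?(card_in_imset i2) //.
by apply/subsetP => A /imsetP[t tB ->]; rewrite inE; have [_ ->] := c12 tB.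
Qed.

Lemma colE_in A : A \in Eg -> colE A \in Col.
Proof.
rewrite inE /colE => A2; case: pickP => [t /andP[tB _]|h].
  have [c _] := c12 tB; rewrite !inE c eqxx andbT; apply/imsetP => -[t' t'B h].
  by move: (i12 tB t'B); rewrite h eqxx.
by rewrite !inE A2 andbT; apply/imsetP => -[t tB h']; have := h t; rewrite tB h' eqxx.
Qed.

Lemma small_subset (A : {set T}) : k <= #|A| -> exists2 T' : {set T}, T' \subset A & #|T'| = k.
Proof.
move=> kA; exists [set t in take k (enum A)].
  by apply/subsetP => t; rewrite inE => /mem_take; rewrite mem_enum.
rewrite cardsE (card_uniqP _) ?take_uniq ?enum_uniq // size_take -cardE.
by case: ltngtP kA.
Qed.

Lemma GR_le q N : has_pq_colouring n (2 * k + 2) q N -> N <= n * n -> GR n (2 * k + 2) q <= N.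
Proof.
move=> h Nn; rewrite leqNgt; apply/negP => lt.
have := before_find 0 lt; by rewrite nth_iota ?add0n ?h.
Qed.

(** Each edge [d2 t] is given the colour of [d1 t], all other edges having colours of their own.
    Inside [S], discarding the edges [d2 t] of the at most [k - 1] blocks contained in [S] leaves
    distinct colours: a colour coming from an edge [d1 t] outside [S] determines [t]. *)
Lemma GR_upper : GR n (2 * k + 2) ('C(2 * k + 2, 2) - (k - 1)) <= 'C(n, 2) - #|Bl|.
Proof.
rewrite -card_Col; apply: GR_le; last first.
  rewrite card_Col; apply: leq_trans (leq_subr _ _) _; rewrite bin2; lia.
have o0 : 0 < n by apply: ltnW.
pose x0 : 'I_n := Ordinal o0; pose x1 : 'I_n := Ordinal n2.
have A0 : [set x0; x1] \in Eg by rewrite inE cards2.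
have C0 := colE_in A0.
pose rk A := enum_rank_in C0 A.
apply/existsP; exists [ffun x : 'I_n * 'I_n => rk (colE [set x.1; x.2])].
apply/andP; split.
  by apply/forallP => x; rewrite !ffunE /= setUC.
apply/forallP => S; apply/implyP => /eqP S2.
pose ES := [set A in Eg | A \subset S]; pose TS := [set t in Bl | (d1 t \subset S) && (d2 t \subset S)].
have cES : #|ES| = 'C(2 * k + 2, 2).
  rewrite -S2 -cards_draws; apply: eq_card => A; rewrite !inE andbC //.
have TSB : TS \subset Bl by apply/subsetP => t; rewrite inE => /andP[].
have cTS : #|TS| <= k - 1.
  rewrite leqNgt; apply/negP => h; have kT : k <= #|TS| by lia.
  have [T' T'S T'k] := small_subset kT.
  have := sp (subset_trans T'S TSB) T'k.
  suff : #|\bigcup_(t in T') (d1 t :|: d2 t)| <= 2 * k + 2 by lia.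
  rewrite -S2; apply/subset_leq_card/bigcupsP => t /(subsetP T'S).
  by rewrite inE => /and3P[_ h1 h2]; rewrite subUset h1.
pose EI := ES :\: [set d2 t | t in TS].
have rinj : {in EI &, injective colE}.
  have pk A : A \in EI -> colE A \subset S -> colE A = A.
    rewrite !inE /colE => /andP[An /andP[A2 AS]]; case: pickP => // t /andP[tB /eqP tA] h.
    by case/negP: An; apply/imsetP; exists t => //; rewrite inE tB h tA.
  have sb A : A \in EI -> A \subset S by rewrite !inE => /and3P[].
  move=> A B AE BE h.
  case: (boolP (colE A \subset S)) => cA.
    by rewrite -(pk A) // h pk // -h.
  have cB : ~~ (colE B \subset S) by rewrite -h.
  move: h cA cB; rewrite /colE; case: pickP => [t /andP[tB /eqP <-]|_]; last by rewrite (sb A AE).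
  case: pickP => [t' /andP[t'B /eqP <-]|_]; last by rewrite (sb B BE).
  by move=> /(i1 tB t'B) ->.
apply: leq_trans (_ : #|[set rk (colE A) | A in EI]| <= _).
  rewrite card_in_imset; last first.
    move=> A B AE BE /enum_rank_in_inj h; apply: rinj => //; apply: h.
      by apply: colE_in; move: AE; rewrite !inE => /and3P[].
    by apply: colE_in; move: BE; rewrite !inE => /and3P[].
  rewrite cardsD cES; apply: leq_sub2l; apply: leq_trans cTS.
  by apply: leq_trans (subset_leq_card (subsetIr _ _)) _; apply: leq_imset_card.
apply/subset_leq_card/subsetP => c /imsetP[A AE ->].
have [AS /cards2P[x [y [xy AE']]]] : A \subset S /\ #|A| == 2 by move: AE; rewrite !inE => /and3P[_ -> ->].
apply/imsetP; exists (x, y); last by rewrite ffunE /= -AE'.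
by move: AS; rewrite AE' subUset !sub1set => /andP[xS yS]; rewrite inE xS yS.
Qed.

End Colouring.

End Colourings.

(** * Upper bounds for the generalised Ramsey number *)

Module UpperBounds.
Import mathcomp.algebra_tactics.ring mathcomp.algebra_tactics.lra.
Import Order.TTheory GRing.Theory Num.Theory.
Import Correlation Nibble Packing Copies Squares Colourings.

Local Open Scope ring_scope.

Notation GRk n k := (GR n (2 * k + 2) ('C(2 * k + 2, 2) - (k - 1)))%N.

Lemma GR_gadget (VF Bk : finType) (Jp : {set {set VF}}) (d1 d2 : Bk -> {set VF}) (k : nat) (eps : rat) :
  (2 < #|VF|)%N -> Jp != set0 -> (0 < k <= 7)%N ->
  (forall S : {set Bk}, S != set0 -> #|S| <= 7 -> 2 * #|S| + 2 <= #|\bigcup_(B in S) (d1 B :|: d2 B)|)%N ->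
  (forall S : {set Bk}, #|S| = k -> 2 * k + 3 <= #|\bigcup_(B in S) (d1 B :|: d2 B)|)%N ->
  (forall (S : {set Bk}) (P : {set VF}), #|S| <= 3 -> #|\bigcup_(B in S) (d1 B :|: d2 B)| = 2 * #|S| + 2 ->
    P \subset \bigcup_(B in S) (d1 B :|: d2 B) -> #|P| = 2 -> P \in Jp)%N ->
  (forall B, d1 B \in Jp) -> (forall B, d2 B \in Jp) -> (forall P, P \in Jp -> #|P| = 2%N) ->
  injective d1 -> injective d2 -> (forall B B', d1 B != d2 B') -> 0 < eps < 1 ->
  exists n0 : nat, forall n, (n0 <= n)%N ->
    (GRk n k)%:R <= 'C(n, 2)%:R * (1 - (1 - eps) ^+ 2 * (#|{: Bk}|%:R / #|Jp|%:R)) :> rat.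
Proof.
move=> m2 J0 /andP[k0 k7] F1 F2 F3 dJ1 dJ2 Jp2 i1 i2 i12 /andP[e0 e1].
have p01 : 0 <= eps < 1 by rewrite ltW.
have q0 : 0 < 1 - eps by rewrite subr_gt0.
have y0 : 0 < (1 - eps) ^+ #|Jp| * eps ^+ #|nJ Jp| by rewrite mulr_gt0 // exprn_gt0.
have e01 : 0 < eps <= 1 by rewrite e0 ltW.
have [n0 H] := gadget_packing Jp2 J0 m2 p01 y0 e01.
exists (n0 + 2)%N => n hn.
have [Acc [cA star]] := H n (leq_trans (leq_addr _ _) hn).
have n2 : (1 < n)%N by apply: leq_trans hn; rewrite leq_addl.
have [f1 f2 f3 f4] := D_facts m2 star dJ1 dJ2 Jp2 i1 i2 i12.
have sp (T' : {set _}) := @block_span VF Bk Jp d1 d2 k m2 k7 F1 F2 F3 n Acc star T'.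
have up := @GR_upper n k _ (Blk Bk Acc) (@D1 VF Bk d1 n) (@D2 VF Bk d2 n) n2 k0 f1 f2 f3 f4 (fun T' a b => sp T' a b k0).
have JR : 0 < #|Jp|%:R :> rat by rewrite ltr0n card_gt0.
have Bc : #|Blk Bk Acc|%:R <= 'C(n, 2)%:R :> rat.
  rewrite ler_nat -card_Eg -(card_in_imset f2); apply/subset_leq_card/subsetP => A /imsetP[t tB ->].
  by rewrite inE; have [-> _] := f1 t tB.
apply: le_trans (_ : ('C(n, 2) - #|Blk Bk Acc|)%:R <= _); first by rewrite ler_nat.
rewrite natrB; last by rewrite -(ler_nat rat).
rewrite mulrBr mulr1 lerD2l lerN2 card_Blk natrM.
apply: le_trans (ler_wpM2r (ler0n _ _) cA).
by rewrite le_eqVlt; apply/orP; left; apply/eqP; ring.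
Qed.

Lemma bin_le n : 'C(n, 2)%:R * 2 <= n%:R ^+ 2 :> rat.
Proof.
rewrite -natrX -(natrM _ _ 2) ler_nat.
have -> : ('C(n, 2) * 2 = n * n.-1)%N by rewrite -[X in (_ * X)%N]/(2`!) bin_ffact ffactnS ffactn1.
by rewrite expnS expn1 leq_mul2l leq_pred orbT.
Qed.

Lemma GR_ratio (x c r e : rat) (n : nat) : 0 < e <= 1 / 2 -> 0 <= r -> 0 <= c <= 1 -> c - e <= r ->
  x <= 'C(n, 2)%:R * (1 - (1 - e) ^+ 2 * r) -> x <= ((1 - c) / 2 + 2 * e) * n%:R ^+ 2.
Proof.
move=> /andP[e0 e2] r0 /andP[c0 c1] cr h; apply: le_trans h _.
have h1 : 0 <= (1 - 2 * e) * (r - (c - e)) by apply: mulr_ge0; lra.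
have h2 : 0 <= e * e * r by rewrite !mulr_ge0 // ltW.
have h3 : 0 <= e * (1 - c) by rewrite mulr_ge0 ?subr_ge0 // ltW.
have h4 : 0 <= e * e by rewrite mulr_ge0 // ltW.
have h5 : 1 - (1 - e) ^+ 2 * r <= (1 - c) + 4 * e by rewrite expr2; lra.
apply: le_trans (ler_wpM2l (ler0n _ _) h5) _.
have h6 : 0 <= (1 - c) / 2 + 2 * e by lra.
have := ler_wpM2r h6 (bin_le n); lra.
Qed.

Lemma small_eps (eps : rat) : 0 < eps -> exists2 e : rat, 0 < e <= 1 / 2 & 2 * e <= eps.
Proof.
move=> e0; exists (Num.min (eps / 2) (1 / 2)).
  by rewrite lt_min ge_min lexx orbT andbT divr_gt0.
have h : Num.min (eps / 2) (1 / 2) <= eps / 2 by rewrite ge_min lexx.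
lra.
Qed.

Lemma ratio_arith (p q j B : nat) (e : rat) : (0 < j)%N -> 1 <= p%:R * e -> 0 < e ->
  (p * j <= (11 * p + 4) * q)%N -> B = (2 * q)%N -> 2 / 11 - e <= B%:R / j%:R.
Proof.
move=> j0 pe e0 c ->; have jR : 0 < j%:R :> rat by rewrite ltr0n.
have c' : p%:R * j%:R <= (11 * p%:R + 4) * q%:R :> rat by rewrite -!natrM -natrD -natrM ler_nat.
rewrite (ler_pdivlMr _ _ jR) [(2 * q)%:R]natrM.
have q0 : 0 < 11 * p%:R + 4 :> rat by rewrite -(natrM rat 11 p) -(natrD rat (11 * p) 4) ltr0n addn_gt0 orbT.
rewrite -(ler_pM2l q0); apply: le_trans (_ : 2 * (p%:R * j%:R) <= _); last by move: c'; clear; lra.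
have -> : (11 * p%:R + 4) * ((2 / 11 - e) * j%:R) = (2 * p%:R + 8 / 11 - 11 * (p%:R * e) - 4 * e) * j%:R by field.
rewrite [leRHS]mulrA; apply: ler_wpM2r; first exact: ltW.
by move: pe e0; clear; lra.
Qed.

Lemma GR_upper_odd (k : nat) (eps : rat) : (k = 5 \/ k = 7)%N -> 0 < eps ->
  exists n0 : nat, forall n, (n0 <= n)%N -> (GRk n k)%:R <= (9 / 22 + eps) * n%:R ^+ 2 :> rat.
Proof.
move=> k57 eps0; have [e ee e2] := small_eps eps0; have /andP[ep0 ep1] := ee.
have ee1 : 0 < e < 1 by rewrite ep0 /=; lra.
(* The prime is taken large enough for the term 4 in [card_Jp] to cost at most [e]. *)
have [N hN] := exists_nat_gt (1 / e).
have [p Np p_pr] := prime_above N.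
have pe : 1 <= p%:R * e.
  have : N%:R <= p%:R :> rat by rewrite ler_nat ltnW.
  by move: hN; rewrite ler_pdivrMr // => h1 h2; apply: le_trans h1 _; apply: ler_wpM2r => //; exact: ltW.
have pR : 0 < p%:R :> rat by rewrite ltr0n prime_gt0.
pose B0 : Bk p := (((0, 0), (0, 0, 0)), false).
have J0 : Jp p != set0 by apply/set0Pn; exists (ed1 B0); case: (ed_Jp B0).
have m2 : (2 < #|{: VS p}|)%N.
  apply: leq_trans (_ : #|bs B0| <= _)%N; first by rewrite card_bs.
  exact: max_card.
have F2 (S : {set Bk p}) : #|S| = k -> (2 * k + 3 <= #|\bigcup_(B in S) (ed1 B :|: ed2 B)|)%N.
  by move=> Sk; rewrite -Sk; apply: (span_F2 p_pr); rewrite Sk.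
have k7 : (0 < k <= 7)%N by case: k57 => ->.
have [n0 H] := @GR_gadget (VS p) (Bk p) (Jp p) (@ed1 p) (@ed2 p) k e m2 J0 k7 (@span_F1 p p_pr) F2
  (@span_F3 p p_pr) (fun B => proj1 (ed_Jp B)) (fun B => proj2 (ed_Jp B)) (@Jp2 p) (@ed1_inj p) (@ed2_inj p)
  (@ed1_ed2 p) ee1.
exists n0 => n hn; have JR : 0 < #|Jp p|%:R :> rat by rewrite ltr0n card_gt0.
have cr : 2 / 11 - e <= #|{: Bk p}|%:R / #|Jp p|%:R.
  apply: (ratio_arith _ pe ep0 (card_Jp p_pr) (card_Bk p)).
  by rewrite card_gt0.
have r0 : 0 <= #|{: Bk p}|%:R / #|Jp p|%:R :> rat by rewrite divr_ge0.
have c01 : 0 <= (2 / 11 : rat) <= 1 by [].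
apply: le_trans (GR_ratio ee r0 c01 cr (H n hn)) _.
by apply: ler_wpM2r; [exact: exprn_ge0 | move: e2; clear; lra].
Qed.

(** All six pairs of the gadget are covered, so accepted copies never share a pair. A copy has a
    single block, which makes the conditions on several blocks of one copy vacuous. *)
Lemma GR_upper_6 (eps : rat) : 0 < eps ->
  exists n0 : nat, forall n, (n0 <= n)%N -> (GRk n 6)%:R <= (5 / 12 + eps) * n%:R ^+ 2 :> rat.
Proof.
move=> eps0; have [e ee e2] := small_eps eps0; have /andP[ep0 ep1] := ee.
have ee1 : 0 < e < 1 by rewrite ep0 /=; lra.
pose J4 : {set {set 'I_4}} := [set P : {set 'I_4} | #|P| == 2%N].
pose o (i : nat) : 'I_4 := inord i.
have oE i j : (i < 4)%N -> (j < 4)%N -> (o i == o j) = (i == j) by move=> hi hj; rewrite -val_eqE /= !inordK.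
pose f1 (_ : unit) : {set 'I_4} := [set o 0%N; o 1%N]; pose f2 (_ : unit) : {set 'I_4} := [set o 2; o 3].
have c1 b : #|f1 b| = 2%N by rewrite cards2 oE.
have c2 b : #|f2 b| = 2%N by rewrite cards2 oE.
have d12 : f1 Datatypes.tt :&: f2 Datatypes.tt = set0.
  by apply/setP => i; rewrite !inE; apply/negP => /andP[/orP[]/eqP ->]; rewrite !oE.
have c4 : #|f1 Datatypes.tt :|: f2 Datatypes.tt| = 4 by rewrite cardsU d12 cards0 c1 c2.
have S1 (S : {set unit}) : (#|S| <= 1)%N by rewrite -card_unit; exact: max_card.
have J0 : J4 != set0 by apply/set0Pn; exists (f1 Datatypes.tt); rewrite inE c1.
have F1 (S : {set unit}) : S != set0 -> (#|S| <= 7 -> 2 * #|S| + 2 <= #|\bigcup_(B in S) (f1 B :|: f2 B)|)%N.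
  move=> /set0Pn[[] tS] _; have -> : S = [set Datatypes.tt] by apply/setP => -[]; rewrite inE tS.
  by rewrite cards1 big_set1 c4.
have F2 (S : {set unit}) : #|S| = 6%N -> (2 * 6 + 3 <= #|\bigcup_(B in S) (f1 B :|: f2 B)|)%N.
  by move=> S6; have := S1 S; rewrite S6.
have F3 (S : {set unit}) (P : {set 'I_4}) : (#|S| <= 3 -> #|\bigcup_(B in S) (f1 B :|: f2 B)| = 2 * #|S| + 2 ->
    P \subset \bigcup_(B in S) (f1 B :|: f2 B) -> #|P| = 2 -> P \in J4)%N.
  by move=> _ _ _ P2; rewrite inE P2.
have m2 : (2 < #|'I_4|)%N by rewrite card_ord.
have Jp2 (P : {set 'I_4}) : P \in J4 -> #|P| = 2%N by rewrite inE => /eqP.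
have u1 : injective f1 by move=> [] [].
have u2 : injective f2 by move=> [] [].
have f12 b b' : f1 b != f2 b'.
  apply/eqP => h; have : o 0%N \in f2 b' by rewrite -h !inE eqxx.
  by rewrite !inE !oE.
have g1 b : f1 b \in J4 by rewrite inE c1.
have g2 b : f2 b \in J4 by rewrite inE c2.
have [n0 H] := @GR_gadget _ unit J4 f1 f2 6 e m2 J0 isT F1 F2 F3 g1 g2 Jp2 u1 u2 f12 ee1.
exists n0 => n hn.
have J6 : #|J4| = 6%N by rewrite /J4 cardsE -[RHS]/('C(4, 2)) -[in RHS](card_ord 4) -card_draws cardsE.
have r0 : 0 <= #|{: unit}|%:R / #|J4|%:R :> rat by rewrite divr_ge0.
have cr : 1 / 6 - e <= #|{: unit}|%:R / #|J4|%:R.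
  by rewrite J6 card_unit; move: ep0; clear; lra.
have c01 : 0 <= (1 / 6 : rat) <= 1 by [].
apply: le_trans (GR_ratio ee r0 c01 cr (H n hn)) _.
by apply: ler_wpM2r; [exact: exprn_ge0 | move: e2; clear; lra].
Qed.

End UpperBounds.

(** * The number of repeated colours *)
Module Repeats.
Import Colourings.

Section Repeats.
Variables (n k : nat) (I : finType) (V : I -> {set 'I_n}).
Implicit Types (e g : I) (D T X A : {set I}) (v : 'I_n) (Q : {set 'I_n}).

Definition VV D := \bigcup_(e in D) V e.

Lemma VV1 e : VV [set e] = V e.
Proof. by rewrite /VV big_set1. Qed.

Lemma VVU D T : VV (D :|: T) = VV D :|: VV T.
Proof. by rewrite /VV bigcup_setU. Qed.

Lemma VVS D T : D \subset T -> VV D \subset VV T.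
Proof. by move=> h; apply/bigcupsP => e eD; apply: (bigcup_sup e) => //; apply: (subsetP h). Qed.

Lemma V_VV e D : e \in D -> V e \subset VV D.
Proof. by move=> eD; apply: (bigcup_sup e). Qed.

(* Disjoint sets of this kind through a common [v] merge, so they are few (see [cleaning]). *)
Definition OT D v := (#|VV D| <= 2 * #|D| + 1) && [forall j : 'I_(#|D|).+1, (0 < j) ==>
  [exists T : {set I}, [&& T \subset D, #|T| == j, v \in VV T & #|VV T| <= 2 * j + 2]]].

(** A whole set [D] has at most [2 * #|D| + 1] vertices and shares [v] with the next part, so
    absorbing it keeps the bound [2 * j + 2]; only the last part used is truncated, to a subset that
    still contains [v]. *)
Lemma OT_combine v (r : seq {set I}) j : uniq r ->
  (forall D, D \in r -> OT D v) -> (forall D T, D \in r -> T \in r -> D != T -> [disjoint D & T]) ->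
  0 < j <= \sum_(D <- r) #|D| ->
  exists T, [/\ T \subset \bigcup_(D <- r) D, #|T| = j, v \in VV T & #|VV T| <= 2 * j + 2].
Proof.
elim: r j => [|D r IH] j; first by rewrite big_nil => _ _ _ /andP[/leq_trans h /h].
rewrite cons_uniq !big_cons => /andP[Dr ur] ot dj /andP[j0 jS].
have /andP[vD /forallP tD] := ot D (mem_head _ _).
case: (leqP j #|D|) => jD.
  have jo : j < #|D|.+1 by [].
  have := tD (Ordinal jo); rewrite /= j0 => /existsP[T /and4P[TD /eqP Tj vT Tv]].
  by exists T; split => //; apply: subset_trans TD _; apply: subsetUl.
have [|||T [TS Tj vT Tv]] := IH (j - #|D|) ur.
- by move=> D' D'r; apply: ot; rewrite inE D'r orbT.
- by move=> D' T D'r Tr; apply: dj; rewrite inE ?D'r ?Tr orbT.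
- by rewrite subn_gt0 jD /=; lia.
case: (posnP #|D|) => D0.
  exists T; split; [exact: subset_trans TS (subsetUr _ _) | by rewrite Tj D0 subn0 | by [] | by rewrite D0 subn0 in Tv].
have DT : D :&: T = set0.
  apply/eqP; rewrite setI_eq0; apply: disjointWr TS _; rewrite disjoint_sym disjoints_subset.
  rewrite big_seq; elim/big_ind: _ => [|A B hA hB|D' D'r]; first exact: sub0set.
    by rewrite subUset hA.
  rewrite -disjoints_subset; apply: dj; rewrite ?inE ?D'r ?eqxx ?orbT //.
  by apply: contraNneq Dr => <-.
have vVD : v \in VV D.
  have Do : #|D| < #|D|.+1 by [].
  have := tD (Ordinal Do); rewrite /= D0 => /existsP[T0 /and4P[T0D _ vT0 _]].
  by apply: (subsetP (VVS T0D)).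
exists (D :|: T); split.
- by apply: setUS.
- by rewrite cardsU DT cards0 Tj; lia.
- by rewrite VVU inE vT orbT.
have h : 0 < #|VV D :&: VV T| by apply/card_gt0P; exists v; rewrite inE vVD.
by rewrite VVU; have := cardsUI (VV D) (VV T); lia.
Qed.

(** A maximal disjoint family of such sets is removed. Those attached to one vertex [v] have total
    size below [k], since merging them would give [k] elements on at most [2 * k + 2] vertices. *)
Lemma cleaning (A0 : {set I}) :
  (forall D, D \subset A0 -> #|D| = k -> 2 * k + 3 <= #|VV D|) -> 0 < k ->
  exists A, [/\ A \subset A0, #|A0| <= #|A| + n * k &
    forall D v, D \subset A -> 0 < #|D| < k -> ~~ OT D v].
Proof.
move=> H k0.
pose ok (D : {set I}) := [&& D \subset A0, 0 < #|D| < k & [exists v, OT D v]].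
pose Pf (F : {set {set I}}) := [forall D in F, ok D] && trivIset F.
have Pf0 : Pf set0.
  apply/andP; split; first by apply/forall_inP => D; rewrite inE.
  by apply/trivIsetP => A B; rewrite inE.
have [F /maxsetP[/andP[/forall_inP Fok Ftr] Fmax] _] := maxset_exists Pf0.
have cA0 : cover F \subset A0 by apply/bigcupsP => D /Fok/and3P[].
exists (A0 :\: cover F); split; first exact: subsetDl.
- have small v : \sum_(D in F | OT D v) #|D| < k.
    rewrite ltnNge; apply/negP => h.
    have e1 : \sum_(D <- enum [set D in F | OT D v]) #|D| = \sum_(D in F | OT D v) #|D|.
      by rewrite big_enum; apply: eq_bigl => D; rewrite inE.
    have kk : 0 < k <= \sum_(D <- enum [set D in F | OT D v]) #|D| by rewrite k0 e1.
    have [D|D T|T [TS Tk vT Tv]] := @OT_combine v _ k (enum_uniq _) _ _ kk.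
    + by rewrite mem_enum inE => /andP[].
    + rewrite !mem_enum !inE => /andP[DF _] /andP[TF _] DT.
      exact: (trivIsetP Ftr).
    have TA : T \subset A0.
      apply: subset_trans TS _; rewrite big_enum /=; apply: subset_trans cA0; apply/bigcupsP => D.
      by rewrite inE => /andP[DF _]; apply: (bigcup_sup D).
    by have := H T TA Tk; lia.
  rewrite -(cardsID (cover F) A0) (setIidPr cA0) addnC leq_add2l -(eqP Ftr).
  apply: leq_trans (_ : \sum_(v : 'I_n) \sum_(D in F | OT D v) #|D| <= _); last first.
    rewrite -[X in _ <= X * _](card_ord n) -sum_nat_const; apply: leq_sum => v _; exact: ltnW.
  rewrite (exchange_big_dep (mem F)) /=; last by move=> v D _ /andP[].
  apply: leq_sum => D DF; have /and3P[_ _ /existsP[v otv]] := Fok D DF.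
  by rewrite (bigD1 v) /= ?DF ?otv // leq_addr.
move=> D v DA Dk; apply/negP => ot.
have D0 : D != set0 by rewrite -card_gt0; case/andP: Dk.
have Ddis B : B \in F -> [disjoint D & B].
  move=> BF; rewrite disjoints_subset; apply: subset_trans DA _; apply/subsetP => e.
  by rewrite !inE => /andP[ec _]; apply: contraNN ec => eB; apply/bigcupP; exists B.
have PF : Pf (D |: F).
  apply/andP; split.
    apply/forall_inP => B; rewrite !inE => /orP[/eqP ->|]; last exact: Fok.
    rewrite /ok Dk (subset_trans DA) ?subsetDl //=; apply/existsP; exists v; exact: ot.
  apply/trivIsetP => B C; rewrite !inE => /orP[/eqP ->|BF] /orP[/eqP ->|CF] BC.
  - by rewrite eqxx in BC.
  - exact: Ddis.
  - by rewrite disjoint_sym; exact: Ddis.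
  - exact: (trivIsetP Ftr).
have := Fmax _ PF (subsetUr _ _) => /setP/(_ D); rewrite !inE eqxx /= => DF.
have [e eD] := set0Pn _ D0; have := subsetP DA e eD; rewrite inE => /andP[/negP ec _]; apply: ec.
by apply/bigcupP; exists D.
Qed.

(** * Components of the remaining elements *)

Section Clean.
Variable A : {set I}.
Hypothesis k1 : 1 < k.
Hypothesis H : forall D, D \subset A -> #|D| = k -> 2 * k + 3 <= #|VV D|.
Hypothesis V34 : forall e, e \in A -> 2 < #|V e| <= 4.
Hypothesis noOT : forall D v, D \subset A -> 0 < #|D| < k -> ~~ OT D v.

(** A new element has to share two vertices with the union, not with one earlier element. Chains can
    therefore leave a component, and [coverers] relies on this. *)
Inductive chain : {set I} -> Prop :=
| chain1 e : e \in A -> chain [set e]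
| chainU D e : chain D -> e \in A -> e \notin D -> 1 < #|V e :&: VV D| -> chain (e |: D).

Lemma chain_sub D : chain D -> D \subset A.
Proof. by elim=> [e eA|D' e _ DA eA _ _]; rewrite ?subUset sub1set eA. Qed.

Lemma chain_le D : chain D -> #|VV D| <= 2 * #|D| + 2.
Proof.
elim=> [e eA|D' e _ h eA eD m].
  by rewrite VV1 cards1; case/andP: (V34 eA).
rewrite VVU VV1 cardsU1 eD; have := cardsUI (V e) (VV D'); case/andP: (V34 eA) => _; lia.
Qed.

(** The initial segments of the construction are chains of every size containing the first element,
    and [v] is one of its vertices. *)
Lemma chain_start D : chain D -> exists2 v, v \in VV D &
  forall j, 0 < j <= #|D| -> exists T, [/\ T \subset D, #|T| = j, chain T & v \in VV T].
Proof.
elim=> [e eA|D' e cD [v vD h] eA eD m].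
  have /card_gt0P[v vV] : 0 < #|V e| by case/andP: (V34 eA) => /ltnW/ltnW.
  exists v; rewrite ?VV1 // => j; rewrite cards1 => j1.
  by exists [set e]; rewrite cards1 VV1; split => //; [lia | exact: chain1].
exists v; first by rewrite VVU inE vD orbT.
move=> j /andP[j0]; rewrite cardsU1 eD add1n leq_eqVlt => /orP[/eqP ->|jD].
  by exists (e |: D'); rewrite cardsU1 eD; split => //; [exact: chainU | rewrite VVU inE vD orbT].
have [|T [TD Tj cT vT]] := h j; first by rewrite j0.
by exists T; split => //; apply: subset_trans TD (subsetUr _ _).
Qed.

Lemma chain_lt D : chain D -> #|D| < k.
Proof.
move=> cD; rewrite ltnNge; apply/negP => kD; have [v _ h] := chain_start cD.
have [|T [TD Tk cT _]] := h k; first by rewrite kD andbT ltnW.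
by have := H (chain_sub cT) Tk; have := chain_le cT; rewrite Tk; lia.
Qed.

Lemma chain_gt0 D : chain D -> 0 < #|D|.
Proof. by case=> [e _|D' e _ _ eD _]; rewrite ?cards1 // cardsU1 eD. Qed.

(** With fewer vertices the chain and its initial segments would be one of the sets [OT] removed by
    the cleaning. *)
Lemma chain_eq D : chain D -> #|VV D| = 2 * #|D| + 2.
Proof.
move=> cD; apply/eqP; rewrite eqn_leq chain_le //= leqNgt; apply/negP => h.
have [v vD hT] := chain_start cD.
have D01 : 0 < #|D| < k by rewrite chain_gt0 // chain_lt.
case/negP: (noOT v (chain_sub cD) D01); apply/andP; split; first by move: h; rewrite addn2 addn1 ltnS.
apply/forallP => j; apply/implyP => j0; have [|T [TD Tj cT vT]] := hT j.
  by rewrite j0 -ltnS ltn_ord.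
by apply/existsP; exists T; rewrite TD Tj eqxx vT -Tj chain_le.
Qed.

Lemma card_V e : e \in A -> #|V e| = 4.
Proof. by move=> eA; have := chain_eq (chain1 eA); rewrite VV1 cards1. Qed.

Lemma chain_meet D e : chain D -> e \in A -> e \notin D -> 1 < #|V e :&: VV D| -> #|V e :&: VV D| = 2.
Proof.
move=> cD eA eD m; have := chain_eq (chainU cD eA eD m); have := chain_eq cD.
by rewrite VVU VV1 cardsU1 eD; have := cardsUI (V e) (VV D); rewrite card_V //; lia.
Qed.

Lemma chain_add D (G : {set I}) : chain D -> G \subset A -> [disjoint G & D] ->
  (forall g, g \in G -> 1 < #|V g :&: VV D|) -> chain (G :|: D).
Proof.
move=> cD; move: {2}#|G| (erefl #|G|) => c; elim: c G => [|c IH] G Gc GA dj hG.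
  by move/eqP: Gc; rewrite cards_eq0 => /eqP ->; rewrite set0U.
have /card_gt0P[g gG] : 0 < #|G| by rewrite Gc.
have gD : g \notin D by move: dj; rewrite disjoints_subset => /subsetP/(_ g gG); rewrite inE.
rewrite -(setD1K gG) -setUA; apply: chainU.
- apply: IH.
  + by have := cardsD1 g G; rewrite gG Gc => -[].
  + exact: subset_trans (subD1set _ _) GA.
  + exact: disjointWl (subD1set _ _) dj.
  + by move=> h /setD1P[_ hG']; apply: hG.
- exact: (subsetP GA).
- by rewrite !inE eqxx (negbTE gD).
- by apply: leq_trans (hG g gG) _; apply/subset_leq_card/setIS/VVS/subsetUr.
Qed.

Definition adj e g := [&& e \in A, g \in A, e != g & 1 < #|V e :&: V g|].
Definition comp e : {set I} := [set g | connect adj e g].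

Lemma adj_sym : symmetric adj.
Proof. by move=> e g; rewrite /adj eq_sym setIC; case: (e \in A); case: (g \in A). Qed.

Lemma connect_adj_sym : connect_sym adj.
Proof. exact: sym_connect_sym adj_sym. Qed.

Lemma cross e0 D : D \subset comp e0 -> D != set0 -> D != comp e0 ->
  exists g g', [/\ g \in comp e0, g \notin D, g' \in D & adj g' g].
Proof.
move=> DX /set0Pn[x xD] DnX.
case: (boolP [exists g in comp e0 :\: D, [exists g' in D, adj g' g]]) => [|no].
  by case/exists_inP => g; rewrite inE => /andP[gD gX] /exists_inP[g' g'D a]; exists g, g'.
have cl : closed adj (mem D).
  have key y z : adj y z -> y \in D -> z \in D.
    move=> a yD; apply: contraNT no => zD; apply/exists_inP; exists z; last by apply/exists_inP; exists y.
    rewrite !inE zD /=; have := subsetP DX y yD; rewrite inE => /connect_trans; apply; exact: connect1.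
  by move=> y z a; apply/idP/idP; apply: key => //; rewrite adj_sym.
case/negP: DnX; rewrite eqEsubset DX /=; apply/subsetP => y; rewrite inE => ey.
have ex : connect adj e0 x by have := subsetP DX x xD; rewrite inE.
have xy : connect adj x y by apply: connect_trans ey; rewrite connect_adj_sym.
by have := closed_connect cl xy; rewrite /= xD => <-.
Qed.

Lemma comp_sub e0 : e0 \in A -> comp e0 \subset A.
Proof.
move=> eA; apply/subsetP => g; rewrite inE => c.
have cl : closed adj (mem A) by move=> y z /and4P[/= -> ->].
by have := closed_connect cl c; rewrite /= eA => <-.
Qed.

Lemma meet_VV e g D : g \in D -> 1 < #|V e :&: V g| -> 1 < #|V e :&: VV D|.
Proof. by move=> gD h; apply: leq_trans h _; apply/subset_leq_card/setIS/V_VV. Qed.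

Lemma grow e0 D0 j : e0 \in A -> chain D0 -> D0 \subset comp e0 -> #|D0| <= j <= #|comp e0| ->
  exists D, [/\ D0 \subset D, D \subset comp e0, #|D| = j & chain D].
Proof.
move=> eA c0 s0; elim: j => [|j IH] /andP[h1 h2].
  by have := chain_gt0 c0; rewrite ltnNge h1.
move: h1; rewrite leq_eqVlt => /orP[/eqP <-|h1]; first by exists D0.
have [|D [D0D DX Dj cD]] := IH; first by rewrite -ltnS h1 ltnW.
have [||g [g' [gX gD g'D a]]] := cross DX.
- by rewrite -card_gt0 chain_gt0.
- by apply: contraTneq h2 => <-; rewrite Dj ltnn.
have /and4P[_ gA _ m] := a; rewrite setIC in m.
exists (g |: D); split.
- exact: subset_trans D0D (subsetUr _ _).
- by rewrite subUset sub1set gX.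
- by rewrite cardsU1 gD Dj.
- by apply: chainU => //; exact: meet_VV g'D m.
Qed.

Lemma comp_refl e : e \in comp e.
Proof. by rewrite inE connect0. Qed.

Lemma comp_chain e0 : e0 \in A -> chain (comp e0).
Proof.
move=> eA; have s0 : [set e0] \subset comp e0 by rewrite sub1set comp_refl.
have [|D [_ DX Dc cD]] := @grow e0 _ #|comp e0| eA (chain1 eA) s0.
  by rewrite leqnn andbT; exact: subset_leq_card.
suff <- : D = comp e0 by [].
by apply/eqP; rewrite eqEcard DX Dc leqnn.
Qed.

Lemma comp_eq e g : g \in comp e -> comp g = comp e.
Proof.
rewrite inE => c; apply/setP => z; rewrite !inE; apply/idP/idP; first exact: connect_trans.
by apply: connect_trans; rewrite connect_adj_sym.
Qed.

Definition pairs := [set Q : {set 'I_n} | #|Q| == 2].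
Definition PC D := [set Q in pairs | [exists e in D, Q \subset V e]].

Lemma card_pairs_in (S : {set 'I_n}) : #|[set Q in pairs | Q \subset S]| = 'C(#|S|, 2).
Proof. by rewrite -cards_draws; apply: eq_card => Q; rewrite !inE andbC. Qed.

(** By [chain_meet] a new element meets the earlier vertices in exactly two, so five of its six
    pairs are new. *)
Lemma PC_ge D : chain D -> 5 * #|D| + 1 <= #|PC D|.
Proof.
elim=> [e eA|D' e cD h eA eD m].
  rewrite cards1; apply: leq_trans (_ : #|[set Q in pairs | Q \subset V e]| <= _).
    by rewrite card_pairs_in card_V.
  apply/subset_leq_card/subsetP => Q; rewrite !inE => /andP[-> QV] /=.
  by apply/exists_inP; exists e; rewrite ?inE.
pose N := [set Q in pairs | Q \subset V e] :\: [set Q in pairs | Q \subset V e :&: VV D'].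
have N5 : 5 <= #|N|.
  rewrite cardsD card_pairs_in card_V //.
  apply: leq_trans (_ : 'C(4, 2) - #|[set Q in pairs | Q \subset V e :&: VV D']| <= _); last first.
    by apply: leq_sub2l; apply/subset_leq_card/subsetIr.
  by rewrite card_pairs_in (chain_meet cD).
have dis : [disjoint N & PC D'].
  rewrite -setI_eq0; apply/eqP/setP => Q; rewrite !inE; apply/negP => /andP[/andP[n1 /andP[Q2 QV]]].
  case/andP => _ /exists_inP[g gD Qg]; case/negP: n1; rewrite Q2 subsetI QV /=.
  exact: subset_trans Qg (V_VV gD).
rewrite cardsU1 eD; apply: leq_trans (_ : #|N :|: PC D'| <= _).
  by rewrite cardsU (eqP (_ : N :&: PC D' == set0)) ?setI_eq0 // cards0; move: N5 h; lia.
apply/subset_leq_card/subsetP => Q; rewrite !inE => /orP[/andP[_ /andP[-> QV]]|/andP[-> /exists_inP[g gD Qg]]] /=.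
  by apply/exists_inP; exists e; rewrite ?inE ?eqxx.
by apply/exists_inP; exists g; rewrite // !inE gD orbT.
Qed.

Lemma PC_comp_dis e g Q : e \in A -> g \in A -> Q \in PC (comp e) -> Q \in PC (comp g) -> comp e = comp g.
Proof.
move=> eA gA; rewrite !inE => /andP[/eqP Q2 /exists_inP[y ye Qy]] /andP[_ /exists_inP[z zg Qz]].
rewrite -(comp_eq ye) -(comp_eq zg); case: (eqVneq y z) => [->//|yz].
have yA := subsetP (comp_sub eA) y ye; have zA := subsetP (comp_sub gA) z zg.
apply/esym/comp_eq; rewrite inE connect1 // /adj yA zA yz /=.
by rewrite -Q2; apply/subset_leq_card; rewrite subsetI Qy.
Qed.

(* A pair of [FP e1 e2] which is covered outside the component of [e1] and [e2] gives an
   element that extends the component as a chain, so most pairs of [FP e1 e2] are uncovered. *)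
Definition FP e1 e2 := [set Q in pairs | [&& Q \subset V e1 :|: V e2, ~~ (Q \subset V e1) & ~~ (Q \subset V e2)]].

(** Two sets of four vertices with two in common: 15 - 6 - 6 + 1 pairs. *)
Lemma card_FP e1 e2 : adj e1 e2 -> #|FP e1 e2| = 4.
Proof.
case/and4P => e1A e2A e12 m.
have cD : chain (e1 |: [set e2]) by apply: chainU; rewrite ?inE ?VV1 //; exact: chain1.
have m2 : #|V e1 :&: V e2| = 2.
  by have := @chain_meet [set e2] e1 (chain1 e2A) e1A; rewrite inE VV1; apply.
pose B (S : {set 'I_n}) := [set Q in pairs | Q \subset S].
have FE : FP e1 e2 = B (V e1 :|: V e2) :\: (B (V e1) :|: B (V e2)).
  apply/setP => Q; rewrite !inE; case: (#|Q| == 2); rewrite ?andbF //=.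
  by rewrite negb_or; case: (Q \subset V e1); case: (Q \subset V e2); rewrite ?andbF ?andbT.
have BI : B (V e1) :&: B (V e2) = B (V e1 :&: V e2).
  by apply/setP => Q; rewrite !inE subsetI; case: (#|Q| == 2).
rewrite FE cardsD (setIidPr _); last first.
  by rewrite subUset; apply/andP; split; apply/subsetP => Q; rewrite !inE => /andP[-> h] /=; apply: subset_trans h _; rewrite ?subsetUl ?subsetUr.
rewrite cardsU BI !card_pairs_in m2 !card_V // (_ : #|V e1 :|: V e2| = 6) //.
by rewrite cardsU m2 !card_V.
Qed.

(** The component is grown from [e1] and [e2]. The first element [h] to cover [Q] would meet the
    earlier vertices exactly in [Q]; as it already shares two vertices with a neighbour [h'] among
    the earlier elements, [h'] would cover [Q] too. *)
Lemma FP_uncovered_in e0 e1 e2 Q g : e0 \in A -> e1 \in comp e0 -> e2 \in comp e0 -> adj e1 e2 ->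
  Q \in FP e1 e2 -> g \in comp e0 -> ~~ (Q \subset V g).
Proof.
move=> e0A x1 x2 a; have /and4P[e1A e2A e12 m] := a.
rewrite !inE => /and4P[/eqP Q2 QU Q1' Q2'] gX.
pose Z := [set h in comp e0 | ~~ (Q \subset V h)].
have c0 : chain [set e1; e2] by apply: chainU; rewrite ?inE ?VV1 //; exact: chain1.
have s0 : [set e1; e2] \subset comp e0 by apply/subsetP => h /set2P[]->.
have step j : 2 <= j <= #|comp e0| -> exists D, [/\ [set e1; e2] \subset D, D \subset Z, #|D| = j & chain D].
  elim: j => [|j IH] /andP[] //; rewrite leq_eqVlt => /orP[/eqP <- _|h1 h2].
    exists [set e1; e2]; rewrite cards2 e12; split => //.
    by apply/subsetP => h hh; rewrite inE (subsetP s0) //=; case/set2P: hh => ->.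
  have [|D [D0D DZ Dj cD]] := IH; first by rewrite -ltnS h1 ltnW.
  have DX : D \subset comp e0 by apply: subset_trans DZ _; apply/subsetP => h; rewrite inE => /andP[].
  have [||h [h' [hX hD h'D ah]]] := cross DX.
  - by rewrite -card_gt0 chain_gt0.
  - by apply: contraTneq h2 => <-; rewrite Dj ltnn.
  have /and4P[_ hA _ mh] := ah; rewrite setIC in mh.
  have mD := meet_VV h'D mh; have m2 := chain_meet cD hA hD mD.
  exists (h |: D); split; [exact: subset_trans D0D (subsetUr _ _) | | by rewrite cardsU1 hD Dj | exact: chainU].
  rewrite subUset sub1set DZ andbT inE hX /=; apply/negP => Qh.
  have QD : Q \subset VV D by apply: subset_trans QU _; rewrite subUset !V_VV // (subsetP D0D) // !inE eqxx ?orbT.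
  have QE : Q = V h :&: VV D by apply/eqP; rewrite eqEcard subsetI Qh QD Q2 m2.
  have QE' : V h :&: V h' = V h :&: VV D.
    by apply/eqP; rewrite eqEcard m2 mh andbT setIS // V_VV.
  have := subsetP DZ h' h'D; rewrite inE => /andP[_ /negP]; apply.
  by rewrite QE -QE' subsetIr.
have [|D [_ DZ Dc _]] := step #|comp e0|.
  by rewrite leqnn andbT; have := subset_leq_card s0; rewrite cards2 e12.
have DX : D = comp e0.
  by apply/eqP; rewrite eqEcard Dc leqnn andbT; apply: subset_trans DZ _; apply/subsetP => h; rewrite inE => /andP[].
by have := subsetP DZ g; rewrite DX inE => /(_ gX); rewrite inE => /andP[_ /negbTE ->].
Qed.

Lemma chain_pair e1 e2 : adj e1 e2 -> chain [set e1; e2].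
Proof. by case/and4P=> e1A e2A e12 m; apply: chainU; rewrite ?inE ?VV1 //; exact: chain1. Qed.

Lemma comp_in e0 e : e0 \in A -> e \in comp e0 -> e \in A.
Proof. by move=> e0A; apply: (subsetP (comp_sub e0A)). Qed.

Lemma VV_pair e1 e2 : VV [set e1; e2] = V e1 :|: V e2.
Proof. by rewrite VVU !VV1. Qed.

Definition UF e1 e2 := [set Q in FP e1 e2 | ~~ [exists g in A, Q \subset V g]].

Lemma UF_VV e1 e2 Q D : Q \in UF e1 e2 -> [set e1; e2] \subset D -> Q \subset VV D.
Proof.
rewrite 2!inE => /andP[/andP[_ /andP[h _]] _] /VVS; rewrite VV_pair.
exact: subset_trans.
Qed.

Lemma UF_card e1 e2 Q : Q \in UF e1 e2 -> #|Q| = 2.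
Proof. by rewrite 3!inE => /andP[/andP[/eqP ->]]. Qed.

Lemma UF_unc e1 e2 Q g : Q \in UF e1 e2 -> g \in A -> ~~ (Q \subset V g).
Proof. by rewrite inE => /andP[_ /exists_inPn h] gA; apply: h. Qed.

(** An element covering a pair of [FP e1 e2] lies outside the component and meets its vertices in
    this pair only, so different covered pairs have different coverers. *)
Lemma coverers e0 e1 e2 : e0 \in A -> e1 \in comp e0 -> e2 \in comp e0 -> adj e1 e2 ->
  exists G : {set I}, [/\ G \subset A, [disjoint G & comp e0],
    forall g, g \in G -> 1 < #|V g :&: VV (comp e0)| & #|G| + #|UF e1 e2| = 4].
Proof.
move=> e0A x1 x2 a; have cX := comp_chain e0A.
have s0 : [set e1; e2] \subset comp e0 by apply/subsetP => h /set2P[]->.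
pose C := FP e1 e2 :\: UF e1 e2.
pose gf (Q : {set 'I_n}) := odflt e0 [pick g | (g \in A) && (Q \subset V g)].
have gfP Q : Q \in C -> [/\ gf Q \in A, gf Q \notin comp e0 & Q = V (gf Q) :&: VV (comp e0)].
  rewrite /C 2!inE => /andP[nU QF]; move: nU; rewrite QF /= negbK => /exists_inP[g gA Qg].
  have [gQA QgQ] : gf Q \in A /\ Q \subset V (gf Q).
    by rewrite /gf; case: pickP => [h /andP[//]|/(_ g)]; rewrite gA Qg.
  have gX : gf Q \notin comp e0.
    by apply/negP => gX; have := FP_uncovered_in e0A x1 x2 a QF gX; rewrite QgQ.
  have Q2 : #|Q| = 2 by move: QF; rewrite 2!inE => /andP[/eqP ->].
  have QI : Q \subset V (gf Q) :&: VV (comp e0).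
    rewrite subsetI QgQ; apply: subset_trans (VVS s0); rewrite VV_pair.
    by move: QF; rewrite inE => /andP[_ /andP[]].
  split=> //; apply/eqP; rewrite eqEcard QI /= Q2 chain_meet //.
  by rewrite -Q2; exact: subset_leq_card.
exists (gf @: C); split.
- by apply/subsetP => g /imsetP[Q QC ->]; have [] := gfP Q QC.
- by rewrite disjoints_subset; apply/subsetP => g /imsetP[Q QC ->]; rewrite inE; have [] := gfP Q QC.
- move=> g /imsetP[Q QC ->]; have [_ _ <-] := gfP Q QC.
  by move: QC; rewrite 4!inE => /andP[_ /andP[/eqP -> _]].
rewrite card_in_imset; last first.
  by move=> Q R QC RC e; have [_ _ ->] := gfP Q QC; have [_ _ ->] := gfP R RC; rewrite e.
have UFs : UF e1 e2 \subset FP e1 e2 by apply/subsetP => Q; rewrite inE => /andP[].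
by rewrite -(card_FP a) /C cardsD (setIidPr UFs) subnK // subset_leq_card.
Qed.

Lemma subset_of_size (T : finType) (S : {set T}) j : j <= #|S| -> exists2 S' : {set T}, S' \subset S & #|S'| = j.
Proof.
move=> h; have /card_gt0P[S'] : 0 < #|[set B : {set T} | (B \subset S) && (#|B| == j)]|.
  by rewrite cards_draws bin_gt0.
by rewrite inE => /andP[s /eqP]; exists S'.
Qed.

(** The chain formed by the component and [g] can be extended by [e], which then meets it in two
    vertices, already those common with [g]. A vertex of [Q] in [V e] is thus in [V g]. In [share2]
    this keeps the coverers apart from the second component's pair. *)
Lemma coverer_unc e0 g e Q : e0 \in A -> e \in A -> g \notin comp e0 -> e \notin comp e0 ->
  1 < #|V g :&: VV (comp e0)| -> adj e g -> Q \subset V e :|: V g -> Q \subset VV (comp e0) ->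
  Q \subset V g.
Proof.
move=> e0A eA gX eX m a Qu QX; have /and4P[_ gA eg meg] := a.
have cg : chain (g |: comp e0) by apply: chainU => //; exact: comp_chain.
have mD : 1 < #|V e :&: VV (g |: comp e0)| by apply: meet_VV meg; rewrite !inE eqxx.
have eD : e \notin g |: comp e0 by rewrite 2!inE (negbTE eg) (negbTE eX).
have E : V e :&: V g = V e :&: VV (g |: comp e0).
  by apply/eqP; rewrite eqEcard (chain_meet cg eA eD mD) meg setIS // V_VV // !inE eqxx.
apply/subsetP => x xQ; have := subsetP Qu x xQ; rewrite inE => /orP[xe|//].
have : x \in V e :&: VV (g |: comp e0) by rewrite VVU !inE xe (subsetP QX) ?orbT.
by rewrite -E inE => /andP[].
Qed.

Lemma comp_disj e f g : e \in A -> g \in comp e -> comp e != comp f -> g \notin comp f.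
Proof. by move=> eA ge; apply: contraNN => gf; rewrite -(comp_eq ge) -(comp_eq gf). Qed.

(** Otherwise [k - 2] elements of [comp e] and [G] form a chain with [2 * k - 2] vertices, and [f1],
    [f2] add at most 4 vertices since [Q] is common: [k] elements on [2 * k + 2] vertices. *)
Lemma share2 e f e1 e2 f1 f2 Q (G : {set I}) : 3 < k -> e \in A -> f \in A -> comp e != comp f ->
  e1 \in comp e -> e2 \in comp e -> adj e1 e2 -> f1 \in comp f -> f2 \in comp f -> adj f1 f2 ->
  Q \in UF e1 e2 -> Q \in UF f1 f2 ->
  G \subset A -> [disjoint G & comp e] -> (forall g, g \in G -> 1 < #|V g :&: VV (comp e)|) ->
  #|comp e| + #|G| + 2 < k.
Proof.
move=> k4 eA fA ne x1 x2 a y1 y2 b Qe Qf GA Gd Gm; rewrite ltnNge; apply/negP => hk.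
have s0 : [set e1; e2] \subset comp e by apply/subsetP => h /set2P[]->.
have c2 : #|[set e1; e2]| = 2 by rewrite cards2; case/and4P: a => _ _ ->.
have d2 : #|[set f1; f2]| = 2 by rewrite cards2; case/and4P: b => _ _ ->.
have fX h : h \in [set f1; f2] -> h \notin comp e.
  by move=> hf; rewrite (comp_disj fA) // 1?eq_sym //; case/set2P: hf => ->.
have QX : Q \subset VV (comp e) by exact: UF_VV Qe s0.
have Qu : Q \subset V f1 :|: V f2 by rewrite -VV_pair; exact: UF_VV Qf (subxx _).
have fG h : h \in [set f1; f2] -> h \notin G.
  move=> hf; apply/negP => hG; have hA := subsetP GA h hG.
  case/negP: (UF_unc Qf hA).
  case/set2P: (hf) => hE.
    apply: (coverer_unc eA (comp_in fA y2) (fX h hf) (fX f2 (set22 _ _)) (Gm h hG) _ _ QX).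
      by rewrite hE adj_sym.
    by rewrite hE setUC.
  by apply: (coverer_unc eA (comp_in fA y1) (fX h hf) (fX f1 (set21 _ _)) (Gm h hG) _ _ QX); rewrite hE.
have [D [D0D DXG Dk cD]] : exists D, [/\ [set e1; e2] \subset D, D \subset comp e :|: G, #|D| = k - 2 & chain D].
  case: (leqP (k - 2) #|comp e|) => hX.
    have [|D [h1 h2 h3 h4]] := @grow e _ (k - 2) eA (chain_pair a) s0.
      by rewrite c2 hX andbT; clear -k4; lia.
    by exists D; split => //; apply: subset_trans h2 (subsetUl _ _).
  have [|G' G'G G'c] := @subset_of_size _ G (k - 2 - #|comp e|).
    by move: #|comp e| #|G| hk => x y; clear; lia.
  have dj : [disjoint G' & comp e] by exact: disjointWl G'G Gd.
  exists (G' :|: comp e); split.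
  - exact: subset_trans s0 (subsetUr _ _).
  - by rewrite setUC; exact: setUS.
  - have := cardsUI G' (comp e); move: dj; rewrite -setI_eq0 => /eqP ->; rewrite cards0 G'c.
    by move: #|_ :|: _| #|comp e| hX => x y; clear; lia.
  - apply: chain_add => //; first exact: comp_chain.
    + exact: subset_trans G'G GA.
    + by move=> g gG; apply: Gm; exact: (subsetP G'G).
have dj : D :&: [set f1; f2] = set0.
  apply/eqP; rewrite setI_eq0 disjoint_sym disjoints_subset; apply/subsetP => h hf.
  rewrite inE; apply/negP => /(subsetP DXG); rewrite inE (negbTE (fX h hf)) (negbTE (fG h hf)) //.
have cU : #|D :|: [set f1; f2]| = k.
  have := cardsUI D [set f1; f2]; rewrite dj cards0 Dk d2; move: #|_ :|: _| => x; clear -k4; lia.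
have sU : D :|: [set f1; f2] \subset A by rewrite subUset chain_sub // chain_sub //; exact: chain_pair.
have := H sU cU; rewrite VVU.
have := cardsUI (VV D) (VV [set f1; f2]); rewrite (chain_eq cD) (chain_eq (chain_pair b)) d2 Dk.
have : 2 <= #|VV D :&: VV [set f1; f2]|.
  rewrite -(UF_card Qe); apply/subset_leq_card; rewrite subsetI (UF_VV Qe D0D).
  exact: UF_VV Qf (subxx _).
move: #|VV D :|: VV _| #|VV D :&: VV _| => x y; clear -k4; lia.
Qed.

(** Here [k - 4] elements of one component span [2 * k - 6] vertices, and the two elements from each
    of the others add at most 4 vertices beyond [Q], again [2 * k + 2] in all. *)
Lemma share3 e f g e1 e2 f1 f2 g1 g2 Q : 5 < k -> e \in A -> f \in A -> g \in A ->
  comp e != comp f -> comp f != comp g -> comp g != comp e ->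
  e1 \in comp e -> e2 \in comp e -> adj e1 e2 -> f1 \in comp f -> f2 \in comp f -> adj f1 f2 ->
  g1 \in comp g -> g2 \in comp g -> adj g1 g2 ->
  Q \in UF e1 e2 -> Q \in UF f1 f2 -> Q \in UF g1 g2 -> #|comp e| < k - 4.
Proof.
move=> k6 eA fA gA ef fg ge x1 x2 a y1 y2 b z1 z2 c Qe Qf Qg; rewrite ltnNge; apply/negP => hk.
have s0 : [set e1; e2] \subset comp e by apply/subsetP => h /set2P[]->.
have s1 : [set f1; f2] \subset comp f by apply/subsetP => h /set2P[]->.
have s2 : [set g1; g2] \subset comp g by apply/subsetP => h /set2P[]->.
have c2 : #|[set e1; e2]| = 2 by rewrite cards2; case/and4P: a => _ _ ->.
have d2 : #|[set f1; f2]| = 2 by rewrite cards2; case/and4P: b => _ _ ->.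
have b2 : #|[set g1; g2]| = 2 by rewrite cards2; case/and4P: c => _ _ ->.
have [|D [D0D DX Dk cD]] := @grow e _ (k - 4) eA (chain_pair a) s0.
  by rewrite c2 hk andbT; clear -k6; lia.
have dsj (S T : {set I}) (u v : I) : u \in A -> S \subset comp u -> T \subset comp v -> comp u != comp v -> S :&: T = set0.
  move=> uA Su Tv uv; apply/setP => h; rewrite !inE; apply/negP => /andP[hS hT].
  by have := comp_disj uA (subsetP Su h hS) uv; rewrite (subsetP Tv).
have dDf := dsj _ _ _ _ eA DX s1 ef.
have dDg := dsj _ _ _ _ gA s2 DX ge.
have dfg := dsj _ _ _ _ fA s1 s2 fg.
have cU1 : #|D :|: [set f1; f2]| = k - 2.
  by have := cardsUI D [set f1; f2]; rewrite dDf cards0 Dk d2; move: #|_ :|: _| => x; clear -k6; lia.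
have dU : (D :|: [set f1; f2]) :&: [set g1; g2] = set0.
  by rewrite setIUl dfg setIC dDg setU0.
have cU : #|D :|: [set f1; f2] :|: [set g1; g2]| = k.
  by have := cardsUI (D :|: [set f1; f2]) [set g1; g2]; rewrite dU cards0 cU1 b2; move: #|_ :|: _| => x; clear -k6; lia.
have sU : D :|: [set f1; f2] :|: [set g1; g2] \subset A.
  by rewrite subUset [D :|: _ \subset _]subUset (chain_sub cD) (chain_sub (chain_pair b)) (chain_sub (chain_pair c)).
have := H sU cU; rewrite VVU VVU.
have := cardsUI (VV D) (VV [set f1; f2]); rewrite (chain_eq cD) (chain_eq (chain_pair b)) d2 Dk.
have := cardsUI (VV D :|: VV [set f1; f2]) (VV [set g1; g2]); rewrite (chain_eq (chain_pair c)) b2.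
have Q1 : Q \subset VV D by exact: UF_VV Qe D0D.
have Q2 : Q \subset VV [set f1; f2] by exact: UF_VV Qf (subxx _).
have Q3 : Q \subset VV [set g1; g2] by exact: UF_VV Qg (subxx _).
have : 2 <= #|VV D :&: VV [set f1; f2]|.
  by rewrite -(UF_card Qe); apply/subset_leq_card; rewrite subsetI Q1.
have : 2 <= #|(VV D :|: VV [set f1; f2]) :&: VV [set g1; g2]|.
  by rewrite -(UF_card Qe); apply/subset_leq_card; rewrite subsetI Q3 andbT (subset_trans Q1) ?subsetUl.
move: #|_ :|: VV [set g1; g2]| #|_ :&: VV [set g1; g2]| #|VV D :|: _| #|VV D :&: _| => x y z t.
clear -k6; lia.
Qed.

(** * Counting pairs of vertices by components *)

Definition CS := [set comp e | e in A].

Definition OX X := if [pick p : I * I | [&& p.1 \in X, p.2 \in X & adj p.1 p.2]] is Some p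
  then UF p.1 p.2 else set0.

Lemma OX_spec X Q : Q \in OX X ->
  exists e1 e2, [/\ e1 \in X, e2 \in X, adj e1 e2, Q \in UF e1 e2 & OX X = UF e1 e2].
Proof.
rewrite /OX; case: pickP => [[e1 e2] /= /and3P[h1 h2 h3] h|]; last by rewrite inE.
by exists e1, e2.
Qed.

(** Component and coverers together form a chain, which has fewer than [k] elements: a large
    component has few coverers, hence many uncovered pairs. *)
Lemma OX_coverers X : X \in CS -> 2 <= #|X| ->
  exists G : {set I}, [/\ G \subset A, [disjoint G & X],
    forall g, g \in G -> 1 < #|V g :&: VV X|, #|G| + #|OX X| = 4 & #|X| + #|G| < k].
Proof.
case/imsetP => e eA -> X2.
have se : [set e] \subset comp e by rewrite sub1set comp_refl.
have [||g [g' [gX _ /set1P -> a]]] := cross se.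
- by rewrite -card_gt0 cards1.
- by apply: contraTneq X2 => <-; rewrite cards1.
rewrite /OX; case: pickP => [[e1 e2] /= /and3P[h1 h2 h3]|/(_ (e, g))]; last by rewrite /= comp_refl gX a.
have [G [G1 G2 G3 G4]] := coverers eA h1 h2 h3; exists G; split => //.
have := chain_lt (chain_add (comp_chain eA) G1 G2 G3).
by have := cardsUI G (comp e); move: G2; rewrite -setI_eq0 => /eqP ->; rewrite cards0; move: #|_ :|: _| #|comp e| #|G| => x y z; clear; lia.
Qed.

Lemma OX_share2 X Y Q (G : {set I}) : 3 < k -> X \in CS -> Y \in CS -> X != Y -> Q \in OX X -> Q \in OX Y ->
  G \subset A -> [disjoint G & X] -> (forall g, g \in G -> 1 < #|V g :&: VV X|) -> #|X| + #|G| + 2 < k.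
Proof.
move=> k4 /imsetP[e eA ->] /imsetP[f fA ->] ne /OX_spec[e1 [e2 [x1 x2 a Qe _]]].
case/OX_spec => f1 [f2 [y1 y2 b Qf _]] G1 G2 G3.
exact: (share2 k4 eA fA ne x1 x2 a y1 y2 b Qe Qf G1 G2 G3).
Qed.

Lemma OX_share3 X Y Z Q : 5 < k -> X \in CS -> Y \in CS -> Z \in CS -> X != Y -> Y != Z -> Z != X ->
  Q \in OX X -> Q \in OX Y -> Q \in OX Z -> #|X| < k - 4.
Proof.
move=> k6 /imsetP[e eA ->] /imsetP[f fA ->] /imsetP[g gA ->] ef fg ge.
move=> /OX_spec[e1 [e2 [x1 x2 a Qe _]]] /OX_spec[f1 [f2 [y1 y2 b Qf _]]] /OX_spec[g1 [g2 [z1 z2 c Qg _]]].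
exact: (share3 k6 eA fA gA ef fg ge x1 x2 a y1 y2 b z1 z2 c Qe Qf Qg).
Qed.

Lemma CS_card : \sum_(X in CS) #|X| = #|A|.
Proof.
have tr : trivIset CS.
  apply/trivIsetP => X Y /imsetP[e eA ->] /imsetP[f fA ->] ne.
  by rewrite disjoints_subset; apply/subsetP => h he; rewrite inE; exact: comp_disj he ne.
rewrite (eqP tr); congr #|pred_of_set _|; apply/eqP; rewrite eqEsubset; apply/andP; split.
  by apply/bigcupsP => X /imsetP[e eA ->]; exact: comp_sub.
apply/subsetP => e eA; apply/bigcupP; exists (comp e); [exact: imset_f | exact: comp_refl].
Qed.

Lemma sum_mem (T : finType) (B : {set T}) (P : pred T) : \sum_(x in B) P x = #|[set x in B | P x]|.
Proof.
rewrite -sum1_card [LHS]big_mkcond [RHS]big_mkcond; apply: eq_bigr => x _.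
by rewrite !inE; case: (x \in B); case: (P x).
Qed.

(** Every pair of vertices receives at most 2: a covered pair from the only component that covers
    it, an uncovered one by the assumption on [wt]. *)
Lemma weighted_count (c : nat) (O : {set I} -> {set {set 'I_n}}) (wt : {set 'I_n} -> nat) :
  (forall X, O X \subset OX X) ->
  (forall Q, #|[set X in CS | Q \in O X]| * wt Q <= 2) ->
  (forall X, X \in CS -> c * #|X| <= 2 * #|PC X| + \sum_(Q in O X) wt Q) ->
  c * #|A| <= 2 * 'C(n, 2).
Proof.
move=> OO mw h; rewrite -CS_card big_distrr /=; apply: leq_trans (leq_sum _ h) _.
have -> : 2 * 'C(n, 2) = \sum_(Q in pairs) 2.
  rewrite sum_nat_const mulnC -[X in 'C(X, 2)]card_ord -cardsT -card_pairs_in; congr (_ * _).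
  by apply: eq_card => Q; rewrite inE subsetT andbT.
have PCp X : 2 * #|PC X| = \sum_(Q in pairs) 2 * (Q \in PC X).
  rewrite -big_distrr /= sum_mem; congr (_ * _); apply: eq_card => Q.
  by rewrite 2!inE; case: (Q \in pairs).
have OXp X Q : Q \in O X -> Q \in pairs.
  by move/(subsetP (OO X))/OX_spec => [e1 [e2 [_ _ _ /UF_card h' _]]]; rewrite inE h'.
have Op X : \sum_(Q in O X) wt Q = \sum_(Q in pairs) (Q \in O X) * wt Q.
  rewrite [LHS]big_mkcond [RHS]big_mkcond; apply: eq_bigr => Q _.
  by case: ifP => [/OXp ->|_]; rewrite ?mul1n // if_same.
under eq_bigr => X _ do rewrite PCp Op -big_split /=.
rewrite exchange_big /=; apply: leq_sum => Q Qp; rewrite big_split /= -big_distrr /= -big_distrl /=.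
rewrite (sum_mem CS (fun X => Q \in PC X)) (sum_mem CS (fun X => Q \in O X)).
have [->|[X]] := set_0Vmem [set X in CS | Q \in PC X]; first by rewrite cards0 muln0 add0n.
rewrite inE => /andP[XC QX].
have -> : [set X in CS | Q \in PC X] = [set X].
  apply/setP => Y; rewrite inE in_set1; apply/andP/eqP => [[YC]|-> //].
  case/imsetP: YC => f fA ->; case/imsetP: XC QX => e eA -> QX QY.
  exact: (PC_comp_dis fA eA QY QX).
rewrite cards1 (_ : [set _ in _ | Q \in O _] = set0) ?cards0 //.
apply/setP => Y; rewrite inE in_set0; apply/negP => /andP[_ /(subsetP (OO Y))/OX_spec[e1 [e2 [_ _ _ QU _]]]].
move: QX; rewrite inE => /andP[_ /exists_inP[g gX Qg]].
have gA : g \in A by case/imsetP: XC gX => e eA ->; exact: comp_in.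
by have := UF_unc QU gA; rewrite Qg.
Qed.

Lemma PC_CS X : X \in CS -> 5 * #|X| + 1 <= #|PC X|.
Proof. by case/imsetP => e eA ->; apply/PC_ge/comp_chain. Qed.

Lemma CS_gt0 X : X \in CS -> 0 < #|X|.
Proof. by case/imsetP => e eA ->; exact/chain_gt0/comp_chain. Qed.

(** For one or two elements [PC_ge] suffices. A larger component lacks [#|X| - 2], and it has as
    many uncovered pairs, since there are at most [6 - #|X|] coverers. Among such components a pair
    occurs once for k = 5 by [share2], and at most twice for k = 7 by [share3]. *)
Lemma count_odd : k = 5 \/ k = 7 -> 11 * #|A| <= 2 * 'C(n, 2).
Proof.
move=> k57; apply: (@weighted_count 11 (fun X => if 2 < #|X| then OX X else set0) (fun=> 1)).
- by move=> X; case: ifP => _; rewrite ?sub0set.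
- move=> Q; rewrite muln1 leqNgt; apply/negP => /card_gt2P[X [Y [Z [[]]]]]; rewrite !inE.
  case/andP => XC; case: ifP => [X3 QX|]; last by rewrite inE.
  case/andP => YC; case: ifP => [Y3 QY|]; last by rewrite inE.
  case/andP => ZC; case: ifP => [Z3 QZ|]; last by rewrite inE.
  case=> xy yz zx; case: k57 => k57.
    have [G [G1 G2 G3 _ _]] := OX_coverers XC (ltnW X3).
    have k4 : 3 < k by rewrite k57.
    by have := OX_share2 k4 XC YC xy QX QY G1 G2 G3; rewrite k57; move: X3; move: #|X| #|G| => x y; clear; lia.
  have k6 : 5 < k by rewrite k57.
  by have := OX_share3 k6 XC YC ZC xy yz zx QX QY QZ; rewrite k57; move: X3; move: #|X| => x; clear; lia.
move=> X XC; have h := PC_CS XC; have := CS_gt0 XC; rewrite sum1_card; case: ifP => X3 X0.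
  have [G [_ _ _ G4 G5]] := OX_coverers XC (ltnW X3).
  have {k57} k7 : k <= 7 by case: k57 => ->.
  move: #|PC X| #|OX X| #|X| #|G| h G4 G5 k7 => a b x y; clear; lia.
by rewrite cards0; move: X3 h; move: #|X| #|PC X| X0 => x y; clear; lia.
Qed.

(* The weight [3 - m Q] gives each uncovered pair a total of 2, whether it belongs to one
   component or is shared by two. *)
Lemma count_even : k = 6 -> 12 * #|A| <= 2 * 'C(n, 2).
Proof.
move=> k6e; pose m Q := #|[set X in CS | Q \in OX X]|.
have k6 : 5 < k by rewrite k6e.
have k4 : 3 < k by rewrite k6e.
have X2 X Q : X \in CS -> Q \in OX X -> 1 < #|X|.
  move=> XC /OX_spec[e1 [e2 [h1 h2 a _ _]]]; case/and4P: a => _ _ e12 _.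
  by apply/card_gt1P; exists e1, e2.
have m2 Q : m Q <= 2.
  rewrite leqNgt; apply/negP => /card_gt2P[X [Y [Z [[]]]]]; rewrite !inE.
  move=> /andP[XC QX] /andP[YC QY] /andP[ZC QZ] [xy yz zx].
  by have := OX_share3 k6 XC YC ZC xy yz zx QX QY QZ; have := X2 _ _ XC QX; rewrite k6e; move: #|X| => x; clear; lia.
apply: (@weighted_count 12 OX (fun Q => 3 - m Q)) => //.
- by move=> Q; rewrite -/(m Q); have := m2 Q; case: (m Q) => [|[|[|?]]].
move=> X XC; have h := PC_CS XC; have X0 := CS_gt0 XC.
case: (ltnP 1 #|X|) => X1; last first.
  by apply: leq_trans (leq_addr _ _); move: #|X| #|PC X| X0 X1 h => x y; clear; lia.
have [G [G1 G2 G3 G4 G5]] := OX_coverers XC X1.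
(* A shared pair forces [#|X| + #|G|] to be at most 3, so [OX X] has at least [#|X| + 1] pairs and
   weight 1 for each is enough. Otherwise each pair has weight 2, and there are at least [#|X| - 1]
   of them. *)
case: (boolP [exists Q in OX X, 1 < m Q]) => [/exists_inP[Q QX /card_gt1P[Y [Z []]]]|/exists_inPn no].
  rewrite !inE => /andP[YC QY] /andP[ZC QZ] yz.
  have [W [WC QW XW]] : exists W, [/\ W \in CS, Q \in OX W & X != W].
    by case: (eqVneq X Y) => [->|xy]; [exists Z | exists Y].
  have := OX_share2 k4 XC WC XW QX QW G1 G2 G3.
  have : #|OX X| <= \sum_(R in OX X) (3 - m R).
    by rewrite -sum1_card; apply: leq_sum => R _; rewrite subn_gt0 ltnS.
  move: (\sum_(R in OX X) _) #|OX X| #|X| #|PC X| #|G| h G4 X1 => s o x p g; rewrite k6e; clear; lia.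
have : 2 * #|OX X| <= \sum_(R in OX X) (3 - m R).
  rewrite mulnC -sum_nat_const; apply: leq_sum => R RX; have := no R RX; rewrite -leqNgt; move: (m R) => x; clear; lia.
move: (\sum_(R in OX X) _) #|OX X| #|X| #|PC X| #|G| h G4 G5 X1 => s o x p g; rewrite k6e; clear; lia.
Qed.

End Clean.
End Repeats.

(** * The repetitions in a colouring *)

Section FromColouring.
Variables (n k N : nat) (c : {ffun 'I_n * 'I_n -> 'I_N}).
Hypothesis sym : edge_colouring c.
Hypothesis k1 : 1 < k.
Hypothesis kn : 2 * k + 2 <= n.
Hypothesis spans : forall S : {set 'I_n}, #|S| = 2 * k + 2 -> 'C(2 * k + 2, 2) - (k - 1) <= #|span_colours c S|.

Let E := Eg n.
Let col (e : {set 'I_n}) := omap c [pick x : 'I_n * 'I_n | (x.1 != x.2) && (e == [set x.1; x.2])].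
Let rep (e : {set 'I_n}) := odflt e [pick g | (g \in E) && (col g == col e)].

Lemma col_pair (a b : 'I_n) : a != b -> col [set a; b] = Some (c (a, b)).
Proof.
move=> ab; rewrite /col; case: pickP => [[x y] /= /andP[xy /eqP/setP e]|/(_ (a, b))]; last by rewrite ab eqxx.
have := e a; have := e b; rewrite !inE !eqxx orbT /= => /esym/orP hb /esym/orP ha.
have s := forallP sym (a, b); rewrite /= in s; congr Some.
case: ha hb => /eqP ha [] /eqP hb; subst x || subst y => //; try subst; rewrite ?eqxx // in ab *.
by rewrite (eqP s).
Qed.

Lemma repP e : e \in E -> rep e \in E /\ col (rep e) = col e.
Proof.
by move=> eE; rewrite /rep; case: pickP => [g /andP[gE /eqP]|/(_ e)] //; rewrite eE eqxx.
Qed.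

Lemma rep_col e g : e \in E -> g \in E -> col e = col g -> rep e = rep g.
Proof.
move=> eE gE h; rewrite /rep (eq_pick (Q := fun f => (f \in E) && (col f == col g))); last by move=> f; rewrite h.
by case: pickP => // /(_ g); rewrite gE eqxx.
Qed.

Let R := rep @: E.
Let W (e : {set 'I_n}) := e :|: rep e.

Lemma card_R : #|R| <= N.
Proof.
have inj : {in R &, injective col}.
  move=> _ _ /imsetP[e eE ->] /imsetP[g gE ->].
  by have [_ ->] := repP eE; have [_ ->] := repP gE; exact: rep_col.
rewrite -(card_in_imset inj) -[X in _ <= X]card_ord -cardsT -[X in _ <= X](card_imset _ (@Some_inj _)).
apply/subset_leq_card/subsetP => _ /imsetP[g gR ->].
have /cards2P[a [b [ab ->]]] : #|g| == 2.
  by case/imsetP: gR => e eE ->; have [] := repP eE; rewrite inE.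
by rewrite col_pair // imset_f ?inE.
Qed.

(** The elements are the edges that do not represent their colour. If [k] of them, with their
    representatives, fit into [2 * k + 2] vertices, deleting these [k] edges there loses no colour,
    and too few colours are left. *)
Lemma repeats : exists A0 : {set {set 'I_n}}, [/\ 'C(n, 2) <= #|A0| + N,
  forall e, e \in A0 -> 2 < #|W e| <= 4 &
  forall D : {set {set 'I_n}}, D \subset A0 -> #|D| = k -> 2 * k + 3 <= #|VV W D|].
Proof.
exists (E :\: R); split.
- have cE : #|E| = 'C(n, 2).
    by rewrite -[X in 'C(X, 2)]card_ord -cardsT -cards_draws; apply: eq_card => Q; rewrite !inE subsetT.
  have RE : R \subset E by apply/subsetP => _ /imsetP[e eE ->]; have [] := repP eE.
  rewrite cardsD (setIidPr RE) card_Eg; have := card_R; move: #|R| 'C(n, 2) => r b; clear; lia.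
- move=> e; rewrite inE => /andP[eR eE]; have [rE _] := repP eE.
  have re : rep e != e by apply: contraNneq eR => <-; exact: imset_f.
  rewrite 2!inE in eE rE; rewrite /W cardsU (eqP eE) (eqP rE) /=.
  have : #|e :&: rep e| < 2.
    rewrite ltnNge; apply: contraNN re => h; rewrite eq_sym eqEcard (eqP eE) (eqP rE) leqnn andbT.
    apply/setIidPl/eqP; rewrite eqEcard subsetIl (eqP eE) //.
  by move: #|_ :&: _| => x; clear; lia.
move=> D DA Dk; rewrite leqNgt; apply/negP => small.
have [|P PD Pc] := @subset_of_size _ (~: VV W D) (2 * k + 2 - #|VV W D|).
  by have := cardsC (VV W D); rewrite card_ord; move: #|VV W D| #|~: _| => x y; clear -kn small; lia.
pose S := VV W D :|: P.
have Sc : #|S| = 2 * k + 2.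
  rewrite /S cardsU Pc (_ : _ :&: P = set0) ?cards0; last first.
    by apply/eqP; rewrite setI_eq0 disjoint_sym disjoints_subset.
  by move: small; move: #|VV W D| => x; clear; lia.
have := spans Sc.
pose ES := [set e in E | e \subset S].
have DES : D \subset ES.
  apply/subsetP => e eD; rewrite inE; have := subsetP DA e eD; rewrite inE => /andP[_ ->] /=.
  apply: subset_trans (subsetUl _ _); apply: subset_trans (V_VV W eD); exact: subsetUl.
have cES : #|ES| = 'C(2 * k + 2, 2).
  by rewrite -Sc -cards_draws; apply: eq_card => Q; rewrite !inE andbC.
have sub : Some @: span_colours c S \subset col @: (ES :\: D).
  apply/subsetP => y /imsetP[i /imsetP[[a b]]]; rewrite inE /= => /and3P[aS bS ab] -> ->.
  pose e := [set a; b].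
  have eE : e \in E by rewrite inE cards2 ab.
  have eES : e \in ES by rewrite inE eE; apply/subsetP => x /set2P[] ->.
  rewrite -col_pair // -/e; case: (boolP (e \in D)) => eD; last by apply: imset_f; rewrite inE eD.
  have [rE <-] := repP eE; apply: imset_f; rewrite 2!inE rE; apply/andP; split.
    by apply: contraL (imset_f rep eE) => /(subsetP DA); rewrite inE => /andP[].
  apply: subset_trans (subsetUl _ _); apply: subset_trans (V_VV W eD); exact: subsetUr.
have := leq_trans (subset_leq_card sub) (leq_imset_card _ _).
rewrite card_imset; last exact: Some_inj.
rewrite cardsD (setIidPr DES) cES Dk => h1 h2.
have := leq_trans h2 h1; have : k <= 'C(2 * k + 2, 2).
  by rewrite -{1}Dk -cES subset_leq_card.
by move: ('C(_, _)) => x; clear -k1; lia.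
Qed.

Lemma colours_odd : k = 5 \/ k = 7 -> 11 * 'C(n, 2) <= 2 * 'C(n, 2) + 11 * (N + n * k).
Proof.
move=> k57; have [A0 [c0 V0 H0]] := repeats.
have [A [AA cA noOT]] := cleaning H0 (ltnW k1).
have HA (D : {set {set 'I_n}}) : D \subset A -> #|D| = k -> 2 * k + 3 <= #|VV W D| by move=> DA; apply: H0; exact: subset_trans AA.
have := count_odd k1 HA (fun e eA => V0 e (subsetP AA e eA)) noOT k57.
move: #|A| #|A0| 'C(n, 2) (n * k) c0 cA => a a0 b d; clear; lia.
Qed.

Lemma colours_even : k = 6 -> 12 * 'C(n, 2) <= 2 * 'C(n, 2) + 12 * (N + n * k).
Proof.
move=> k57; have [A0 [c0 V0 H0]] := repeats.
have [A [AA cA noOT]] := cleaning H0 (ltnW k1).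
have HA (D : {set {set 'I_n}}) : D \subset A -> #|D| = k -> 2 * k + 3 <= #|VV W D| by move=> DA; apply: H0; exact: subset_trans AA.
have := count_even k1 HA (fun e eA => V0 e (subsetP AA e eA)) noOT k57.
move: #|A| #|A0| 'C(n, 2) (n * k) c0 cA => a a0 b d; clear; lia.
Qed.

End FromColouring.

End Repeats.

(** * Lower bounds for the generalised Ramsey number *)

Module LowerBounds.
Import mathcomp.algebra_tactics.ring mathcomp.algebra_tactics.lra.
Import Order.TTheory GRing.Theory Num.Theory.
Import Colourings UpperBounds Repeats.

Local Open Scope nat_scope.

(** [find] returns a true witness only if the search succeeds in its range. The colouring without
    blocks, in which all edges differ, ensures this. *)
Lemma GR_attained n k : 1 < n -> 0 < k -> has_pq_colouring n (2 * k + 2) ('C(2 * k + 2, 2) - (k - 1)) (GRk n k).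
Proof.
move=> n2 k0; set q := ('C(_, _) - _).
have le : GRk n k <= 'C(n, 2).
  apply: leq_trans (_ : 'C(n, 2) - #|(set0 : {set unit})| <= _); last exact: leq_subr.
  apply: (@GR_upper n k unit set0 (fun=> set0) (fun=> set0)) => //; try by move=> ?; rewrite inE.
  by move=> T' /subset_leq_card; rewrite cards0 => h T'k; move: h; rewrite T'k leqn0 => /eqP h; rewrite h in k0.
have b : 'C(n, 2) <= n * n by rewrite bin2 leq_half_double -addnn; nia.
have hs : has (has_pq_colouring n (2 * k + 2) q) (iota 0 (n * n).+1).
  by rewrite has_find size_iota ltnS (leq_trans le b).
by have := nth_find 0 hs; rewrite nth_iota ?add0n // ltnS (leq_trans le b).
Qed.

Lemma GR_lower_odd n k : k = 5 \/ k = 7 -> 2 * k + 2 <= n -> 9 * (n * n) <= 22 * GRk n k + (22 * k + 9) * n.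
Proof.
move=> k57 kn; have k0 : 1 < k by case: k57 => ->.
have n2 : 1 < n by apply: leq_trans kn; rewrite addn2.
have /existsP[c /andP[s /forallP sp]] := GR_attained n2 (ltnW k0).
have sp' (S : {set 'I_n}) : #|S| = 2 * k + 2 -> 'C(2 * k + 2, 2) - (k - 1) <= #|span_colours c S|.
  by move=> h; have := sp S; rewrite h eqxx.
have := colours_odd s k0 kn sp' k57.
have := mul_bin_left n 1; rewrite bin1 subn1.
move: (GRk n k) 'C(n, 2) n2 => g b; clear; case: n => // n _ /=; nia.
Qed.

Lemma GR_lower_even n : 14 <= n -> 5 * (n * n) <= 12 * GRk n 6 + 77 * n.
Proof.
move=> kn; have k0 : 1 < 6 by [].
have n2 : 1 < n by apply: leq_trans kn.
have /existsP[c /andP[s /forallP sp]] := GR_attained n2 (ltnW k0).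
have sp' (S : {set 'I_n}) : #|S| = 2 * 6 + 2 -> 'C(2 * 6 + 2, 2) - (6 - 1) <= #|span_colours c S|.
  by move=> h; have := sp S; rewrite h eqxx.
have := colours_even s k0 kn sp' erefl.
have := mul_bin_left n 1; rewrite bin1 subn1.
move: (GRk n 6) 'C(n, 2) n2 => g b; clear; case: n => // n _ /=; nia.
Qed.

Local Open Scope ring_scope.
(** Clearing denominators carries the rational estimates over to the real numbers in which the
    limits are stated. *)
Lemma nat_upper (a b : nat) (g : nat -> nat) : (0 < b)%N ->
  (forall eps : rat, 0 < eps -> exists n0 : nat, forall n, (n0 <= n)%N ->
     (g n)%:R <= (a%:R / b%:R + eps) * n%:R ^+ 2) ->
  forall m, (0 < m)%N -> exists n0, forall n, (n0 <= n)%N -> (b * m * g n <= (a * m + b) * (n * n))%N.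
Proof.
move=> b0 h m m0; have mR : (0 < m%:R :> rat) by rewrite ltr0n.
have bR : (0 < b%:R :> rat) by rewrite ltr0n.
have [|n0 H] := h (m%:R^-1); first by rewrite invr_gt0.
exists n0 => n /H {}H; rewrite -(ler_nat rat) !natrM natrD natrM.
have E : ((a%:R / b%:R + m%:R^-1) * n%:R ^+ 2 * (b%:R * m%:R) = (a%:R * m%:R + b%:R) * (n%:R * n%:R) :> rat).
  by field; rewrite !gt_eqF.
by rewrite -E mulrC ler_pM2r // mulr_gt0.
Qed.

Local Close Scope ring_scope.

End LowerBounds.

(** * Limits *)
Import Colourings UpperBounds LowerBounds.
From Stdlib Require Import Reals Lra.

Lemma cv_of_nat_bounds (a b K n1 : nat) (g : nat -> nat) : (0 < b)%nat ->
  (forall m, (0 < m)%nat -> exists n0, forall n, (n0 <= n)%nat -> (b * m * g n <= (a * m + b) * (n * n))%nat) ->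
  (forall n, (n1 <= n)%nat -> (a * (n * n) <= b * g n + K * n)%nat) ->
  Un_cv (fun n => INR (g n) / INR n ^ 2)%R (INR a / INR b)%R.
Proof.
intros b0 up low eps e0.
destruct (archimed_cor1 eps e0) as [m [me m0]].
destruct (up m (introT ssrnat.ltP m0)) as [n0 U].
(* The summand [K * m] makes the linear error [K * n] at most [n * n / m], and the 1 keeps [n]
   positive. *)
exists (n0 + n1 + 1 + K * m)%nat; intros n hn.
assert (U' := le_INR _ _ (elimT ssrnat.leP (U n ltac:(lia)))); assert (L' := le_INR _ _ (elimT ssrnat.leP (low n ltac:(lia)))).
assert (N1 := lt_INR 0 n ltac:(apply/ssrnat.ltP; lia)).
assert (KN := le_INR (K * m) n ltac:(apply/ssrnat.leP; lia)).
assert (B1 := le_INR 1 b (elimT ssrnat.ltP b0)).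
assert (M1 := le_INR 1 m m0).
rewrite ?(mult_INR, plus_INR) in U' L' KN.
change (INR 0) with 0%R in N1; change (INR 1) with 1%R in B1, M1.
revert U' L' N1 KN B1 M1 me.
generalize (INR (g n)) (INR a) (INR b) (INR K) (INR n) (INR m) (pos_INR K); clear.
intros G A B k x M k0 U L x0 KN B1 M1 me.
assert (E : (G / x ^ 2 - A / B = (B * G - A * (x * x)) / (B * (x * x)))%R) by (field; split; lra).
assert (X2 : (0 < x * x)%R) by nra.
assert (D : (0 < B * (x * x))%R) by nra.
assert (Mi : (0 < / M)%R) by (apply Rinv_0_lt_compat; lra).
assert (MM : (M * / M = 1)%R) by (field; lra).
unfold Rdist; rewrite E.
assert (h1 : ((B * G - A * (x * x)) / (B * (x * x)) <= / M)%R).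
  apply (Rmult_le_reg_r _ _ _ D); unfold Rdiv; rewrite Rmult_assoc Rinv_l ?Rmult_1_r; [|lra].
  apply (Rmult_le_reg_l M); [lra|].
  replace (M * (/ M * (B * (x * x))))%R with ((M * / M) * (B * (x * x)))%R by ring.
  rewrite MM; lra.
assert (h2 : (- / M <= (B * G - A * (x * x)) / (B * (x * x)))%R).
  apply (Rmult_le_reg_r _ _ _ D); unfold Rdiv; rewrite Rmult_assoc Rinv_l ?Rmult_1_r; [|lra].
  apply (Rmult_le_reg_l M); [lra|].
  replace (M * (- / M * (B * (x * x))))%R with (- ((M * / M) * (B * (x * x))))%R by ring.
  rewrite MM.
  assert (h3 : (k * M * x <= x * x)%R) by nra.
  assert (h4 : (M * (A * (x * x) - B * G) <= M * (k * x))%R) by (apply Rmult_le_compat_l; lra).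
  nra.
apply Rabs_def1; lra.
Qed.

Lemma cv_odd k p q : k = 5 \/ k = 7 -> p = 2 * k + 2 -> q = 'C(2 * k + 2, 2) - (k - 1) ->
  Un_cv (fun n => INR (GR n p q) / INR n ^ 2)%R (INR 9 / INR 22)%R.
Proof.
move=> k57 -> ->; apply: (@cv_of_nat_bounds 9 22 (22 * k + 9) (2 * k + 2)).
- by [].
- move=> m m0; have [eps e0|n0 H] := @nat_upper 9 22 (fun n => GRk n k) isT _ m m0.
    exact: GR_upper_odd.
  by exists n0.
- by move=> n hn; exact: GR_lower_odd.
Qed.

Lemma cv_even p q : p = 14 -> q = 'C(14, 2) - 5 ->
  Un_cv (fun n => INR (GR n p q) / INR n ^ 2)%R (INR 5 / INR 12)%R.
Proof.
move=> -> ->; apply: (@cv_of_nat_bounds 5 12 77 14).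
- by [].
- move=> m m0; have [eps e0|n0 H] := @nat_upper 5 12 (fun n => GRk n 6) isT _ m m0.
    exact: GR_upper_6.
  by exists n0.
- by move=> n hn; exact: GR_lower_even.
Qed.

Open Scope R_scope.

Theorem theorem1p6 :
  Un_cv (fun n : nat => INR (GR n 12 62) / (INR n ^ 2)) (9 / 22) /\
  Un_cv (fun n : nat => INR (GR n 14 86) / (INR n ^ 2)) (5 / 12) /\
  Un_cv (fun n : nat => INR (GR n 16 114) / (INR n ^ 2)) (9 / 22).
Proof.
have e m : INR m = IZR (Z.of_nat m) by exact: INR_IZR_INZ.
split; last split.
- by have := @cv_odd 5 12 62 (or_introl erefl) erefl erefl; rewrite (e 9%nat) (e 22%nat).
- by have := @cv_even 14 86 erefl erefl; rewrite (e 5%nat) (e 12%nat).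
- by have := @cv_odd 7 16 114 (or_intror erefl) erefl erefl; rewrite (e 9%nat) (e 22%nat).
Qed.
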